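(* Let $\Omega=dx_1\wedge dx_2$ on $\mathbb R^2$. Consider the following real $\mathcal G$-normal forms $A:(\mathbb R^2,0)\to(\mathrm{Sym}_2,O_2)$: 1. $\begin{pmatrix} x_1 & 0 \\ 0 & x_2 \end{pmatrix}$; 2. $\begin{pmatrix} x_1 & x_2 \\ x_2 & -x_1 \end{pmatrix}$; 3. $\begin{pmatrix} x_1 & x_2 \\ x_2 & \pm x_1^\ell \end{pmatrix}$, $\ell\ge2$; 4. $\begin{pmatrix} x_1 & x_2^\ell \\ x_2^\ell & x_1 \end{pmatrix}$, $\ell\ge2$; 5. $\begin{pmatrix} \pm x_2^{\ell_1} & x_1 \\ x_1 & \pm x_2^{\ell_2} \end{pmatrix}$, $\ell_1\ge\ell_2\ge2$; 6. $\begin{pmatrix} x_1 & x_2^2 \\ x_2^2 & \pm x_1^2 \end{pmatrix}$; 7. $\begin{pmatrix} x_1 & 0 \\ 0 & \pm x_2^2\pm x_1^\ell \end{pmatrix}$, $\ell\ge2$; 8. $\begin{pmatrix} x_1 & 0 \\ 0 & x_1x_2\pm x_1^\ell \end{pmatrix}$, $\ell\ge3$; 9. $\begin{pmatrix} x_1 & x_2^\ell \\ x_2^\ell & x_1x_2 \end{pmatrix}$, $\ell\ge2$; 10. $\begin{pmatrix} x_1 & 0 \\ 0 & \pm x_1^2+x_2^3 \end{pmatrix}$. All of them are symmetrically quasi-homogeneous, and only the singularities 8–10 split into two different unimodular (volume-preserving equivalence) singularities; each of the $\mathcal G$-classes 1–7 is a single volume-preserving equivalence class. The unimodular normal forms,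 with their $\mathcal G_e$-codimension (cod) and weights $(\lambda_1,\lambda_2)$ of symmetrical quasi-homogeneity, are: - the normal forms 1–7 above, with: 1: cod $1$, $(1,1)$; 2: cod $1$, $(1,1)$; 3: cod $\ell$, $(2,\ell+1)$; 4: cod $2\ell-1$, $(\ell,1)$; 5: cod $\ell_1+\ell_2-1$, $(\ell_1+\ell_2,2)$; 6: cod $6$, $(4,3)$; 7: cod $\ell+2$, $(2,\ell)$; - $8^\pm$: $\begin{pmatrix} x_1 & 0 \\ 0 & \pm x_1x_2\pm x_1^\ell \end{pmatrix}$, $\ell\ge3$; cod $2\ell$, $(1,\ell-1)$ (the two classes into which 8 splits correspond to the sign of $x_1x_2$); - $9^+$: $\begin{pmatrix} x_1 & x_2^\ell \\ x_2^\ell & x_1x_2 \end{pmatrix}$ and $9^-$: $\begin{pmatrix} -x_1 & x_2^\ell \\ x_2^\ell & -x_1x_2 \end{pmatrix}$, $\ell\ge2$; cod $2\ell+1$, $(2\ell-1,2)$; - $10^\pm$: $\begin{pmatrix} x_1 & 0 \\ 0 & \pm x_1^2\pm x_2^3 \end{pmatrix}$; cod $7$, $(3,2)$ (the two classes into which 10 splits correspond to the sign of $x_2^3$).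
   Context: $\mathrm{Sym}_n$ and $\mathrm{GL}_n$ are the real symmetric and the real invertible $n\times n$ matrices, $M_n$ all real $n\times n$ matrices, $O_n$ the $n\times n$ zero matrix; $C^\infty(\mathbb R^r,S)$ is the space of smooth map-germs at $0\in\mathbb R^r$ with values in $S$. $A,B\in C^\infty(\mathbb R^r,\mathrm{Sym}_n)$ are $\mathcal G$-equivalent if $B=X^T(A\circ\Phi)X$ for some diffeomorphism-germ $\Phi:(\mathbb R^r,0)\to(\mathbb R^r,0)$ and some $X\in C^\infty(\mathbb R^r,\mathrm{GL}_n)$; they are volume-preserving (unimodular) equivalent if this holds with some $\Phi$ satisfying $\Phi^*\Omega=\Omega$. The $\mathcal G_e$-codimension of $A$ is the real dimension of the quotient of $C^\infty(\mathbb R^r,\mathrm{Sym}_n)$ by the subspace $\{dA(V)+U^TA+AU\}$, where $V$ ranges over all smooth vector field-germs at $0\in\mathbb R^r$ (not necessarily vanishing at $0$) and $U$ over $C^\infty(\mathbb R^r,M_n)$. $A\in C^\infty(\mathbb R^r,\mathrm{Sym}_n)$ is symmetrically quasi-homogeneous if there exist a coordinate system $(x_1,\dots,x_r)$ on $(\mathbb R^r,0)$, non-negative integers $\lambda_1,\dots,\lambda_r$ (weights) with $\sum_k\lambda_k>0$, non-negative integers $\delta_1,\dots,\delta_n$ (quasi-degrees), and $X\in C^\infty(\mathbb R^r,\mathrm{GL}_n)$ such that $B=X^TAX$ satisfies $B_{ij}(t^{\lambda_1}x_1,\dots,t^{\lambda_r}x_r)=t^{\frac12(\delta_i+\delta_j)}B_{ij}(x_1,\dots,x_r)$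 for any $t\in\mathbb R$ and all $i,j$.
   Formalization: In item 8 and 8^± the first diagonal entry x_1 is replaced by x_2, since diag(x_1, x_1x_2 ± x_1^ℓ) has infinite codimension, not 2ℓ; and for odd ℓ the two classes into which 8 splits also differ in the sign of x_1^ℓ. *)

(* Defs.v *)
From HB Require Import structures.
From mathcomp Require Import all_boot all_order all_algebra.
From mathcomp Require Import all_classical all_reals all_analysis.

Set Implicit Arguments.
Unset Strict Implicit.
Unset Printing Implicit Defensive.

Import Order.TTheory GRing.Theory Num.Theory.
Import numFieldNormedType.Exports.

Local Open Scope classical_set_scope.
Local Open Scope ring_scope.

(* A germ at 0 is represented by a total function on R^r; only its behaviour
   near 0 matters in every definition below, and equality of germs is equality
   on a neighbourhood of 0. *)

Section Germs.
Context {R : realType} {r : nat} {W : normedModType R}.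
Implicit Type f : 'rV[R]_r -> W.

Definition partial (i : 'I_r) f : 'rV[R]_r -> W :=
  fun x => 'D_(delta_mx 0 i) f x.

Definition iter_partial (s : seq 'I_r) f : 'rV[R]_r -> W :=
  foldr partial f s.

(* C^oo: on a common neighbourhood of 0, the iterated partial derivatives of
   all orders exist and are Frechet differentiable. *)
Definition smooth_germ f : Prop :=
  \forall x \near (0 : 'rV[R]_r), forall s : seq 'I_r,
    differentiable (iter_partial s f) x.

End Germs.

Section Equivalences.
Context {R : realType} {r n : nat}.
Implicit Types (A B C : 'rV[R]_r -> 'M[R]_n) (Phi Psi : 'rV[R]_r -> 'rV[R]_r).

Definition sym_germ A : Prop :=
  smooth_germ A /\ \forall x \near (0 : 'rV[R]_r), (A x)^T = A x.

Definition GL_germ (X : 'rV[R]_r -> 'M[R]_n) : Prop :=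
  smooth_germ X /\ \forall x \near (0 : 'rV[R]_r), X x \in unitmx.

Definition diffeo_germ Phi : Prop :=
  [/\ smooth_germ Phi, Phi 0 = 0 &
    exists Psi, [/\ smooth_germ Psi, Psi 0 = 0,
      \forall x \near (0 : 'rV[R]_r), Psi (Phi x) = x &
      \forall x \near (0 : 'rV[R]_r), Phi (Psi x) = x]].

Definition congruent_via Phi A B : Prop :=
  exists2 X : 'rV[R]_r -> 'M[R]_n, GL_germ X &
    \forall x \near (0 : 'rV[R]_r), B x = (X x)^T *m A (Phi x) *m X x.

Definition G_equiv A B : Prop :=
  exists2 Phi, diffeo_germ Phi & congruent_via Phi A B.

(* A 2-form is a function of a point and two tangent vectors. *)
Definition pullback2 Phi (Omega : 'rV[R]_r -> 'rV[R]_r -> 'rV[R]_r -> R) :=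
  fun x u v => Omega (Phi x) ('d Phi x u) ('d Phi x v).

Definition preserves2 Phi (Omega : 'rV[R]_r -> 'rV[R]_r -> 'rV[R]_r -> R) :=
  \forall x \near (0 : 'rV[R]_r), forall u v,
    pullback2 Phi Omega x u v = Omega x u v.

Definition vp_equiv (Omega : 'rV[R]_r -> 'rV[R]_r -> 'rV[R]_r -> R) A B : Prop :=
  exists Phi, [/\ diffeo_germ Phi, preserves2 Phi Omega & congruent_via Phi A B].

(* C belongs to the extended tangent space {dA(V) + U^T A + A U}. *)
Definition Ge_tangent A C : Prop :=
  exists (V : 'rV[R]_r -> 'rV[R]_r) (U : 'rV[R]_r -> 'M[R]_n),
    [/\ smooth_germ V, smooth_germ U &
      \forall x \near (0 : 'rV[R]_r),
        C x = 'd A x (V x) + (U x)^T *m A x + A x *m U x].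

(* The quotient of the symmetric germs by the extended tangent space of A has
   dimension d: the classes of some e_0, ..., e_(d-1) form a basis of it. *)
Definition Ge_codim A (d : nat) : Prop :=
  exists e : 'I_d -> 'rV[R]_r -> 'M[R]_n,
    [/\ forall k, sym_germ (e k),
        forall C, sym_germ C -> exists c : 'I_d -> R,
          Ge_tangent A (fun x => C x - \sum_k c k *: e k x) &
        forall c : 'I_d -> R,
          Ge_tangent A (fun x => \sum_k c k *: e k x) -> forall k, c k = 0].

(* t^(m/2) for any real t. If m is odd and t < 0 this is 0 by convention; this
   is harmless in sym_qh_in, since there a smooth entry of half-integer
   quasi-degree vanishes near 0 by the equations for t >= 0 alone. *)
Definition half_pow (t : R) (m : nat) : R :=
  if odd m then Num.sqrt t ^+ m else t ^+ m./2.

Definition weighted_scale (lam : 'I_r -> nat) (t : R) (x : 'rV[R]_r) : 'rV[R]_r :=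
  \row_k (t ^+ lam k * x 0 k).

(* Symmetric quasi-homogeneity of A in the coordinate system Psi^-1 (that is,
   Psi x is the point with coordinates x), with weights lam. *)
Definition sym_qh_in Psi (lam : 'I_r -> nat) A : Prop :=
  (0 < \sum_k lam k)%N /\
  exists (delta : 'I_n -> nat) (X : 'rV[R]_r -> 'M[R]_n), GL_germ X /\
    let B y := (X y)^T *m A y *m X y in
    forall (t : R) i j, \forall x \near (0 : 'rV[R]_r),
      B (Psi (weighted_scale lam t x)) i j =
      half_pow t (delta i + delta j) * B (Psi x) i j.

Definition sym_quasi_homogeneous A : Prop :=
  exists Psi lam, diffeo_germ Psi /\ sym_qh_in Psi lam A.

(* The G-class of A is a single Omega-preserving class. *)
Definition one_vp_class Omega A : Prop :=
  forall B, sym_germ B -> (G_equiv A B <-> vp_equiv Omega A B).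

(* The G-class of A is the union of exactly two Omega-preserving classes, those
   of A1 and A2. *)
Definition two_vp_classes Omega A A1 A2 : Prop :=
  ~ vp_equiv Omega A1 A2 /\
  forall B, sym_germ B ->
    (G_equiv A B <-> vp_equiv Omega A1 B \/ vp_equiv Omega A2 B).

End Equivalences.

Section Plane.
Context {R : realType}.

Definition dx1dx2 (_ u v : 'rV[R]_2) : R := u 0 0 * v 0 1 - u 0 1 * v 0 0.

(* The symmetric matrix (a b; b d). *)
Definition sym2 (a b d : R) : 'M[R]_2 :=
  \matrix_(i, j) if i != j then b else if i == 0 then a else d.

Definition plane_germ (F : R -> R -> 'M[R]_2) (x : 'rV[R]_2) : 'M[R]_2 :=
  F (x 0 0) (x 0 1).

Definition pair_weights (a b : nat) (k : 'I_2) : nat := if k == 0 then a else b.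

(* A is symmetrically quasi-homogeneous, with weights (a, b) in the given
   coordinates, and has extended codimension c. *)
Definition qh_data (A : 'rV[R]_2 -> 'M[R]_2) (c a b : nat) : Prop :=
  [/\ sym_quasi_homogeneous A, sym_qh_in id (pair_weights a b) A & Ge_codim A c].

(* In each family below, the boolean parameters encode the independent signs:
   (-1) ^+ false = 1 and (-1) ^+ true = -1. *)

Definition nf1 := plane_germ (fun x1 x2 => sym2 x1 0 x2).

Definition nf2 := plane_germ (fun x1 x2 => sym2 x1 x2 (- x1)).

Definition nf3 (s : bool) (l : nat) :=
  plane_germ (fun x1 x2 => sym2 x1 x2 ((-1) ^+ s * x1 ^+ l)).

Definition nf4 (l : nat) :=
  plane_germ (fun x1 x2 => sym2 x1 (x2 ^+ l) x1).

Definition nf5 (s1 s2 : bool) (l1 l2 : nat) :=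
  plane_germ (fun x1 x2 =>
    sym2 ((-1) ^+ s1 * x2 ^+ l1) x1 ((-1) ^+ s2 * x2 ^+ l2)).

Definition nf6 (s : bool) :=
  plane_germ (fun x1 x2 => sym2 x1 (x2 ^+ 2) ((-1) ^+ s * x1 ^+ 2)).

Definition nf7 (s1 s2 : bool) (l : nat) :=
  plane_germ (fun x1 x2 =>
    sym2 x1 0 ((-1) ^+ s1 * x2 ^+ 2 + (-1) ^+ s2 * x1 ^+ l)).

(* The first entry has to be x2: the germ diag(x1, x1 x2 +- x1^l) has infinite
   extended codimension, since the off-diagonal entry of every element of its
   extended tangent space is divisible by x1. *)
Definition nf8 (e s : bool) (l : nat) :=
  plane_germ (fun x1 x2 =>
    sym2 x2 0 ((-1) ^+ e * (x1 * x2) + (-1) ^+ s * x1 ^+ l)).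

Definition nf9 (e : bool) (l : nat) :=
  plane_germ (fun x1 x2 =>
    sym2 ((-1) ^+ e * x1) (x2 ^+ l) ((-1) ^+ e * (x1 * x2))).

Definition nf10 (s e : bool) :=
  plane_germ (fun x1 x2 =>
    sym2 x1 0 ((-1) ^+ s * x1 ^+ 2 + (-1) ^+ e * x2 ^+ 3)).

End Plane.

(* Main.v *)
From HB Require Import structures.
Require Import Defs.
From mathcomp Require Import all_boot all_order all_algebra.
From mathcomp Require Import all_classical all_reals all_analysis.
From mathcomp Require Import zify ring lra.

(* If B is G-equivalent to a quasi-homogeneous A through Phi, then Phi can be
   corrected by a scaling x |-> (u(x)^l1 x1, u(x)^l2 x2), which is a symmetry of
   A up to congruence.  Its Jacobian is prescribed by Euler's equation for a
   power of u, solved by an integral, so every Jacobian that is positive at 0 is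
   attained.  Hence a G-class consists of at most two volume-preserving classes,
   those of A and of its mirror image, and of only one if A has an
   orientation-reversing symmetry.  For 8-10 the two classes are distinguished
   by the lowest-order terms of an equivalence along lines through 0.
   The codimensions come from dividing the entries of a symmetric germ by powers
   of the coordinates (Hadamard's lemma); the monomial remainders are shown to be
   independent modulo the tangent space by restriction to lines through 0. *)

Set Implicit Arguments.
Unset Strict Implicit.
Unset Printing Implicit Defensive.

Import Order.TTheory GRing.Theory Num.Theory.
Import numFieldNormedType.Exports.

Local Open Scope classical_set_scope.
Local Open Scope ring_scope.

(** The Jacobian of x |-> (u^l1 x1, u^l2 x2) contains no product of two partial derivatives of u:
    with N = l1 + l2 and K = u^N it equals K + E(K)/N, where E is the weighted Euler field.
    Prescribing it is therefore a linear problem in K. At 0 this Jacobian is u(0)^N > 0, so scalings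
    never change orientation; a constant linear involution of determinant -1 takes care of the other
    half. Since a function u is substituted for the scaling parameter, quasi-homogeneity is needed
    as an identity in all t and x, not as an identity of germs for each t. A smooth germ has one
    neighbourhood that serves all orders of differentiation. For this reason each analytic
    construction is followed on a fixed open set, with the order as a separate parameter. In the
    codimension counts a single generator often acts on two entries at once, so a multiple of it
    that cancels a term in one entry leaves a monomial in the other. Independence then needs the
    value of that generator at 0. All lines through 0 share these values, so an equation on one line
    can be used on another. *)

Lemma nbhs_open (T : topologicalType) (x : T) (A : set T) : nbhs x A ->
  exists U, [/\ open U, U x & U `<=` A].
Proof. by rewrite nbhsE => -[U [oU Ux] UA]; exists U. Qed.

(** * Fréchet derivatives in epsilon form *)

Section Differentiability.
Context {R : realType} {V W : normedModType R}.
Implicit Types f g : V -> W.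

Lemma differentiable_lin (f : V -> W) (x : V) (df : {linear V -> W}) :
  continuous df ->
  (forall e, 0 < e -> \forall h \near 0, `|f (h + x) - f x - df h| <= e * `|h|) ->
  differentiable f x /\ 'd f x = df :> (V -> W).
Proof.
move=> cdf H.
have E : f \o shift x = cst (f x) + df +o_ (0 : V) id.
  apply/eqaddoP => e e0; near=> h => /=.
  by rewrite !fctE opprD addrA; near: h; exact: H.
have dE := diff_unique cdf E.
by split=> //; apply/diff_locallyP; rewrite dE.
Unshelve. all: by end_near. Qed.

Lemma differentiable_near f x : differentiable f x ->
  forall e, 0 < e -> \forall h \near 0, `|f (h + x) - f x - 'd f x h| <= e * `|h|.
Proof.
move=> /diff_locally /eqaddoP H e e0.
by near do rewrite -addrA -opprD; exact: H.
Unshelve. all: by end_near. Qed.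

Lemma near_eq_diff f g x : {near x, f =1 g} -> differentiable f x ->
  differentiable g x /\ 'd g x = 'd f x :> (V -> W).
Proof.
move=> fg df; apply: differentiable_lin => [|e e0].
  exact: diff_continuous.
have fgx := nbhs_singleton fg.
near=> h; rewrite -fgx.
have <- : f (h + x) = g (h + x).
  by near: h; rewrite -[nbhs 0]/(nbhs (0:V)); move: fg; rewrite (near_shift 0)/= subr0.
by near: h; exact: differentiable_near.
Unshelve. all: by end_near. Qed.

End Differentiability.

(** * C^k functions *)

Section Partials.
Context {R : realType} {r : nat} {W : normedModType R}.
Implicit Types (f g : 'rV[R]_r -> W) (U : set 'rV[R]_r).

Lemma diff_partialE f x v : differentiable f x ->
  'd f x v = \sum_i v 0 i *: partial i f x.
Proof.
move=> df; rewrite {1}(row_sum_delta v) linear_sum; apply: eq_bigr => i _.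
by rewrite linearZ /= /partial deriveE.
Qed.

Lemma partialE i f x : differentiable f x ->
  partial i f x = 'd f x (delta_mx 0 i).
Proof. by move=> df; rewrite /partial deriveE. Qed.

Lemma eq_partial i f g x : {near x, f =1 g} -> partial i f x = partial i g x.
Proof. by move=> fg; exact: near_eq_derive. Qed.

(** A class between C^k and C^(k+1): the partial derivatives of order at most k are Fréchet
    differentiable, hence continuous. The set [U] does not depend on [k], as [smooth_germ]
    requires. *)
Fixpoint ck (k : nat) U f : Prop :=
  (forall x, U x -> differentiable f x) /\
  (if k is k'.+1 then forall i, ck k' U (partial i f) else True).

Lemma ck_diff k U f x : ck k U f -> U x -> differentiable f x.
Proof. by case: k => [|k] [+ _]; apply. Qed.

Lemma ck_partial k U f i : ck k.+1 U f -> ck k U (partial i f).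
Proof. by move=> [_ H]; exact: H. Qed.

Lemma ckW k U f : ck k.+1 U f -> ck k U f.
Proof.
elim: k f => [|k IH] f [d H]; split=> // i.
by apply: IH; exact: H.
Qed.

Lemma ck_sub k U U' f : U' `<=` U -> ck k U f -> ck k U' f.
Proof.
move=> sU; elim: k f => [|k IH] f [d H]; split=> //.
- by move=> x /sU /d.
- by move=> x /sU /d.
by move=> i; apply: IH; exact: H.
Qed.

Lemma open_near_eq U f g x : open U -> {in U, f =1 g} -> U x -> {near x, f =1 g}.
Proof.
move=> oU fg Ux; have nU : nbhs x U by exact: open_nbhs_nbhs.
by apply: filterS nU => y Uy; apply: fg; rewrite inE.
Qed.

Lemma eq_ck k U f g : open U -> {in U, f =1 g} -> ck k U f -> ck k U g.
Proof.
move=> oU; elim: k f g => [|k IH] f g fg [d H]; split=> //.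
- by move=> x Ux; have [] := near_eq_diff (open_near_eq oU fg Ux) (d _ Ux).
- by move=> x Ux; have [] := near_eq_diff (open_near_eq oU fg Ux) (d _ Ux).
move=> i; apply: IH (H i) => x /set_mem Ux.
exact/eq_partial/(open_near_eq oU fg Ux).
Qed.

Lemma ckP k U f : ck k U f <->
  forall s : seq 'I_r, (size s <= k)%N -> forall x, U x -> differentiable (iter_partial s f) x.
Proof.
elim: k f => [|k IH] f; split.
- by move=> [d _] [].
- by move=> H; split=> //; exact: (H [::]).
- move=> [d H] s; case/lastP: s => [|s i]; first by move=> _; exact: d.
  rewrite size_rcons ltnS => sk; have /IH := H i.
  by rewrite /iter_partial foldr_rcons; apply.
- move=> H; split; first exact: (H [::]).
  move=> i; apply/IH => s sk; have := H (rcons s i).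
  by rewrite /iter_partial foldr_rcons size_rcons; apply.
Qed.

Lemma smooth_germP f : smooth_germ f <->
  exists U, [/\ open U, U 0 & forall k, ck k U f].
Proof.
split.
  move=> /nbhs_open[U [oU U0 H]]; exists U; split=> // k.
  apply/ckP => s _ x Ux.
  exact: H.
move=> [U [oU U0 H]]; rewrite /smooth_germ.
have nU : nbhs (0 : 'rV[R]_r) U by exact: open_nbhs_nbhs.
apply: filterS nU => x Ux s; have /ckP := H (size s); exact.
Qed.

Lemma smooth_germ_diff f : smooth_germ f -> \forall x \near (0 : 'rV[R]_r), differentiable f x.
Proof. by move=> H; apply: filterS H => x /(_ [::]). Qed.

Lemma smooth_germ_cvg f : smooth_germ f -> {for 0, continuous f}.
Proof.
move=> /smooth_germ_diff /nbhs_singleton; exact: differentiable_continuous.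
Qed.

Lemma smooth_germ_partial i f : smooth_germ f -> smooth_germ (partial i f).
Proof.
move=> /smooth_germP[U [oU U0 H]]; apply/smooth_germP; exists U; split=> // k.
exact: ck_partial (H k.+1).
Qed.

Lemma ck_cst k U (c : W) : ck k U (cst c).
Proof.
elim: k c => [|k IH] c; split=> //.
move=> i; suff -> : partial i (cst c : 'rV[R]_r -> W) = cst 0 by exact: IH.
by apply/funext => x; rewrite /partial derive_cst.
Qed.

Lemma ckD k U f g : open U -> ck k U f -> ck k U g -> ck k U (fun x => f x + g x).
Proof.
move=> oU; elim: k f g => [|k IH] f g [df Hf] [dg Hg]; split=> //.
- by move=> x Ux; apply: differentiableD; [exact: df|exact: dg].
- by move=> x Ux; apply: differentiableD; [exact: df|exact: dg].
move=> i; apply: eq_ck (IH _ _ (Hf i) (Hg i)) => // x /set_mem Ux.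
by rewrite /partial -[RHS]/('D_(delta_mx 0 i) (f + g) x) deriveD//;
  apply: diff_derivable; [exact: df|exact: dg].
Qed.

Lemma ck_sum k U (I : Type) (s : seq I) (P : pred I) (F : I -> 'rV[R]_r -> W) : open U ->
  (forall i, P i -> ck k U (F i)) -> ck k U (fun x => \sum_(i <- s | P i) F i x).
Proof.
move=> oU H; elim: s => [|i s IH].
  by under eq_fun do rewrite big_nil; exact: ck_cst.
under eq_fun do rewrite big_cons.
by case Pi : (P i); [apply: ckD => //; exact: H|].
Qed.

End Partials.

Section LinearImage.
Context {R : realType} {r : nat} {W W' : normedModType R}.

Lemma ck_lin k (U : set 'rV[R]_r) (L : {linear W -> W'}) f : open U -> continuous L ->
  ck k U f -> ck k U (fun x => L (f x)).
Proof.
move=> oU cL; elim: k f => [|k IH] f [d H]; split=> //.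
- move=> x Ux; apply: (@differentiable_comp _ _ _ _ f L); first exact: d.
  exact: linear_differentiable.
- move=> x Ux; apply: (@differentiable_comp _ _ _ _ f L); first exact: d.
  exact: linear_differentiable.
move=> i; apply: eq_ck (IH _ (H i)) => // x /set_mem Ux.
have dL y : differentiable L y by exact: linear_differentiable.
rewrite !partialE; last 2 first.
- by apply: (@differentiable_comp _ _ _ _ f L) => //; exact: d.
- exact: d.
have /= -> := @diff_comp _ _ _ _ f L x (d x Ux) (dL _).
by rewrite diff_lin.
Qed.

End LinearImage.

Section Scalar.
Context {R : realType} {r : nat}.
Implicit Types (f g : 'rV[R]_r -> R) (U : set 'rV[R]_r).

Lemma partialD i f g x : differentiable f x -> differentiable g x ->
  partial i (fun x => f x + g x) x = partial i f x + partial i g x.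
Proof.
by move=> df dg; rewrite /partial -[LHS]/('D_(delta_mx 0 i) (f + g) x) deriveD//;
  apply: diff_derivable.
Qed.

Lemma partialM i f g x : differentiable f x -> differentiable g x ->
  partial i (fun x => f x * g x) x = partial i f x * g x + f x * partial i g x.
Proof.
move=> df dg; rewrite /partial -[LHS]/('D_(delta_mx 0 i) (f * g) x) deriveM;
  try exact: diff_derivable.
by rewrite addrC mulrC; congr (_ + _); rewrite mulrC.
Qed.

Lemma ckM k U f g : open U -> ck k U f -> ck k U g -> ck k U (fun x => f x * g x).
Proof.
move=> oU; elim: k f g => [|k IH] f g Hf Hg; split=> //.
- by move=> x Ux; apply: differentiableM; [exact: ck_diff Hf _|exact: ck_diff Hg _].
- by move=> x Ux; apply: differentiableM; [exact: ck_diff Hf _|exact: ck_diff Hg _].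
move=> i; apply: (@eq_ck _ _ _ _ _ (fun x => partial i f x * g x + f x * partial i g x)) => //.
  move=> x /set_mem Ux; rewrite partialM//; [exact: ck_diff Hf _|exact: ck_diff Hg _].
by apply: ckD => //; apply: IH => //; [exact: ck_partial|exact: ckW|exact: ckW|exact: ck_partial].
Qed.

Lemma ckN k U f : open U -> ck k U f -> ck k U (fun x => - f x).
Proof.
move=> oU H; apply: (@eq_ck _ _ _ _ _ (fun x => -1 * f x)) => //.
  by move=> x _; rewrite mulN1r.
by apply: ckM => //; exact: ck_cst.
Qed.

Lemma ck_prod k U (I : Type) (s : seq I) (P : pred I) (F : I -> 'rV[R]_r -> R) : open U ->
  (forall i, P i -> ck k U (F i)) -> ck k U (fun x => \prod_(i <- s | P i) F i x).
Proof.
move=> oU H; elim: s => [|i s IH].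
  by under eq_fun do rewrite big_nil; exact: ck_cst.
under eq_fun do rewrite big_cons.
by case Pi : (P i); [apply: ckM => //; exact: H|].
Qed.

Lemma ckX k U n f : open U -> ck k U f -> ck k U (fun x => f x ^+ n).
Proof.
move=> oU H; elim: n => [|n IH]; first exact: ck_cst.
by under eq_fun do rewrite exprS; exact: ckM.
Qed.

(* Closure under an outer function phi whose derivative is again phi times a
   rational expression: covers inversion and real powers at once. *)
Lemma ck_outer k U (phi : R -> R) f (u : 'rV[R]_r -> R) : open U ->
  (forall x, U x -> is_derive (f x) (1 : R) phi (u x)) ->
  (forall k', ck k' U (phi \o f) -> ck k' U f -> ck k' U u) ->
  ck k U f -> ck k U (phi \o f).
Proof.
move=> oU dphi Hu.
have d k' : ck k' U f -> forall x, U x -> differentiable (phi \o f) x.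
  move=> Hf x Ux; apply: differentiable_comp; first exact: ck_diff Hf _.
  by apply/derivable1_diffP; case: (dphi x Ux).
elim: k => [|k IH] Hf; split=> //; try exact: d Hf.
move=> i; apply: (@eq_ck _ _ _ _ _ (fun x => u x * partial i f x)) => //.
  move=> x /set_mem Ux; rewrite !partialE; last 2 first.
  - exact: d Hf x Ux.
  - exact: ck_diff Hf _.
  have dp : differentiable phi (f x) by apply/derivable1_diffP; case: (dphi x Ux).
  have df : differentiable f x by exact: ck_diff Hf _.
  have chain a : 'd phi (f x) a = a * u x.
    have {1}-> : a = a *: (1 : R) by rewrite [RHS]mulr1.
    by rewrite linearZ/= -deriveE//; case: (dphi x Ux) => _ ->.
  have -> : 'd (phi \o f) x = ('d phi (f x) \o 'd f x) :> ('rV[R]_r -> R).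
    exact: diff_comp.
  by rewrite /= chain mulrC.
apply: ckM => //; last exact: ck_partial.
by apply: Hu; [apply: IH; exact: ckW|exact: ckW].
Qed.

Lemma ckV k U f : open U -> (forall x, U x -> f x != 0) -> ck k U f ->
  ck k U (fun x => (f x)^-1).
Proof.
move=> oU f0; apply: (@ck_outer _ _ _ _ (fun x => - ((f x)^-1 ^+ 2))) => //.
  move=> x Ux; have := f0 _ Ux => fx0.
  have dV := differentiable_Rinv fx0.
  apply: DeriveDef; first exact/derivable1_diffP.
  by rewrite deriveE// diff_Rinv//= exprVn scaler1.
by move=> k' H _; apply: ckN => //; exact: ckX.
Qed.

Lemma ck_powR k U f (p : R) : open U -> (forall x, U x -> 0 < f x) -> ck k U f ->
  ck k U (fun x => f x `^ p).
Proof.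
move=> oU f0; apply: (@ck_outer _ _ (@powR R ^~ p) _
   (fun x => p * (f x `^ p * (f x)^-1))) => //.
  move=> x Ux; have := f0 _ Ux => fx0.
  have xi : f x \in `]0, +oo[ by rewrite in_itv/= fx0.
  apply: DeriveDef; first exact: derivable_powR.
  rewrite -derive1E powR_derive1//; congr (_ * _).
  by rewrite powRB ?(gt_eqF fx0) ?implybT// powRr1// ltW.
move=> k' H Hf; apply: ckM => //; first exact: ck_cst.
by apply: ckM => //; apply: ckV => // x Ux; rewrite gt_eqF// f0.
Qed.

Lemma partial_coord i j (x : 'rV[R]_r) :
  partial i (fun x : 'rV[R]_r => x 0 j) x = (i == j)%:R.
Proof.
rewrite partialE; last exact: differentiable_coord.
pose f : 'rV[R]_r -> R := fun N => N 0 j.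
have fl : linear f by move=> a u v; rewrite /f !mxE.
pose fL := GRing.isLinear.Build _ _ _ _ f fl.
pose F : {linear 'rV[R]_r -> R} := HB.pack f fL.
rewrite -[(fun x : 'rV[R]_r => x 0 j)]/(F : 'rV[R]_r -> R) diff_lin.
  by rewrite /= /f mxE eqxx /= eq_sym.
exact: coord_continuous.
Qed.

Lemma ck_coord k U j : ck k U (fun x : 'rV[R]_r => x 0 j).
Proof.
elim: k => [|k IH]; split=> //.
- by move=> x _; exact: differentiable_coord.
- by move=> x _; exact: differentiable_coord.
move=> i; suff -> : partial i (fun x : 'rV[R]_r => x 0 j) = cst (i == j)%:R by exact: ck_cst.
by apply/funext => x; rewrite partial_coord.
Qed.

Lemma ck_mxP k U m n (X : 'rV[R]_r -> 'M[R]_(m, n)) : open U ->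
  ck k U X <-> (forall i j, ck k U (fun x => X x i j)).
Proof.
move=> oU; split=> [H i j|H].
  pose f : 'M[R]_(m, n) -> R := fun N => N i j.
  have fl : linear f by move=> a u v; rewrite /f !mxE.
  pose fL := GRing.isLinear.Build _ _ _ _ f fl.
  pose F : {linear 'M[R]_(m, n) -> R} := HB.pack f fL.
  by apply: (@ck_lin _ _ _ _ _ _ F) => //; exact: coord_continuous.
have -> : X = fun x => \sum_i \sum_j X x i j *: delta_mx i j.
  by apply/funext => x; exact: matrix_sum_delta.
apply: ck_sum => // i _; apply: ck_sum => // j _.
pose L (a : R) : 'M[R]_(m, n) := a *: delta_mx i j.
have Ll : linear L by move=> a u v; rewrite /L scalerDl scalerA.
pose LL := GRing.isLinear.Build _ _ _ _ L Ll.
pose F : {linear R -> 'M[R]_(m, n)} := HB.pack L LL.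
by apply: (@ck_lin _ _ _ _ _ _ F) => //; exact: scalel_continuous.
Qed.

End Scalar.

Section ChainRule.
Context {R : realType} {r s : nat}.

Lemma differentiable_mxP m n (X : 'rV[R]_r -> 'M[R]_(m, n)) x :
  differentiable X x -> forall i j, differentiable (fun x => X x i j) x.
Proof.
move=> d i j; apply: (@differentiable_comp _ _ _ _ X (fun N : 'M[R]_(m, n) => N i j)) => //.
exact: differentiable_coord.
Qed.

Lemma partial_mx m n (X : 'rV[R]_r -> 'M[R]_(m, n)) x k i j : differentiable X x ->
  partial k X x i j = partial k (fun x => X x i j) x.
Proof. by move=> d; rewrite /partial derive_mx ?mxE//; exact: diff_derivable. Qed.

Lemma partial_comp (Phi : 'rV[R]_r -> 'rV[R]_s) (f : 'rV[R]_s -> R) i x :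
  differentiable Phi x -> differentiable f (Phi x) ->
  partial i (f \o Phi) x = \sum_j partial i (fun x => Phi x 0 j) x * partial j f (Phi x).
Proof.
move=> dP df; rewrite partialE; last exact: differentiable_comp.
rewrite diff_comp//= diff_partialE//; apply: eq_bigr => j _.
by rewrite -partialE// partial_mx.
Qed.

Lemma ck_comp k (U : set 'rV[R]_r) (U' : set 'rV[R]_s) (Phi : 'rV[R]_r -> 'rV[R]_s) (f : 'rV[R]_s -> R) :
  open U -> open U' -> (forall x, U x -> U' (Phi x)) ->
  ck k U Phi -> ck k U' f -> ck k U (f \o Phi).
Proof.
move=> oU oU' UU'.
have d k' f' : ck k' U Phi -> ck k' U' f' -> forall x, U x -> differentiable (f' \o Phi) x.
  move=> HP Hf x Ux; apply: differentiable_comp; first exact: ck_diff HP _.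
  by apply: ck_diff Hf _; exact: UU'.
elim: k f => [|k IH] f HP Hf; split=> //; try exact: d HP Hf.
move=> i; apply: (@eq_ck _ _ _ _ _
  (fun x => \sum_j partial i (fun x => Phi x 0 j) x * (partial j f \o Phi) x)) => //.
  move=> x /set_mem Ux; rewrite partial_comp//; first exact: ck_diff HP _.
  by apply: ck_diff Hf _; exact: UU'.
apply: ck_sum => // j _; apply: ckM => //.
  by apply: ck_partial; move/(ck_mxP _ _ oU): HP; apply.
by apply: IH; [exact: ckW|exact: ck_partial].
Qed.

End ChainRule.

Lemma ck_le {R : realType} {r : nat} {W : normedModType R} k k' (U : set 'rV[R]_r)
  (f : 'rV[R]_r -> W) : (k' <= k)%N -> ck k U f -> ck k' U f.
Proof.
move=> kk /ckP H; apply/ckP => s sk; apply: H; exact: leq_trans kk.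
Qed.

(** * Closure properties of smooth germs *)

Section SmoothGerms.
Context {R : realType} {r : nat}.
Implicit Types (f g : 'rV[R]_r -> R).

Lemma smooth_germ2P f g : smooth_germ f -> smooth_germ g ->
  exists U : set 'rV[R]_r, [/\ open U, U 0 & forall k, ck k U f /\ ck k U g].
Proof.
move=> /smooth_germP[U [oU U0 Hf]] /smooth_germP[U' [oU' U0' Hg]].
exists (U `&` U'); split; [exact: openI|by []|move=> k; split].
  by apply: ck_sub (Hf k) => x [].
by apply: ck_sub (Hg k) => x [].
Qed.

Lemma smooth_germ_cst {W : normedModType R} (c : W) : smooth_germ (cst c : 'rV[R]_r -> W).
Proof.
by apply/smooth_germP; exists setT; split=> //; [exact: openT|move=> k; exact: ck_cst].
Qed.

Lemma smooth_germ_coord j : smooth_germ (fun x : 'rV[R]_r => x 0 j).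
Proof.
by apply/smooth_germP; exists setT; split=> //; [exact: openT|move=> k; exact: ck_coord].
Qed.

Lemma smooth_germD f g : smooth_germ f -> smooth_germ g -> smooth_germ (fun x => f x + g x).
Proof.
move=> sf sg; have [U [oU U0 H]] := smooth_germ2P sf sg.
by apply/smooth_germP; exists U; split=> // k; apply: ckD => //; case: (H k).
Qed.

Lemma smooth_germM f g : smooth_germ f -> smooth_germ g -> smooth_germ (fun x => f x * g x).
Proof.
move=> sf sg; have [U [oU U0 H]] := smooth_germ2P sf sg.
by apply/smooth_germP; exists U; split=> // k; apply: ckM => //; case: (H k).
Qed.

Lemma smooth_germN f : smooth_germ f -> smooth_germ (fun x => - f x).
Proof.
move=> /smooth_germP[U [oU U0 H]].
by apply/smooth_germP; exists U; split=> // k; exact: ckN.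
Qed.

Lemma smooth_germX n f : smooth_germ f -> smooth_germ (fun x => f x ^+ n).
Proof.
move=> /smooth_germP[U [oU U0 H]].
by apply/smooth_germP; exists U; split=> // k; exact: ckX.
Qed.

Lemma smooth_germ_sum (I : Type) (s : seq I) (P : pred I) (F : I -> 'rV[R]_r -> R) :
  (forall i, P i -> smooth_germ (F i)) ->
  smooth_germ (fun x => \sum_(i <- s | P i) F i x).
Proof.
move=> H; elim: s => [|i s IH].
  by under eq_fun do rewrite big_nil; exact: smooth_germ_cst.
under eq_fun do rewrite big_cons.
by case Pi : (P i); [apply: smooth_germD => //; exact: H|].
Qed.

Lemma smooth_germ_prod (I : Type) (s : seq I) (P : pred I) (F : I -> 'rV[R]_r -> R) :
  (forall i, P i -> smooth_germ (F i)) ->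
  smooth_germ (fun x => \prod_(i <- s | P i) F i x).
Proof.
move=> H; elim: s => [|i s IH].
  by under eq_fun do rewrite big_nil; exact: smooth_germ_cst.
under eq_fun do rewrite big_cons.
by case Pi : (P i); [apply: smooth_germM => //; exact: H|].
Qed.

Lemma continuous_open_sub {W : topologicalType} (U : set 'rV[R]_r) (f : 'rV[R]_r -> W) (A : set W) x :
  open U -> U x -> {for x, continuous f} -> open A -> A (f x) ->
  exists U', [/\ open U', U' x, U' `<=` U & forall y, U' y -> A (f y)].
Proof.
move=> oU Ux cf oA Afx.
have nA : nbhs x (f @^-1` A) by apply: cf; exact: open_nbhs_nbhs.
have nU : nbhs x U by exact: open_nbhs_nbhs.
have [U' [oU' U'x H]] := nbhs_open (filterI nU nA).
by exists U'; split=> // y /H[].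
Qed.

Lemma smooth_germV f : f 0 != 0 -> smooth_germ f -> smooth_germ (fun x => (f x)^-1).
Proof.
move=> f0 sf; have cf := smooth_germ_cvg sf.
move/smooth_germP : sf => [U [oU U0 H]].
have [U' [oU' U'0 UU' HU']] := @continuous_open_sub _ U f [set y | y != 0] 0 oU U0 cf (@open_neq R 0) f0.
apply/smooth_germP; exists U'; split=> // k; apply: ckV => //.
exact: ck_sub (H k).
Qed.

Lemma smooth_germ_powR f p : 0 < f 0 -> smooth_germ f -> smooth_germ (fun x => f x `^ p).
Proof.
move=> f0 sf; have cf := smooth_germ_cvg sf.
move/smooth_germP : sf => [U [oU U0 H]].
have [U' [oU' U'0 UU' HU']] := @continuous_open_sub _ U f [set y | 0 < y] 0 oU U0 cf (@open_gt R 0) f0.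
apply/smooth_germP; exists U'; split=> // k; apply: ck_powR => //.
exact: ck_sub (H k).
Qed.

Lemma smooth_germ_mxP m n (X : 'rV[R]_r -> 'M[R]_(m, n)) :
  smooth_germ X <-> forall i j, smooth_germ (fun x => X x i j).
Proof.
split=> [/smooth_germP[U [oU U0 H]] i j|H].
  by apply/smooth_germP; exists U; split=> // k; move/(ck_mxP k _ oU): (H k); apply.
(* The neighbourhoods of the finitely many entries are intersected before any order [k] is fixed. *)
have : forall s : seq ('I_m * 'I_n), exists U : set 'rV[R]_r, [/\ open U, U 0 &
    forall i, i \in s -> forall k, ck k U (fun x => X x i.1 i.2)].
  elim=> [|[i j] s [U [oU U0 HU]]]; first by exists setT; split=> //; exact: openT.
  have /smooth_germP[U' [oU' U0' HU']] := H i j.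
  exists (U `&` U'); split; [exact: openI|by []|].
  move=> [i' j']; rewrite inE => /predU1P[[-> ->] k|/HU sk k].
    by apply: ck_sub (HU' k) => x [].
  by apply: ck_sub (sk k) => x [].
move=> /(_ (enum {: 'I_m * 'I_n}))[U [oU U0 HU]].
apply/smooth_germP; exists U; split=> // k; apply/ck_mxP => // i j.
by apply: (HU (i, j)); rewrite mem_enum.
Qed.

End SmoothGerms.

Section SmoothComp.
Context {R : realType} {r s : nat}.

Lemma smooth_germ_comp (Phi : 'rV[R]_r -> 'rV[R]_s) (f : 'rV[R]_s -> R) :
  smooth_germ Phi -> Phi 0 = 0 -> smooth_germ f -> smooth_germ (f \o Phi).
Proof.
move=> sP P0 sf; have cP := smooth_germ_cvg sP.
move/smooth_germP : sP => [U [oU U0 H]].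
move/smooth_germP : sf => [V [oV V0 HV]].
have VP0 : V (Phi 0) by rewrite P0.
have [U' [oU' U'0 UU' HU']] := continuous_open_sub oU U0 cP oV VP0.
apply/smooth_germP; exists U'; split=> // k.
apply: (ck_comp oU' oV) => //; exact: ck_sub (H k).
Qed.

Lemma smooth_germ_comp_mx m n (Phi : 'rV[R]_r -> 'rV[R]_s) (X : 'rV[R]_s -> 'M[R]_(m, n)) :
  smooth_germ Phi -> Phi 0 = 0 -> smooth_germ X -> smooth_germ (X \o Phi).
Proof.
move=> sP P0 /smooth_germ_mxP sX; apply/smooth_germ_mxP => i j.
exact: smooth_germ_comp (sX i j).
Qed.

End SmoothComp.

Section SmoothMatrix.
Context {R : realType} {r : nat}.

Lemma smooth_germ_mulmx m n p (X : 'rV[R]_r -> 'M[R]_(m, n)) (Y : 'rV[R]_r -> 'M[R]_(n, p)) :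
  smooth_germ X -> smooth_germ Y -> smooth_germ (fun x => X x *m Y x).
Proof.
move=> /smooth_germ_mxP sX /smooth_germ_mxP sY; apply/smooth_germ_mxP => i j.
under eq_fun do rewrite mxE.
by apply: smooth_germ_sum => k _; exact: smooth_germM.
Qed.

Lemma ck_det k (U : set 'rV[R]_r) n (X : 'rV[R]_r -> 'M[R]_n) : open U ->
  (forall i j, ck k U (fun x => X x i j)) -> ck k U (fun x => \det (X x)).
Proof.
move=> oU H; rewrite /determinant.
apply: ck_sum => // s _; apply: ckM => //; first exact: ck_cst.
by apply: ck_prod => // i _; exact: H.
Qed.

Lemma ck_adj k (U : set 'rV[R]_r) n (X : 'rV[R]_r -> 'M[R]_n) i j : open U ->
  (forall i j, ck k U (fun x => X x i j)) -> ck k U (fun x => (\adj (X x)) i j).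
Proof.
move=> oU H; under eq_fun do rewrite mxE /cofactor.
apply: ckM => //; first exact: ck_cst.
apply: ck_det => // i' j'; under eq_fun do rewrite !mxE.
exact: H.
Qed.

End SmoothMatrix.

(** * Bounds on balls and the mean value inequality *)

Section Norms.
Context {R : realType}.

Lemma ler_coord_norm r (x : 'rV[R]_r) i : `|x 0 i| <= `|x|.
Proof. by rewrite [leRHS]/Num.Def.normr/= mx_normrE; exact: (le_bigmax _ _ (0, i)). Qed.

Lemma norm_le_coord r (x : 'rV[R]_r) e : 0 <= e -> (forall i, `|x 0 i| <= e) -> `|x| <= e.
Proof.
move=> e0 H; rewrite [leLHS]/Num.Def.normr/= mx_normrE (bigmax_le _ e0)//= => -[i j] _ /=.
by rewrite ord1.
Qed.

Lemma ball0P r (x : 'rV[R]_r) e : ball 0 e x <-> `|x| < e.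
Proof. by rewrite -ball_normE /ball_/= sub0r normrN. Qed.

Lemma ck_ball_bounded r (f : 'rV[R]_r -> R) (e rho : R) : ck 0 (ball 0 e) f ->
  rho < e -> exists2 M : R, 0 <= M & forall x : 'rV[R]_r, `|x| <= rho -> `|f x| <= M.
Proof.
move=> cf re; have [r0|r0] := ltP rho 0.
  by exists 0 => // x xr; have := le_lt_trans xr r0; rewrite ltNge normr_ge0.
pose A := [set x : 'rV[R]_r | `|x| <= rho].
have cA : compact A.
  apply: bounded_closed_compact.
    exists rho; split; first exact: num_real.
    by move=> M rM x /= xA; rewrite (le_trans xA)// ltW.
  by apply: closed_comp (@closed_le _ rho) => x _; exact: norm_continuous.
have : compact (f @` A).
  apply: continuous_compact => //; apply: continuous_in_subspaceT => x /set_mem xA.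
  by apply/differentiable_continuous/(ck_diff cf)/ball0P; exact: le_lt_trans re.
move=> /compact_bounded[M [_ HM]]; exists (`|M| + 1); first by rewrite addr_ge0.
move=> x xA; apply: (HM (`|M| + 1)); last by exists x.
by rewrite (le_lt_trans (ler_norm M))// ltrDl.
Qed.

(** The norm is the maximum norm, so a differential with all partials bounded by [L] has operator
    norm at most [r * L]; this is the origin of the factor [r]. *)
Lemma mean_value_bound r (f : 'rV[R]_r -> R) (x y : 'rV[R]_r) L :
  (forall t : R, 0 <= t <= 1 -> differentiable f (x + t *: (y - x))) ->
  (forall (t : R) i, 0 <= t <= 1 -> `|partial i f (x + t *: (y - x))| <= L) ->
  `|f y - f x| <= r%:R * L * `|y - x|.
Proof.
move=> df bf; pose g (t : R) := f (x + t *: (y - x)).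
pose p (t : R) : 'rV[R]_r := x + t *: (y - x).
have dp (t : R) : is_diff t p (fun h => h *: (y - x)).
  rewrite (_ : (fun h => _) = 0 + (fun h : R => h *: (y - x))); last first.
    by apply/funext => h; rewrite fctE add0r.
  exact: is_diffD.
have dg (t : R) : 0 <= t <= 1 -> is_derive t (1 : R) g ('d f (p t) (y - x)).
  move=> t01; have dpt := dp t; have dft := df t t01.
  have dgt : differentiable (f \o p) t by apply: differentiable_comp.
  apply: DeriveDef; first exact/derivable1_diffP.
  rewrite deriveE//.
  have -> : 'd (f \o p) t = ('d f (p t) \o 'd p t) :> (R -> R) by exact: diff_comp.
  by rewrite /= (@diff_val _ _ _ _ _ _ _ dpt) scale1r.
have [c c01 E] : exists2 c, c \in `[(0:R), 1]%R & g 1 - g 0 = 'd f (p c) (y - x) * (1 - 0).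
  apply: (@MVT_segment _ g (fun t => 'd f (p t) (y - x))) => //.
    by move=> t; rewrite in_itv/= => /andP[t0 t1]; apply: dg; rewrite !ltW.
  apply: continuous_in_subspaceT => t /set_mem; rewrite /= in_itv/= => t01.
  by apply/differentiable_continuous/derivable1_diffP; have [] := dg t t01.
have -> : f y - f x = g 1 - g 0 by rewrite /g scale1r scale0r addr0 subrKC.
rewrite in_itv/= in c01.
rewrite E subr0 mulr1 diff_partialE; last exact: df.
apply: le_trans (ler_norm_sum _ _ _) _.
rewrite -mulrA mulr_natl -[X in _ *+ X](card_ord r) -sumr_const.
apply: ler_sum => i _; rewrite normrM mulrC ler_pM//; first exact: bf.
exact: ler_coord_norm.
Qed.

End Norms.

(** * Averages along weighted scalings *)

Section UnitInterval.
Context {R : realType}.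
Implicit Types (g : R -> R) (c : R).

Local Notation mu := (@lebesgue_measure R).

Definition int01 g : R := (\int[mu]_(t in `[0%R, 1%R]) g t)%R.

(** Two-sided continuity, also at 0 and 1, and so stronger than continuity within the interval. The
    integrands below extend past both ends, and sums and products reduce to limits at a point. *)
Definition cont01 g := forall t : R, 0 <= t <= 1 -> {for t, continuous g}.

Lemma cont01_within g : cont01 g -> {within `[0, 1], continuous g}.
Proof.
move=> cg; apply: continuous_in_subspaceT => t /set_mem; rewrite /= in_itv/=.
exact: cg.
Qed.

Lemma cont01_integrable g : cont01 g -> mu.-integrable `[0, 1] (EFin \o g).
Proof.
move=> cg; apply: continuous_compact_integrable; first exact: segment_compact.
exact: cont01_within.
Qed.

Lemma cont01D g1 g2 : cont01 g1 -> cont01 g2 -> cont01 (fun t => g1 t + g2 t).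
Proof. by move=> c1 c2 t t01; apply: cvgD; [exact: c1|exact: c2]. Qed.

Lemma cont01N g : cont01 g -> cont01 (fun t => - g t).
Proof. by move=> c1 t t01; apply: cvgN; exact: c1. Qed.

Lemma cont01M g1 g2 : cont01 g1 -> cont01 g2 -> cont01 (fun t => g1 t * g2 t).
Proof. by move=> c1 c2 t t01; apply: cvgM; [exact: c1|exact: c2]. Qed.

Lemma cont01_cst c : cont01 (fun=> c).
Proof. by move=> t _; exact: cvg_cst. Qed.

Lemma cont01_sum (I : Type) (s : seq I) (F : I -> R -> R) :
  (forall i, cont01 (F i)) -> cont01 (fun t => \sum_(i <- s) F i t).
Proof.
move=> H; elim: s => [|i s IH].
  by under eq_fun do rewrite big_nil; exact: cont01_cst.
by under eq_fun do rewrite big_cons; exact: cont01D.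
Qed.

Lemma cont01X n : cont01 (fun t => t ^+ n).
Proof. by move=> t _; exact: exprn_continuous. Qed.

Lemma int01D g1 g2 : cont01 g1 -> cont01 g2 ->
  int01 (fun t => g1 t + g2 t) = int01 g1 + int01 g2.
Proof. by move=> c1 c2; rewrite /int01 RintegralD//; exact: cont01_integrable. Qed.

Lemma int01B g1 g2 : cont01 g1 -> cont01 g2 ->
  int01 (fun t => g1 t - g2 t) = int01 g1 - int01 g2.
Proof. by move=> c1 c2; rewrite /int01 RintegralB//; exact: cont01_integrable. Qed.

Lemma int01Z c g : cont01 g -> int01 (fun t => c * g t) = c * int01 g.
Proof. by move=> cg; rewrite /int01 RintegralZl//; exact: cont01_integrable. Qed.

Lemma int01_cst c : int01 (fun=> c) = c.
Proof.
have E : mu `[0%R, 1%R]%classic = 1%E.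
  by rewrite lebesgue_measure_itv/= lte_fin ltr01 oppr0 adde0.
by rewrite /int01 Rintegral_cst// [X in fine X]E mulr1.
Qed.

Lemma int01_sum (I : Type) (s : seq I) (F : I -> R -> R) :
  (forall i, cont01 (F i)) ->
  int01 (fun t => \sum_(i <- s) F i t) = \sum_(i <- s) int01 (F i).
Proof.
move=> H; elim: s => [|i s IH].
  by under eq_fun do rewrite big_nil; rewrite big_nil int01_cst.
under eq_fun do rewrite big_cons.
by rewrite big_cons int01D ?IH//; exact: cont01_sum.
Qed.

Lemma int01_norm_le g c : cont01 g -> (forall t : R, 0 <= t <= 1 -> `|g t| <= c) ->
  `|int01 g| <= c.
Proof.
move=> cg H; have ig := cont01_integrable cg.
apply: le_trans (le_normr_Rintegral _ ig) _ => //.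
rewrite -[leRHS]int01_cst; apply: le_Rintegral => //.
- apply: cont01_integrable => t t01; apply: cvg_norm; exact: cg.
- by apply: cont01_integrable; exact: cont01_cst.
Qed.

Lemma int01_derive g dg : (forall t : R, 0 <= t <= 1 -> is_derive t 1 g (dg t)) ->
  cont01 dg -> int01 dg = g 1 - g 0.
Proof.
move=> dgP cdg.
have cg : cont01 g.
  move=> t t01; apply/differentiable_continuous/derivable1_diffP.
  by have [] := dgP t t01.
rewrite /int01 /Rintegral (@continuous_FTC2 _ _ g)//.
- exact: cont01_within.
- split.
  + by move=> t; rewrite in_itv/= => /andP[t0 t1]; have [] := dgP t; rewrite ?ltW.
  + by apply: cvg_at_right_filter; apply: cg; rewrite lexx ler01.
  + by apply: cvg_at_left_filter; apply: cg; rewrite lexx ler01.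
move=> t; rewrite in_itv/= => /andP[t0 t1]; have [] := dgP t; first by rewrite !ltW.
by rewrite derive1E.
Qed.

End UnitInterval.

Lemma ler_sum_term {R : numDomainType} (I : finType) (F : I -> R) i :
  (forall j, 0 <= F j) -> F i <= \sum_j F j.
Proof. by move=> F0; rewrite (bigD1 i)//= lerDl sumr_ge0. Qed.

Section QuasiHomogeneousMean.
Context {R : realType} {r : nat}.
Implicit Types (f : 'rV[R]_r -> R) (x h : 'rV[R]_r) (lam : 'I_r -> nat).

(** The weighted average of f over the orbit of x under scalings with t in [0, 1]. A partial
    derivative in direction k brings out a factor t^(lam k), so derivatives of such averages are
    again such averages, with a larger exponent [m]. *)
Definition qh_mean m lam f x : R := int01 (fun t => t ^+ m * f (weighted_scale lam t x)).

Lemma weighted_scaleD lam t x h :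
  weighted_scale lam t (h + x) = weighted_scale lam t h + weighted_scale lam t x.
Proof. by apply/rowP => k; rewrite !mxE mulrDr. Qed.

Lemma weighted_scale1 lam x : weighted_scale lam 1 x = x.
Proof. by apply/rowP => k; rewrite !mxE expr1n mul1r. Qed.

Lemma weighted_scale_norm lam t x : 0 <= t <= 1 -> `|weighted_scale lam t x| <= `|x|.
Proof.
move=> /andP[t0 t1]; apply: norm_le_coord => // k.
rewrite mxE normrM -[leRHS]mul1r ler_pM//; last exact: ler_coord_norm.
by rewrite ger0_norm ?exprn_ge0// exprn_ile1.
Qed.

Lemma weighted_scale_is_derive lam x (t : R) :
  is_derive t 1 (fun t => weighted_scale lam t x)
    (\row_k ((lam k)%:R * t ^+ (lam k).-1 * x 0 k)).
Proof.
have d k : is_derive t (1 : R) (fun t : R => t ^+ lam k * x 0 k) ((lam k)%:R * t ^+ (lam k).-1 * x 0 k).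
  have -> : (fun t : R => t ^+ lam k * x 0 k) = x 0 k \*: (fun t : R => t ^+ lam k).
    by apply/funext => u /=; rewrite mulrC.
  apply: is_derive_eq; first apply: is_deriveZ.
    apply: DeriveDef; first exact: exprn_derivable.
    by rewrite exp_derive.
  by rewrite /GRing.scale/= mulr1 mulrC.
have dm : derivable (fun t => weighted_scale lam t x) t 1.
  apply/derivable_mxP => i j.
  under eq_fun do rewrite mxE.
  by have [] := d j.
apply: DeriveDef => //; rewrite derive_mx//; apply/rowP => k; rewrite !mxE.
by under eq_fun do rewrite mxE; have [_ ->] := d k.
Qed.

Lemma weighted_scale_comp_is_derive lam x (t : R) f :
  differentiable f (weighted_scale lam t x) ->
  is_derive t 1 (fun t => f (weighted_scale lam t x))
    (\sum_k (lam k)%:R * t ^+ (lam k).-1 * x 0 k * partial k f (weighted_scale lam t x)).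
Proof.
move=> df; pose p (t : R) := weighted_scale lam t x.
have [dp vp] : is_derive t (1 : R) p _ := weighted_scale_is_derive lam x t.
have dfp : differentiable p t by apply/derivable1_diffP.
have dc : differentiable (f \o p) t by exact: differentiable_comp.
apply: DeriveDef; first exact/derivable1_diffP.
rewrite deriveE//.
have -> : 'd (f \o p) t = ('d f (p t) \o 'd p t) :> (R -> R) by exact: diff_comp.
have E : 'd p t (1 : R) = _ := etrans (esym (deriveE (1 : R) dfp)) vp.
rewrite /= E diff_partialE//; apply: eq_bigr => k _.
by rewrite mxE.
Qed.

Lemma cont01_qh m lam f x e : (forall y, `|y| < e -> differentiable f y) -> `|x| < e ->
  cont01 (fun t => t ^+ m * f (weighted_scale lam t x)).
Proof.
move=> df xe; apply: cont01M; first exact: cont01X.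
move=> t t01; apply/differentiable_continuous/derivable1_diffP.
have [] // := @weighted_scale_comp_is_derive lam x t f.
by apply: df; exact: le_lt_trans (weighted_scale_norm _ _ t01) xe.
Qed.

(** A second-order Taylor bound that is uniform in t, which justifies differentiation under the
    integral without a convergence theorem. The mean value inequality is applied twice, to f minus
    its linear part and to the partials of f; each use costs a factor [r]. *)
Lemma qh_mean_remainder e f : ck 2 (ball 0 e) f -> forall x, `|x| < e ->
  exists2 C : R, 0 <= C & \forall h \near (0 : 'rV[R]_r), `|h + x| < e /\
    forall lam (t : R), 0 <= t <= 1 ->
    `|f (weighted_scale lam t (h + x)) - f (weighted_scale lam t x) -
      \sum_k t ^+ lam k * h 0 k * partial k f (weighted_scale lam t x)| <= C * `|h| ^+ 2.
Proof.
move=> cf x xe.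
(* Halfway between [|x|] and [e]: the closed ball of radius [rho] is compact, lies in the domain,
   and contains all the scaled segments for small h. *)
pose rho := (`|x| + e) / 2.
have xr : `|x| < rho by rewrite /rho; lra.
have re : rho < e by rewrite /rho; lra.
have df y : `|y| <= rho -> differentiable f y.
  by move=> yr; apply: (ck_diff cf); apply/ball0P; exact: le_lt_trans re.
have ddf k y : `|y| <= rho -> differentiable (partial k f) y.
  move=> yr; apply: (ck_diff (ck_partial k cf)); apply/ball0P; exact: le_lt_trans re.
have [M M0 HM] : exists2 M : R, 0 <= M & forall i j (y : 'rV[R]_r), `|y| <= rho ->
    `|partial i (partial j f) y| <= M.
  have B i j : exists M : R, 0 <= M /\ forall y : 'rV[R]_r, `|y| <= rho ->
      `|partial i (partial j f) y| <= M.
    have [M M0 HM] := ck_ball_bounded (ck_partial i (ck_partial j cf)) re.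
    by exists M.
  pose N i j := projT1 (cid (B i j)).
  have N0 i j : 0 <= N i j by rewrite /N; case: cid => M [].
  have NH i j y : `|y| <= rho -> `|partial i (partial j f) y| <= N i j.
    by rewrite /N; case: cid => M [? H]; exact: H.
  exists (\sum_i \sum_j N i j); first by do 2![apply: sumr_ge0 => ? _].
  move=> i j y yr; apply: le_trans (NH i j y yr) _.
  apply: le_trans (ler_sum_term i _); first exact: ler_sum_term.
  by move=> i'; apply: sumr_ge0.
exists (r%:R * (r%:R * M)); first by rewrite !mulr_ge0.
near=> h.
have hr : `|h| + `|x| <= rho.
  rewrite -lerBrDr ltW//; near: h.
  have rx : 0 < rho - `|x| by rewrite subr_gt0.
  have /nbhs_ballP : nbhs (0 : 'rV[R]_r) (ball 0 (rho - `|x|)) by exact: nbhsx_ballx.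
  move=> [d d0 H]; apply/nbhs_ballP; exists d => // y /H /ball0P.
  exact.
split; first by rewrite (le_lt_trans _ re)// (le_trans (ler_normD _ _)).
move=> lam t t01; rewrite weighted_scaleD.
set z := weighted_scale lam t x; set k := weighted_scale lam t h.
have kh : `|k| <= `|h| by exact: weighted_scale_norm.
have zx : `|z| <= `|x| by exact: weighted_scale_norm.
(* The partials of [q] are the partials of f minus their values at [z], hence of size O(|h|) on the
   segment from [z] to [k + z]. *)
pose q (y : 'rV[R]_r) := f y - \sum_i y 0 i * partial i f z.
have -> : f (k + z) - f z - \sum_i t ^+ lam i * h 0 i * partial i f z = q (k + z) - q z.
  rewrite /q.
  have -> : \sum_i (k + z) 0 i * partial i f z =
      \sum_i t ^+ lam i * h 0 i * partial i f z + \sum_i z 0 i * partial i f z.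
    by rewrite -big_split; apply: eq_bigr => i _; rewrite /k /z !mxE/= mulrDl.
  lra.
have seg (s : R) : 0 <= s <= 1 -> `|z + s *: (k + z - z)| <= rho.
  move=> /andP[s0 s1]; rewrite addrK (le_trans (ler_normD _ _))//.
  apply: le_trans hr; rewrite addrC lerD// normrZ ger0_norm//.
  by rewrite -[leRHS]mul1r ler_pM.
have dlin y : differentiable (fun y : 'rV[R]_r => \sum_i y 0 i * partial i f z) y.
  apply: (@ck_diff _ _ _ 0 setT) => //.
  apply: ck_sum; first exact: openT.
  move=> i _; apply: ckM; [exact: openT|exact: ck_coord|exact: ck_cst].
have plin i y : partial i (fun y : 'rV[R]_r => \sum_j y 0 j * partial j f z) y = partial i f z.
  rewrite -[LHS]/('D_(delta_mx 0 i) (fun y : 'rV[R]_r => \sum_j y 0 j * partial j f z) y).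
  have -> : (fun y : 'rV[R]_r => \sum_j y 0 j * partial j f z) =
     \sum_j (fun y : 'rV[R]_r => y 0 j * partial j f z).
    by apply/funext => u; rewrite fct_sumE.
  have dj j : differentiable (fun y : 'rV[R]_r => y 0 j * partial j f z) y.
    by apply: differentiableM; [exact: differentiable_coord|exact: differentiable_cst].
  rewrite derive_sum; last by move=> j; exact: diff_derivable.
  rewrite (bigD1 i)//= big1 ?addr0 => [|j ji].
    rewrite -[LHS]/(partial i _ y) (@partialM _ _ i (fun y => y 0 i) (cst _)).
    - by rewrite partial_coord eqxx mul1r /partial derive_cst mulr0 addr0.
    - exact: differentiable_coord.
    - exact: differentiable_cst.
  rewrite -[LHS]/(partial i _ y) (@partialM _ _ i (fun y => y 0 j) (cst _)).
  - by rewrite partial_coord eq_sym (negPf ji) mul0r /partial derive_cst mulr0 addr0.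
  - exact: differentiable_coord.
  - exact: differentiable_cst.
have Q := @mean_value_bound _ _ q z (k + z) (r%:R * M * `|h|).
apply: le_trans (Q _ _) _.
- move=> s s01; apply: differentiableB => //; apply: df; exact: seg.
- move=> s i s01; set y := z + _.
  have yr : `|y| <= rho by exact: seg.
  have -> : partial i q y = partial i f y - partial i f z.
    rewrite /partial /q deriveB; last 2 first.
    - exact/diff_derivable/df.
    - exact/diff_derivable.
    by congr (_ - _); exact: plin.
  have segy (u : R) : 0 <= u <= 1 -> `|z + u *: (y - z)| <= rho.
    move=> /andP[u0 u1]; rewrite /y addrAC subrr add0r scalerA; apply: seg.
    move: s01 => /andP[s0 s1]; rewrite mulr_ge0//= -[leRHS]mul1r ler_pM//.
  apply: le_trans (@mean_value_bound _ _ (partial i f) z y M _ _) _.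
  + by move=> u /segy; exact: ddf.
  + by move=> u j /segy; exact: HM.
  rewrite ler_wpM2l ?mulr_ge0// /y addrAC subrr add0r addrK normrZ.
  move: s01 => /andP[s0 s1]; rewrite ger0_norm//.
  by rewrite -[leRHS]mul1r ler_pM.
- rewrite addrK expr2 -!mulrA !ler_wpM2l//.
Unshelve. all: by end_near. Qed.

Lemma qh_mean_diff e m lam f x : ck 2 (ball 0 e) f -> `|x| < e ->
  differentiable (qh_mean m lam f) x /\
  forall k, partial k (qh_mean m lam f) x = qh_mean (m + lam k) lam (partial k f) x.
Proof.
move=> cf xe.
have df y : `|y| < e -> differentiable f y by move=> ye; apply: (ck_diff cf); exact/ball0P.
have ddf k y : `|y| < e -> differentiable (partial k f) y.
  by move=> ye; apply: (ck_diff (ck_partial k cf)); exact/ball0P.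
have [C C0 HC] := qh_mean_remainder cf xe.
pose L (h : 'rV[R]_r) : R := \sum_k h 0 k * qh_mean (m + lam k) lam (partial k f) x.
have Ll : linear L.
  move=> a u v; rewrite /L scaler_sumr -big_split; apply: eq_bigr => k _.
  by rewrite !mxE mulrDl -mulrA.
pose LL := GRing.isLinear.Build _ _ _ _ L Ll.
pose F : {linear 'rV[R]_r -> R} := HB.pack L LL.
have cF : continuous F.
  move=> y; apply/differentiable_continuous.
  apply: (@ck_diff _ _ _ 0 setT) => //; apply: ck_sum; first exact: openT.
  move=> i _; apply: ckM; [exact: openT|exact: ck_coord|exact: ck_cst].
have [dJ dE] : differentiable (qh_mean m lam f) x /\
    'd (qh_mean m lam f) x = F :> ('rV[R]_r -> R).
  apply: differentiable_lin => // eps eps0; near=> h.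
  have [hxe H] : `|h + x| < e /\ forall lam (t : R), 0 <= t <= 1 ->
    `|f (weighted_scale lam t (h + x)) - f (weighted_scale lam t x) -
      \sum_k t ^+ lam k * h 0 k * partial k f (weighted_scale lam t x)| <= C * `|h| ^+ 2.
    by near: h.
  have cJ k : cont01 (fun t => h 0 k * (t ^+ (m + lam k) * partial k f (weighted_scale lam t x))).
    by apply: cont01M; [exact: cont01_cst|exact: cont01_qh (ddf k) xe].
  have cD : cont01 (fun t => t ^+ m * f (weighted_scale lam t (h + x)) -
      t ^+ m * f (weighted_scale lam t x)).
    apply: cont01D; first exact: cont01_qh df hxe.
    by apply: cont01N; exact: cont01_qh df xe.
  have -> : qh_mean m lam f (h + x) - qh_mean m lam f x - F h =
     int01 (fun t => t ^+ m * f (weighted_scale lam t (h + x)) - t ^+ m * f (weighted_scale lam t x) -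
       \sum_k h 0 k * (t ^+ (m + lam k) * partial k f (weighted_scale lam t x))).
    rewrite int01B//; last exact: cont01_sum.
    rewrite int01B; [|exact: cont01_qh df hxe|exact: cont01_qh df xe].
    congr (_ - _ - _); rewrite int01_sum// /F/= /L; apply: eq_bigr => k _.
    by rewrite int01Z//; exact: cont01_qh (ddf k) xe.
  apply: le_trans (_ : C * `|h| ^+ 2 <= _); last first.
    rewrite expr2 mulrA ler_wpM2r//.
    have : `|h| <= eps / (C + 1).
      rewrite ltW//; near: h.
      have : 0 < eps / (C + 1) by rewrite divr_gt0// ltr_wpDl.
      move=> /(nbhsx_ballx (0 : 'rV[R]_r)) /nbhs_ballP[d d0 Hd].
      by apply/nbhs_ballP; exists d => // y /Hd /ball0P.
    rewrite ler_pdivlMr ?ltr_wpDl//; apply: le_trans.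
    by rewrite mulrC ler_wpM2l// lerDl.
  apply: int01_norm_le.
    by apply: cont01D => //; apply: cont01N; exact: cont01_sum.
  move=> t t01; move: (t01) => /andP[t0 t1].
  have -> : t ^+ m * f (weighted_scale lam t (h + x)) - t ^+ m * f (weighted_scale lam t x) -
       \sum_k h 0 k * (t ^+ (m + lam k) * partial k f (weighted_scale lam t x)) =
       t ^+ m * (f (weighted_scale lam t (h + x)) - f (weighted_scale lam t x) -
      \sum_k t ^+ lam k * h 0 k * partial k f (weighted_scale lam t x)).
    rewrite mulrBr mulrBr; congr (_ - _); rewrite mulr_sumr; apply: eq_bigr => k _.
    by rewrite exprD; ring.
  rewrite normrM -[leRHS]mul1r ler_pM//; last exact: H.
  by rewrite ger0_norm ?exprn_ge0// exprn_ile1.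
split=> // k; rewrite partialE// dE /F/= /L (bigD1 k)//= mxE !eqxx mul1r big1 ?addr0//.
by move=> j jk; rewrite mxE (negPf jk) andbF mul0r.
Unshelve. all: by end_near. Qed.

(** The uniform remainder needs two derivatives of f. The loss of two orders does not accumulate in
    the induction, because the derivative falls on f itself. *)
Lemma ck_qh_mean e m lam f k : ck k.+2 (ball 0 e) f -> ck k (ball 0 e) (qh_mean m lam f).
Proof.
elim: k m f => [|k IH] m f cf; split=> //.
- by move=> x /ball0P xe; case: (qh_mean_diff m lam cf xe).
- move=> x /ball0P xe; case: (@qh_mean_diff e m lam f x) => //.
  exact: ck_le cf.
move=> i; apply: eq_ck (IH (m + lam i)%N _ (ck_partial i cf)).
  exact: ball_open.
move=> x /set_mem /ball0P xe.
have [||_ ->] // := @qh_mean_diff e m lam f x.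
exact: ck_le cf.
Qed.

(** The fundamental theorem of calculus for t |-> t^n f(t.x) on [0, 1]. For n = 0 it yields
    Hadamard's lemma, for n the sum of the weights Euler's equation. The truncated predecessors are
    harmless, since each zero exponent also appears as a factor. *)
Lemma qh_mean_euler e n lam f x : ck 1 (ball 0 e) f -> `|x| < e ->
  f x - 0 ^+ n * f (weighted_scale lam 0 x) =
  n%:R * qh_mean n.-1 lam f x +
  \sum_k (lam k)%:R * x 0 k * qh_mean (n + (lam k).-1) lam (partial k f) x.
Proof.
move=> cf xe.
have df y : `|y| < e -> differentiable f y by move=> ye; apply: (ck_diff cf); exact/ball0P.
have ddf k y : `|y| < e -> differentiable (partial k f) y.
  by move=> ye; apply: (ck_diff (ck_partial k cf)); exact/ball0P.
pose dg t := n%:R * (t ^+ n.-1 * f (weighted_scale lam t x)) +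
  \sum_k (lam k)%:R * x 0 k * (t ^+ (n + (lam k).-1) * partial k f (weighted_scale lam t x)).
have cJ k : cont01 (fun t => (lam k)%:R * x 0 k * (t ^+ (n + (lam k).-1) * partial k f (weighted_scale lam t x))).
  by apply: cont01M; [exact: cont01_cst|exact: cont01_qh (ddf k) xe].
have c0 : cont01 (fun t => n%:R * (t ^+ n.-1 * f (weighted_scale lam t x))).
  by apply: cont01M; [exact: cont01_cst|exact: cont01_qh df xe].
have cdg : cont01 dg by apply: cont01D => //; exact: cont01_sum.
have ddg (t : R) : 0 <= t <= 1 ->
    is_derive t (1 : R) (fun t => t ^+ n * f (weighted_scale lam t x)) (dg t).
  move=> t01.
  have fd : differentiable f (weighted_scale lam t x).
    by apply: df; exact: le_lt_trans (weighted_scale_norm _ _ t01) xe.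
  have [d1 v1] := weighted_scale_comp_is_derive fd.
  apply: DeriveDef; first by apply: derivableM => //; exact: exprn_derivable.
  rewrite deriveM//; last exact: exprn_derivable.
  rewrite v1 exp_derive /dg addrC /GRing.scale/=; congr (_ + _).
    by rewrite mulr1 mulrC mulrA.
  rewrite mulr_sumr; apply: eq_bigr => k _.
  have swap (a b c d p : R) : a * (b * c * d * p) = b * d * (a * c * p) by ring.
  by rewrite exprD swap.
have := int01_derive ddg cdg.
rewrite expr1n mul1r weighted_scale1 => E; rewrite -E.
rewrite /dg int01D//; last exact: cont01_sum.
rewrite int01Z; last exact: cont01_qh df xe.
congr (_ + _); rewrite int01_sum//; apply: eq_bigr => k _.
by rewrite int01Z//; exact: cont01_qh (ddf k) xe.
Qed.

End QuasiHomogeneousMean.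

Lemma nbhs_forall_fin (T : topologicalType) (I : finType) (x : T) (A : I -> set T) :
  (forall i, nbhs x (A i)) -> nbhs x [set y | forall i, A i y].
Proof. by move=> H; apply: filter_forall. Qed.

Lemma diff_subE {R : realType} {V W : normedModType R} (f g : V -> W) x v :
  differentiable f x -> differentiable g x ->
  'd (fun y => f y - g y) x v = 'd f x v - 'd g x v.
Proof. by move=> df dg; rewrite -[LHS]/('d (f - g) x v) diffB. Qed.

Lemma diff_lin_comp {R : realType} {V W W' : normedModType R} (f : V -> W)
  (L : {linear W -> W'}) x v : continuous L -> differentiable f x ->
  differentiable (fun x => L (f x)) x /\ 'd (fun x => L (f x)) x v = L ('d f x v).
Proof.
move=> cL df; have dL : differentiable L (f x) by exact: linear_differentiable.
split; first exact: (@differentiable_comp _ _ _ _ f L).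
have /= -> := @diff_comp _ _ _ _ f L x df dL.
by rewrite diff_lin.
Qed.

(** * Hadamard's lemma and Euler's equation for germs *)

Section GermConsequences.
Context {R : realType} {r : nat}.
Implicit Types (f : 'rV[R]_r -> R) (lam : 'I_r -> nat).

Lemma partialZ i (c : R) f x : differentiable f x ->
  partial i (fun x => c * f x) x = c * partial i f x.
Proof.
move=> df; rewrite (@partialM _ _ i (cst c) f)//.
by rewrite [partial i (cst c) x]/partial derive_cst mul0r add0r.
Qed.

Lemma smooth_germ_ballP (W : normedModType R) (f : 'rV[R]_r -> W) : smooth_germ f ->
  exists2 e : R, 0 < e & forall k, ck k (ball 0 e) f.
Proof.
move=> /smooth_germP[U [oU U0 H]].
have /nbhs_ballP[e e0 He] : nbhs (0 : 'rV[R]_r) U by exact: open_nbhs_nbhs.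
by exists e => // k; apply: ck_sub (H k).
Qed.

Lemma ball_smooth_germ (W : normedModType R) (f : 'rV[R]_r -> W) (e : R) : 0 < e ->
  (forall k, ck k (ball 0 e) f) -> smooth_germ f.
Proof.
move=> e0 H; apply/smooth_germP; exists (ball 0 e); split=> //; first exact: ball_open.
exact: ballxx.
Qed.

Lemma smooth_germ_qh_mean m lam f : smooth_germ f -> smooth_germ (qh_mean m lam f).
Proof.
move=> /smooth_germ_ballP[e e0 H]; apply: (ball_smooth_germ e0) => k.
exact: ck_qh_mean (H _).
Qed.

Lemma hadamard_coord (i : 'I_r) f : smooth_germ f -> exists2 g, smooth_germ g &
  \forall x \near (0 : 'rV[R]_r),
    f x = f (\row_k (if k == i then 0 else x 0 k)) + x 0 i * g x.
Proof.
move=> sf; have [e e0 H] := smooth_germ_ballP sf.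
(* With weight 1 on the coordinate [i] and 0 on the others, the scaling at t = 0 is the projection
   that kills [x 0 i] alone. *)
pose lam k : nat := (k == i).
exists (qh_mean 0 lam (partial i f)).
  by apply/smooth_germ_qh_mean/smooth_germ_partial.
have ne : nbhs (0 : 'rV[R]_r) (ball 0 e) by exact: nbhsx_ballx.
apply: filterS ne => x /ball0P xe.
have := qh_mean_euler 0 lam (H 1%N) xe.
rewrite expr0 !mul1r mul0r add0r (bigD1 i)//= big1 ?addr0 => [|k ki]; last first.
  by rewrite /lam (negPf ki) !mul0r.
have -> : qh_mean (0 + (lam i).-1) lam (partial i f) x = qh_mean 0 lam (partial i f) x.
  by rewrite /lam eqxx.
rewrite {2}/lam eqxx mul1r => E.
have -> : \row_k (if k == i then 0 else x 0 k) = weighted_scale lam 0 x.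
  apply/rowP => k; rewrite !mxE /lam; case: (k == i) => /=; first by rewrite mul0r.
  by rewrite expr0 mul1r.
by move/eqP: E; rewrite subr_eq addrC => /eqP.
Qed.

(** With N the sum of the weights, the solution is K(x) = N times the integral of t^(N-1) f(t.x).
    Positivity of the weights makes the boundary term at t = 0 vanish, and the Euler field vanishes
    at 0, so K and f agree there. *)
Lemma euler_equation lam f : (0 < r)%N -> (forall k, (0 < lam k)%N) -> smooth_germ f ->
  exists K, [/\ smooth_germ K, K 0 = f 0 & \forall x \near (0 : 'rV[R]_r),
    f x = K x + (\sum_k lam k)%:R^-1 * \sum_k (lam k)%:R * x 0 k * partial k K x].
Proof.
move=> r0 lam0 sf; have [e e0 H] := smooth_germ_ballP sf.
set N := (\sum_k lam k)%N.
have N0 : (0 < N)%N.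
  by rewrite /N (bigD1 (Ordinal r0))//= ltn_addr.
have NR : N%:R != 0 :> R by rewrite pnatr_eq0 -lt0n.
pose J := qh_mean N.-1 lam f.
have sJ : smooth_germ J by exact: smooth_germ_qh_mean.
have E x : `|x| < e -> f x = N%:R * J x + \sum_k (lam k)%:R * x 0 k * partial k J x.
  move=> xe; have := qh_mean_euler N lam (H 1%N) xe.
  rewrite expr0n (gtn_eqF N0) mul0r subr0 => ->; congr (_ + _).
  apply: eq_bigr => k _; congr (_ * _).
  have [_ ->] := qh_mean_diff N.-1 lam (H 2) xe.
  (* Since N and [lam k] are positive, (N - 1) + lam k = N + (lam k - 1): the exponent from
     differentiating J is the one in Euler's identity. *)
  by rewrite -{1}(prednK N0) addSn -addnS prednK.
exists (fun x => N%:R * J x); split.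
- by apply: smooth_germM => //; exact: smooth_germ_cst.
- rewrite (E 0) ?normr0// big1 ?addr0// => k _.
  by rewrite mxE mulr0 mul0r.
have nJ := smooth_germ_diff sJ.
have ne : nbhs (0 : 'rV[R]_r) (ball 0 e) by exact: nbhsx_ballx.
near=> x.
have xe : `|x| < e by apply/ball0P; near: x.
have dJ : differentiable J x by near: x.
rewrite E//; congr (_ + _); rewrite mulr_sumr; apply: eq_bigr => k _.
by rewrite partialZ//; field.
Unshelve. all: by end_near. Qed.

End GermConsequences.

(** * The inverse function theorem *)

Section InverseFunction.
Context {R : realType} {r : nat}.
Implicit Types (P : 'rV[R]_r -> 'rV[R]_r) (x y : 'rV[R]_r).

(** No iteration is used: |x - T x| attains its minimum on the compact ball, and replacing the
    minimiser c by T c would halve the value, so the minimum is 0. *)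
Lemma contraction_fixpoint (T : 'rV[R]_r -> 'rV[R]_r) (rho : R) : 0 <= rho ->
  (forall x, `|x| <= rho -> `|T x| <= rho) ->
  (forall x y, `|x| <= rho -> `|y| <= rho -> `|T x - T y| <= 2^-1 * `|x - y|) ->
  exists2 x, `|x| <= rho & T x = x.
Proof.
move=> rho0 TB Tc.
pose A := [set x : 'rV[R]_r | `|x| <= rho].
have cA : compact A.
  apply: bounded_closed_compact.
    exists rho; split; first exact: num_real.
    by move=> M rM x /= xA; rewrite (le_trans xA)// ltW.
  by apply: closed_comp (@closed_le _ rho) => x _; exact: norm_continuous.
have A0 : A !=set0 by exists 0; rewrite /A/= normr0.
have cT : {within A, continuous (fun x => `|x - T x|)}.
  apply/subspace_continuousP => x Ax.
  apply/cvgrPdist_le => e e0; rewrite near_withinE.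
  near=> y => Ay.
  have : `|x - y| <= e / 2.
    near: y; apply/nbhs_ballP; exists (e / 2); first by rewrite /= divr_gt0.
    by move=> y; rewrite -ball_normE => /ltW.
  move=> xy; apply: le_trans (ler_dist_dist _ _) _.
  have -> : x - T x - (y - T y) = (x - y) - (T x - T y).
    by rewrite 2!opprB addrACA [RHS]addrACA; congr (_ + _); rewrite addrC.
  apply: le_trans (ler_normB _ _) _.
  have := Tc x y Ax Ay; rewrite (distrC (T x)); lra.
have [c /set_mem Ac cmin] := EVT_min_rV A0 cA cT.
exists c => //; apply/eqP; rewrite eq_sym -subr_eq0 -normr_eq0 eq_le normr_ge0 andbT.
have TAc : T c \in A by rewrite inE; exact: TB.
have := cmin _ TAc; have := Tc c (T c) Ac (TB _ Ac); lra.
Unshelve. all: by end_near. Qed.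

(** The transpose of the usual Jacobian matrix: vectors are rows and matrices act on the right, so
    the chain rule multiplies from left to right. *)
Definition jacmx P x : 'M[R]_r := \matrix_(i, j) partial i (fun x => P x 0 j) x.

Lemma diff_jacmx P x v : differentiable P x -> 'd P x v = v *m jacmx P x.
Proof.
move=> dP; rewrite diff_partialE//; apply/rowP => j.
rewrite !mxE summxE; apply: eq_bigr => i _.
by rewrite mxE partial_mx// mxE.
Qed.

Lemma mulmxr_continuous (M : 'M[R]_r) : continuous (mulmxr M : 'rV[R]_r -> 'rV[R]_r).
Proof.
move=> x; apply/differentiable_continuous; apply: (@ck_diff _ _ _ 0 setT) => //.
apply/ck_mxP; first exact: openT.
move=> i j; under eq_fun do rewrite mxE.
apply: ck_sum; first exact: openT.
move=> k _; apply: ckM; [exact: openT| |exact: ck_cst].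
by rewrite ord1; exact: ck_coord.
Qed.

Lemma diff_id_sub_mulmxr P (M : 'M[R]_r) x v : differentiable P x ->
  'd (fun y => y - P y *m M) x v = v - 'd P x v *m M.
Proof.
move=> dP; have [dPM E] := diff_lin_comp v (@mulmxr_continuous M) dP.
have dI : differentiable (fun y : 'rV[R]_r => y) x by exact: ex_diff.
have E2 : 'd (fun y => y - P y *m M) x v =
    'd (fun y : 'rV[R]_r => y) x v - 'd (fun y => P y *m M) x v := diff_subE v dI dPM.
have EI : 'd (fun y : 'rV[R]_r => y) x v = v :=
  congr1 (fun g : 'rV[R]_r -> 'rV[R]_r => g v) (@diff_val _ _ _ _ _ _ _ (is_diff_id x)).
have EM : 'd (fun y => P y *m M) x v = 'd P x v *m M := E.
exact: (etrans E2 (f_equal2 (fun a b : 'rV[R]_r => a - b) EI EM)).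
Qed.

Lemma mulmxr_bound (M : 'M[R]_r) : exists2 c : R, 0 < c & forall x : 'rV[R]_r, `|x *m M| <= c * `|x|.
Proof. exact: (linear_lipschitz (@mulmxr_continuous M)). Qed.

(** With k = Q(y + h) - Q(y) and J the Jacobian at Q(y), the error is k - h J^-1 = -(h - k J) J^-1.
    The bracket is o(|k|) because P is differentiable and P (Q z) = z, and the Lipschitz bound on Q
    turns o(|k|) into o(|h|). *)
Lemma inverse_differentiable P (Q : 'rV[R]_r -> 'rV[R]_r) (c : R) (y : 'rV[R]_r) :
  differentiable P (Q y) -> jacmx P (Q y) \in unitmx ->
  (\forall z \near y, P (Q z) = z /\ `|Q z - Q y| <= c * `|z - y|) ->
  differentiable Q y /\ forall v, 'd Q y v = v *m invmx (jacmx P (Q y)).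
Proof.
set J := jacmx P (Q y) => dP uJ H.
have [b b0 Hb] := mulmxr_bound (invmx J).
suff [dQ dE] : differentiable Q y /\ 'd Q y = mulmxr (invmx J) :> ('rV[R]_r -> 'rV[R]_r).
  by split=> // v; rewrite dE.
apply: differentiable_lin => [|e e0]; first exact: mulmxr_continuous.
have [PQy _] := nbhs_singleton H.
have cc : 0 < `|c| + 1 by rewrite ltr_wpDl.
have dc : 0 < e / (b * (`|c| + 1)) by rewrite divr_gt0// mulr_gt0.
have [d d0 Hd] := (nbhs_ballP _ _).1 (differentiable_near dP dc).
have H' : \forall h \near (0 : 'rV[R]_r), P (Q (h + y)) = h + y /\ `|Q (h + y) - Q y| <= c * `|h|.
  move: H; rewrite (near_shift 0)/= subr0; apply: filterS => h /=.
  by rewrite /= addrK.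
near=> h.
have [PQh Qh] : P (Q (h + y)) = h + y /\ `|Q (h + y) - Q y| <= c * `|h| by near: h.
set k := Q (h + y) - Q y in Qh *.
have Qh' : `|k| <= (`|c| + 1) * `|h|.
  apply: le_trans Qh _; rewrite ler_wpM2r//.
  by apply: le_trans (ler_norm c) _; rewrite lerDl.
have kd : `|k| < d.
  apply: le_lt_trans Qh' _; rewrite -ltr_pdivlMl// mulrC.
  near: h.
  have : 0 < d / (`|c| + 1) by rewrite divr_gt0.
  move=> /(nbhsx_ballx (0 : 'rV[R]_r)) /nbhs_ballP[d' d'0 Hd'].
  by apply/nbhs_ballP; exists d' => // z /Hd' /ball0P.
have := Hd k; rewrite -ball_normE /= sub0r normrN => /(_ kd).
rewrite diff_jacmx// -/J {1}/k subrK PQh PQy addrK => Hk.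
have -> : k - h *m invmx J = - ((h - k *m J) *m invmx J).
  by rewrite mulmxBl -mulmxA mulmxV// mulmx1 opprB.
rewrite normrN; apply: le_trans (Hb _) _.
rewrite -ler_pdivlMl//; apply: le_trans Hk _.
apply: (@le_trans _ _ (e / (b * (`|c| + 1)) * ((`|c| + 1) * `|h|))).
  by rewrite ler_wpM2l// ltW.
rewrite le_eqVlt; apply/orP; left; apply/eqP; field.
by rewrite !gt_eqF.
Unshelve. all: by end_near. Qed.

(** Bootstrapping: the partials of Q are entries of the inverse Jacobian of P evaluated at Q, which
    Cramer's formula writes as a quotient of polynomials in partials of P. Each order of regularity
    of Q thus gives the next. *)
Lemma ck_inverse k (V U : set 'rV[R]_r) P Q : open V -> open U ->
  ck k.+1 U P -> (forall x, U x -> jacmx P x \in unitmx) ->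
  (forall y, V y -> U (Q y)) ->
  (forall y, V y -> differentiable Q y /\ forall v, 'd Q y v = v *m invmx (jacmx P (Q y))) ->
  ck k V Q.
Proof.
move=> oV oU cP uP QV dQ.
elim: k cP => [|k IH] cP; split=> //; try by move=> y /dQ[].
move=> i; apply/ck_mxP => // i' j; rewrite {i'}ord1.
have cQ : ck k V Q by apply: IH; exact: ckW.
have cpm i1 j1 : ck k.+1 U (fun x => jacmx P x i1 j1).
  under eq_fun do rewrite mxE.
  by apply: ck_partial; move/(ck_mxP _ _ oU) : cP; apply.
pose F x := (\det (jacmx P x))^-1 * (\adj (jacmx P x)) i j.
apply: (@eq_ck _ _ _ _ _ (F \o Q)) => //.
  move=> y /set_mem Vy /=; have [dQy E] := dQ y Vy.
  rewrite partialE// E -rowE mxE /invmx uP; last exact: QV.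
  by rewrite mxE.
apply: (ck_comp oV oU) => //.
apply: ckM => //.
  apply: ckV => //; first by move=> x /uP; rewrite unitmxE unitfE.
  by apply: ck_det => // i1 j1; exact: ckW.
by apply: ck_adj => // i1 j1; exact: ckW.
Qed.

(** With B the inverse of the Jacobian at 0, the map G = id - P B has zero derivative at 0, so it
    contracts by 1/2 near 0. Solving P x = y amounts to finding a fixed point of x |-> y B + G x. *)
Lemma inverse_function P : smooth_germ P -> P 0 = 0 -> jacmx P 0 \in unitmx ->
  diffeo_germ P.
Proof.
move=> sP P0 uP; set B := invmx (jacmx P 0).
have [e1 e10 H1] := smooth_germ_ballP sP.
pose G x := x - P x *m B.
have ckG k : ck k (ball 0 e1) G.
  apply/ck_mxP; first exact: ball_open.
  move=> i j; rewrite ord1; apply: (@eq_ck _ _ _ _ _ (fun x => x 0 j + - \sum_l P x 0 l * B l j)).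
  - exact: ball_open.
  - by move=> x _; rewrite /G !mxE.
  apply: ckD; [exact: ball_open|exact: ck_coord|apply: ckN; first exact: ball_open].
  apply: ck_sum => [|l _]; first exact: ball_open.
  apply: ckM; [exact: ball_open| |exact: ck_cst].
  by move/(ck_mxP _ _ (@ball_open _ _ _ _)) : (H1 k); apply.
have dG0 : 'd G 0 = (fun=> 0) :> ('rV[R]_r -> 'rV[R]_r).
  have b0 : ball (0 : 'rV[R]_r) e1 0 by exact: ballxx.
  have dP : differentiable P 0 by exact: ck_diff (H1 0) b0.
  apply/funext => v.
  by rewrite /G diff_id_sub_mulmxr// diff_jacmx// -mulmxA mulmxV// mulmx1 subrr.
(* Chosen so that the mean value bound [r * L] is at most 1/2; the added 1 keeps [L] meaningful when
   r = 0. *)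
pose L : R := (2 * (r%:R + 1))^-1.
have L0 : 0 < L by rewrite invr_gt0 mulr_gt0// ltr_wpDl.
have [e [e0 ee1 HL Hu]] : exists e : R, [/\ 0 < e, e <= e1,
    forall i j x, `|x| < e -> `|partial i (fun x => G x 0 j) x| <= L &
    forall x, `|x| < e -> jacmx P x \in unitmx].
  have nL i j : \forall x \near (0 : 'rV[R]_r), `|partial i (fun x => G x 0 j) x| <= L.
    have b0 : ball (0 : 'rV[R]_r) e1 0 by exact: ballxx.
    have dGj : ck 1 (ball 0 e1) (fun x => G x 0 j).
      by move/(ck_mxP _ _ (@ball_open _ _ _ _)) : (ckG 1%N); apply.
    have cG : {for 0, continuous (partial i (fun x => G x 0 j))}.
      by apply: differentiable_continuous; exact: ck_diff (ck_partial i dGj) b0.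
    have Z : partial i (fun x => G x 0 j) 0 = 0.
      rewrite -partial_mx; last exact: ck_diff (ckG 0) b0.
      by rewrite partialE ?dG0 ?mxE//; exact: ck_diff (ckG 0) b0.
    move/cvgrPdist_le : cG => /(_ _ L0); rewrite Z.
    by apply: filterS => x; rewrite sub0r normrN.
  have nu : \forall x \near (0 : 'rV[R]_r), jacmx P x \in unitmx.
    have b0 : ball (0 : 'rV[R]_r) e1 0 by exact: ballxx.
    pose D x := \det (jacmx P x).
    have cD : {for 0, continuous D}.
      apply: differentiable_continuous; apply: (@ck_diff _ _ _ 0 (ball 0 e1)) => //.
      apply: ck_det; first exact: ball_open.
      move=> i j; under eq_fun do rewrite mxE.
      by apply: ck_partial; move/(ck_mxP _ _ (@ball_open _ _ _ _)) : (H1 1%N); apply.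
    have D0 : D 0 != 0 by rewrite /D -unitfE -unitmxE.
    have : nbhs (0 : 'rV[R]_r) (D @^-1` [set z | z != 0]).
      by apply: cD; apply: open_nbhs_nbhs; split=> //; exact: open_neq.
    by apply: filterS => x; rewrite /D unitmxE unitfE.
  have nL' : \forall x \near (0 : 'rV[R]_r), forall i j : 'I_r,
     `|partial i (fun x => G x 0 j) x| <= L.
    exact: (nbhs_forall_fin (fun i => nbhs_forall_fin (nL i))).
  have [e2 e20 He2] := (nbhs_ballP _ _).1 (filterI nL' nu).
  exists (Num.min e1 e2); split.
  - by rewrite lt_min e10.
  - by rewrite ge_min lexx.
  - move=> i j x; rewrite lt_min => /andP[_ xe].
    by have [+ _] := He2 x ((ball0P x e2).2 xe); exact.
  - move=> x; rewrite lt_min => /andP[_ xe].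
    by have [] := He2 x ((ball0P x e2).2 xe).
have GL x y : `|x| < e -> `|y| < e -> `|G x - G y| <= 2^-1 * `|x - y|.
  move=> xe ye; apply: norm_le_coord; first by rewrite mulr_ge0.
  move=> j.
  have -> : (G x - G y) 0 j = G x 0 j - G y 0 j by rewrite mxE [X in _ + X]mxE.
  have seg (t : R) : 0 <= t <= 1 -> `|y + t *: (x - y)| < e.
    move=> /andP[t0 t1].
    have -> : y + t *: (x - y) = (1 - t) *: y + t *: x.
      by rewrite scalerBl scale1r scalerBr addrA addrAC.
    apply: le_lt_trans (ler_normD _ _) _.
    rewrite !normrZ (ger0_norm t0) ger0_norm ?subr_ge0//.
    have : t * `|x| + (1 - t) * `|y| <= t * Num.max `|x| `|y| + (1 - t) * Num.max `|x| `|y|.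
      by rewrite lerD// ler_wpM2l ?subr_ge0// le_max lexx ?orbT.
    have tt : t + (1 - t) = 1 by ring.
    rewrite -mulrDl tt mul1r addrC => /le_lt_trans; apply.
    by rewrite gt_max xe.
  apply: le_trans (@mean_value_bound _ _ (fun x => G x 0 j) y x L _ _) _.
  - move=> t /seg te; apply: differentiable_mxP.
    by apply: (ck_diff (ckG 0%N)); apply/ball0P; exact: lt_le_trans ee1.
  - by move=> t i /seg; exact: HL.
  rewrite ler_wpM2r// /L invfM mulrCA ler_piMr// ?invr_ge0//.
  by rewrite ler_pdivrMr ?ltr_wpDl// mul1r lerDl.
pose rho := e / 2.
have rho0 : 0 < rho by rewrite divr_gt0.
have rhoe : rho < e by rewrite /rho; lra.
have inj x y : `|x| <= rho -> `|y| <= rho -> `|x - y| <= 2 * `|(P x - P y) *m B|.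
  move=> xr yr; have := GL x y (le_lt_trans xr rhoe) (le_lt_trans yr rhoe).
  have E : x - y = (G x - G y) + (P x - P y) *m B.
    rewrite /G mulmxBl; move: (P x *m B) (P y *m B) => p q.
    by apply/rowP => k; rewrite !mxE; ring.
  have := ler_normD (G x - G y) ((P x - P y) *m B); rewrite -E; lra.
(* The condition on y sits under the existential, so that a choice function defines [Q] everywhere;
   outside the condition its value is arbitrary. *)
have surj y : exists x, `|y *m B| <= rho / 2 -> `|x| <= rho /\ P x = y.
  have [yr|] := boolP (`|y *m B| <= rho / 2); last by exists 0.
  have G0 : G 0 = 0 by rewrite /G P0 mul0mx subr0.
  have [||x xr E] := @contraction_fixpoint (fun x => y *m B + G x) rho (ltW rho0).
  - move=> x xr; apply: le_trans (ler_normD _ _) _.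
    have := GL x 0 (le_lt_trans xr rhoe); rewrite normr0 G0 !subr0 => /(_ e0); lra.
  - move=> x y' xr yr'; rewrite opprD addrACA subrr add0r.
    by apply: GL; exact: le_lt_trans rhoe.
  exists x => _; split=> //.
  have {}E : y *m B = P x *m B.
    move: E; rewrite /G; move: (y *m B) (P x *m B) => q p /rowP E.
    by apply/rowP => k; have := E k; rewrite !mxE; lra.
  have uB : B \in unitmx by rewrite unitmx_inv.
  by rewrite -[LHS](mulmxK uB) -E mulmxK.
pose Q y := projT1 (cid (surj y)).
have QP y : `|y *m B| <= rho / 2 -> `|Q y| <= rho /\ P (Q y) = y.
  by rewrite /Q; case: cid.
have QL y z : `|y *m B| <= rho / 2 -> `|z *m B| <= rho / 2 -> `|Q y - Q z| <= 2 * `|(y - z) *m B|.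
  move=> yr zr; have [Qy Py] := QP y yr; have [Qz Pz] := QP z zr.
  by have := inj _ _ Qy Qz; rewrite Py Pz.
have r20 : `|(0 : 'rV[R]_r) *m B| <= rho / 2 by rewrite mul0mx normr0 divr_ge0// ltW.
have Q0 : Q 0 = 0.
  have [Qr PQ] := QP 0 r20.
  have := inj (Q 0) 0 Qr; rewrite normr0 PQ P0 subrr mul0mx normr0 mulr0 subr0.
  by move=> /(_ (ltW rho0)); rewrite normr_le0 => /eqP.
pose V := [set y : 'rV[R]_r | `|y *m B| < rho / 2].
have oV : open V.
  apply: open_comp (@open_lt _ (rho / 2)) => y _.
  apply: continuous_comp; first exact: mulmxr_continuous.
  exact: norm_continuous.
have V0 : V 0 by rewrite /V/= mul0mx normr0 divr_gt0.
have [b b0 Hb] := mulmxr_bound B.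
have dQ y : V y -> differentiable Q y /\ forall v, 'd Q y v = v *m invmx (jacmx P (Q y)).
  move=> Vy; have [Qr PQ] := QP y (ltW Vy).
  have Qe : `|Q y| < e by exact: le_lt_trans rhoe.
  apply: (@inverse_differentiable P Q (2 * b)).
  - by apply: (ck_diff (H1 0%N)); apply/ball0P; exact: lt_le_trans ee1.
  - exact: Hu.
  have nV : nbhs y V by exact: open_nbhs_nbhs.
  apply: filterS nV => z Vz; split; first by have [] := QP z (ltW Vz).
  apply: le_trans (QL z y (ltW Vz) (ltW Vy)) _.
  by rewrite -mulrA ler_wpM2l.
have sQ : smooth_germ Q.
  apply/smooth_germP; exists V; split=> // k.
  apply: (@ck_inverse k V (ball 0 e) P) => //.
  - exact: ball_open.
  - by apply: ck_sub (H1 _); exact: le_ball.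
  - by move=> x /ball0P; exact: Hu.
  - by move=> y Vy; apply/ball0P; apply: le_lt_trans rhoe; case: (QP y (ltW Vy)).
split=> //; exists Q; split=> //; last first.
  have nV : nbhs (0 : 'rV[R]_r) V by exact: open_nbhs_nbhs.
  by apply: filterS nV => y Vy; case: (QP y (ltW Vy)).
(* For the other composite, Q (P x) and x lie in the ball of radius [rho] and have the same image
   under P, so injectivity there identifies them. *)
have cP := smooth_germ_cvg sP.
have nPV : nbhs (0 : 'rV[R]_r) (P @^-1` V).
  by apply: cP; rewrite P0; exact: open_nbhs_nbhs.
have nr : nbhs (0 : 'rV[R]_r) (ball 0 rho) by exact: nbhsx_ballx.
apply: filterS (filterI nPV nr) => x [/= Vx /ball0P xr].
have [Qr PQ] := QP _ (ltW Vx).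
have := inj (Q (P x)) x Qr (ltW xr); rewrite PQ subrr mul0mx normr0 mulr0.
by rewrite normr_le0 subr_eq0 => /eqP.
Qed.

End InverseFunction.

(** * Jacobian matrices and diffeomorphism germs *)

Section Jacobian.
Context {R : realType} {r : nat}.
Implicit Types (P Q : 'rV[R]_r -> 'rV[R]_r).

Lemma jacmx_comp P Q x : differentiable P x -> differentiable Q (P x) ->
  jacmx (Q \o P) x = jacmx P x *m jacmx Q (P x).
Proof.
move=> dP dQ; apply/matrixP => i j; rewrite !mxE.
rewrite (@partial_comp _ _ _ P (fun y => Q y 0 j))//; last exact: differentiable_mxP.
by apply: eq_bigr => k _; rewrite !mxE.
Qed.

Lemma eq_jacmx P Q x : {near x, P =1 Q} -> jacmx P x = jacmx Q x.
Proof.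
move=> PQ; apply/matrixP => i j; rewrite !mxE; apply: eq_partial.
by apply: filterS PQ => y ->.
Qed.

Lemma jacmx_id (x : 'rV[R]_r) : jacmx (fun y : 'rV[R]_r => y) x = 1%:M.
Proof. by apply/matrixP => i j; rewrite !mxE partial_coord. Qed.

Lemma jacmx_mulmxr (M : 'M[R]_r) (x : 'rV[R]_r) : jacmx (fun y : 'rV[R]_r => y *m M) x = M.
Proof.
have dM : differentiable (fun y : 'rV[R]_r => y *m M) x.
  by apply: (@linear_differentiable _ _ _ (mulmxr M)); exact: mulmxr_continuous.
have E : 'd (fun y : 'rV[R]_r => y *m M) x = mulmxr M :> ('rV[R]_r -> 'rV[R]_r).
  by apply: (@diff_lin _ _ _ (mulmxr M)); exact: mulmxr_continuous.
apply/row_matrixP => i; rewrite 2!rowE -diff_jacmx//.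
by rewrite E.
Qed.

Lemma near_comp0 P (A : set 'rV[R]_r) : {for 0, continuous P} -> P 0 = 0 ->
  (\forall y \near (0 : 'rV[R]_r), A y) -> \forall x \near (0 : 'rV[R]_r), A (P x).
Proof. by move=> cP P0 nA; apply: cP; rewrite P0. Qed.

Lemma differentiable_expr (f : 'rV[R]_r -> R) n x : differentiable f x ->
  differentiable (fun x => f x ^+ n) x.
Proof.
move=> df; elim: n => [|n IH]; first exact: differentiable_cst.
rewrite (_ : (fun x => f x ^+ n.+1) = f * (fun x => f x ^+ n)).
  exact: differentiableM.
by apply/funext => y; rewrite exprS.
Qed.

Lemma partialX i (f : 'rV[R]_r -> R) n x : differentiable f x ->
  partial i (fun x => f x ^+ n) x = n%:R * f x ^+ n.-1 * partial i f x.
Proof.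
move=> df; elim: n => [|n IH]; first by rewrite /partial derive_cst !mul0r.
rewrite (_ : (fun x => f x ^+ n.+1) = (fun x => f x * (fun x => f x ^+ n) x)).
  rewrite partialM//; last exact: differentiable_expr.
  rewrite IH /=; case: n {IH} => [|n]; first by rewrite !mul0r expr0 !mulr1 mulr0 addr0 mul1r.
  by rewrite /= -[in RHS](addn1 n.+1) natrD exprS; ring.
by apply/funext => y; rewrite exprS.
Qed.

Lemma smooth_germ_gt0 (f : 'rV[R]_r -> R) : smooth_germ f -> 0 < f 0 ->
  \forall x \near (0 : 'rV[R]_r), 0 < f x.
Proof.
move=> /smooth_germ_cvg cf f0.
have H : nbhs (f 0) [set y | 0 < y] by apply: open_nbhs_nbhs; split=> //; exact: open_gt.
exact: (cf _ H).
Qed.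

Lemma smooth_germ_det n (X : 'rV[R]_r -> 'M[R]_n) : smooth_germ X ->
  smooth_germ (fun x => \det (X x)).
Proof.
move=> /smooth_germ_mxP sX; rewrite /determinant.
apply: smooth_germ_sum => s _; apply: smooth_germM; first exact: smooth_germ_cst.
by apply: smooth_germ_prod => i _; exact: sX.
Qed.

Lemma smooth_germ_jacmx P : smooth_germ P -> smooth_germ (jacmx P).
Proof.
move=> /smooth_germ_mxP sP; apply/smooth_germ_mxP => i j.
by under eq_fun do rewrite mxE; exact: smooth_germ_partial.
Qed.

Lemma smooth_germ_comp_rV P Q : smooth_germ P -> P 0 = 0 -> smooth_germ Q -> smooth_germ (Q \o P).
Proof. exact: smooth_germ_comp_mx. Qed.

Lemma diffeo_germ_comp P Q : diffeo_germ P -> diffeo_germ Q -> diffeo_germ (Q \o P).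
Proof.
move=> [sP P0 [P' [sP' P'0 PP' P'P]]] [sQ Q0 [Q' [sQ' Q'0 QQ' Q'Q]]].
split; [exact: smooth_germ_comp_rV|by rewrite /= P0|].
exists (P' \o Q'); split; [exact: smooth_germ_comp_rV|by rewrite /= Q'0| |].
  near=> x; rewrite /= (_ : Q' (Q (P x)) = P x); first by near: x.
  by near: x; apply: near_comp0 QQ' => //; exact: smooth_germ_cvg.
near=> x; rewrite /= (_ : P (P' (Q' x)) = Q' x); first by near: x.
by near: x; apply: near_comp0 P'P => //; exact: smooth_germ_cvg.
Unshelve. all: by end_near. Qed.

Lemma diffeo_germ_id : diffeo_germ (fun x : 'rV[R]_r => x).
Proof.
have s : smooth_germ (fun x : 'rV[R]_r => x).
  by apply/smooth_germ_mxP => i j; rewrite ord1; exact: smooth_germ_coord.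
by split=> //; exists (fun x => x); split=> //; near=> x.
Unshelve. all: by end_near. Qed.

Lemma diffeo_germ_involution (M : 'M[R]_r) : M *m M = 1%:M -> diffeo_germ (mulmxr M : 'rV[R]_r -> 'rV[R]_r).
Proof.
move=> MM; have s : smooth_germ (mulmxr M : 'rV[R]_r -> 'rV[R]_r).
  apply: smooth_germ_mulmx; first by case: diffeo_germ_id.
  exact: smooth_germ_cst.
split=> //=; first by rewrite mul0mx.
exists (mulmxr M); split=> //=; first by rewrite mul0mx.
- by near=> x; rewrite /= -mulmxA MM mulmx1.
- by near=> x; rewrite /= -mulmxA MM mulmx1.
Unshelve. all: by end_near. Qed.

Lemma diffeo_jacmx P Q : smooth_germ P -> P 0 = 0 -> smooth_germ Q ->
  (\forall x \near (0 : 'rV[R]_r), Q (P x) = x) ->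
  \forall x \near (0 : 'rV[R]_r), jacmx P x *m jacmx Q (P x) = 1%:M.
Proof.
move=> sP P0 sQ QP; have cP := smooth_germ_cvg sP.
have dQ := near_comp0 cP P0 (smooth_germ_diff sQ).
have dP := smooth_germ_diff sP.
(* To differentiate Q (P y) = y at a point x near 0, the identity must hold around x and not only at
   x; an open set provides this. *)
move/nbhs_open : QP => [U [oU U0 QP]].
have nU : nbhs (0 : 'rV[R]_r) U by exact: open_nbhs_nbhs.
near=> x; rewrite -jacmx_comp; [|by near: x|by near: x].
rewrite -(jacmx_id x); apply: eq_jacmx.
have Ux : U x by near: x.
have : nbhs x U by exact: open_nbhs_nbhs.
by apply: filterS => y /QP.
Unshelve. all: by end_near. Qed.

End Jacobian.

(** * Correcting the Jacobian of an equivalence *)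

Section Plane.
Context {R : realType}.
Implicit Types (P : 'rV[R]_2 -> 'rV[R]_2) (A B : 'rV[R]_2 -> 'M[R]_2).

Lemma sum2E (V : nmodType) (F : 'I_2 -> V) : \sum_i F i = F 0 + F 1.
Proof. by rewrite !big_ord_recl big_ord0 addr0; congr (_ + F _); apply: val_inj. Qed.

Lemma nsum2E (F : 'I_2 -> nat) : (\sum_i F i = F 0%R + F 1%R)%N.
Proof. by rewrite !big_ord_recl big_ord0 addn0; congr (_ + F _)%N; apply: val_inj. Qed.

Lemma det2E (M : 'M[R]_2) : \det M = M 0 0 * M 1 1 - M 0 1 * M 1 0.
Proof.
rewrite (expand_det_row _ 0) sum2E /cofactor !det_mx11 !mxE /= expr0 mul1r expr1 mulN1r mulrN.
by congr (_ * M _ _ - _ * M _ _); apply: val_inj.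
Qed.

Lemma dx1dx2_mulmx x (u v : 'rV[R]_2) (M : 'M[R]_2) :
  dx1dx2 x (u *m M) (v *m M) = \det M * dx1dx2 x u v.
Proof. by rewrite /dx1dx2 !mxE !sum2E det2E; ring. Qed.

Lemma preserves_detP P : smooth_germ P ->
  preserves2 P dx1dx2 <-> \forall x \near (0 : 'rV[R]_2), \det (jacmx P x) = 1.
Proof.
move=> /smooth_germ_diff dP; split=> [H|H].
  near=> x.
  have dPx : differentiable P x by near: x.
  have Hx : forall u v, pullback2 P dx1dx2 x u v = dx1dx2 x u v by near: x.
  have := Hx (delta_mx 0 0) (delta_mx 0 1).
  rewrite /pullback2 !diff_jacmx// dx1dx2_mulmx.
  by rewrite /dx1dx2 !mxE/= !mulr1 mulr0 subr0 mulr1.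
near=> x => u v.
have dPx : differentiable P x by near: x.
have Hx : \det (jacmx P x) = 1 by near: x.
by rewrite /pullback2 !diff_jacmx// dx1dx2_mulmx Hx mul1r.
Unshelve. all: by end_near. Qed.

(** The left side is the Jacobian determinant of (x, y) |-> (u^a x, u^b y) when u has partials p and
    q; the factors 1 and 0 are Kronecker deltas. The p q terms cancel, and what remains is u^(a+b)
    plus its weighted Euler derivative divided by a + b. *)
Lemma scaling_det_identity (a b : nat) (u p q x y : R) : (0 < a)%N -> (0 < b)%N ->
  (a%:R * u ^+ a.-1 * p * x + u ^+ a * 1) * (b%:R * u ^+ b.-1 * q * y + u ^+ b * 1) -
  (b%:R * u ^+ b.-1 * p * y + u ^+ b * 0) * (a%:R * u ^+ a.-1 * q * x + u ^+ a * 0) =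
  u ^+ (a + b) + (a + b)%:R^-1 *
    (a%:R * x * ((a + b)%:R * u ^+ (a + b).-1 * p) +
     b%:R * y * ((a + b)%:R * u ^+ (a + b).-1 * q)).
Proof.
case: a => // a _; case: b => // b _.
have NR : (a.+1 + b.+1)%:R != 0 :> R by rewrite pnatr_eq0.
have -> : (a.+1 + b.+1).-1 = (a + b).+1 by rewrite addSn addnS.
move: NR; rewrite natrD => NR.
rewrite -[X in _ = _ + X](_ : a.+1%:R * x * (u ^+ (a + b).+1 * p) +
  b.+1%:R * y * (u ^+ (a + b).+1 * q) = _); last first.
  move: (a.+1%:R) (b.+1%:R) NR => s t st; field; exact: st.
move: (a.+1%:R) (b.+1%:R) => s t.
by rewrite !exprS !exprD !exprS; ring.
Qed.

(* Moser's argument without flows: along the quasi-homogeneous scalings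
   x |-> u(x).x the equation "Jacobian = f" becomes Euler's equation for K = u^N. *)
Lemma scaling_with_jacobian (lam : 'I_2 -> nat) (f : 'rV[R]_2 -> R) :
  (forall k, (0 < lam k)%N) -> smooth_germ f -> 0 < f 0 ->
  exists u : 'rV[R]_2 -> R, [/\ smooth_germ u, 0 < u 0,
    diffeo_germ (fun x => weighted_scale lam (u x) x) &
    \forall x \near (0 : 'rV[R]_2),
      \det (jacmx (fun x => weighted_scale lam (u x) x) x) = f x].
Proof.
move=> lam0 sf f0.
have [K [sK K0 EK]] := euler_equation (isT : (0 < 2)%N) lam0 sf.
set N := (\sum_k lam k)%N in EK.
have Ns : N = (lam 0%R + lam 1%R)%N by exact: nsum2E.
have N0 : (0 < N)%N by rewrite Ns ltn_addr.
have NR : N%:R != 0 :> R by rewrite pnatr_eq0 -lt0n.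
have K00 : 0 < K 0 by rewrite K0.
(* The N-th root of K, smooth near 0 because K 0 = f 0 is positive. *)
pose u x := K x `^ (N%:R^-1).
have su : smooth_germ u by exact: smooth_germ_powR.
have u0 : 0 < u 0 by exact: powR_gt0.
have uN x : 0 < K x -> u x ^+ N = K x.
  move=> Kx; rewrite -powR_mulrn ?powR_ge0// /u -powRrM mulVf// powRr1//.
  exact: ltW.
pose S x := weighted_scale lam (u x) x.
have sS : smooth_germ S.
  apply/smooth_germ_mxP => i j; under eq_fun do rewrite mxE.
  by apply: smooth_germM; [exact: smooth_germX|exact: smooth_germ_coord].
have nK : \forall x \near (0 : 'rV[R]_2), 0 < K x.
  exact: smooth_germ_gt0.
have nuN : \forall x \near (0 : 'rV[R]_2), {near x, (fun x => u x ^+ N) =1 K}.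
  move/nbhs_open : nK => [U [oU U0 HU]].
  have nU : nbhs (0 : 'rV[R]_2) U by exact: open_nbhs_nbhs.
  apply: filterS nU => x Ux; have : nbhs x U by exact: open_nbhs_nbhs.
  by apply: filterS => y /HU; exact: uN.
have ndu := smooth_germ_diff su.
have E : \forall x \near (0 : 'rV[R]_2), \det (jacmx S x) = f x.
  near=> x.
  have dux : differentiable u x by near: x.
  have uNx : {near x, (fun x => u x ^+ N) =1 K} by near: x.
  have Kx := nbhs_singleton uNx.
  have -> : f x = K x + N%:R^-1 * \sum_k (lam k)%:R * x 0 k * partial k K x by near: x.
  have pX n k := @partialX _ _ k u n x dux.
  have dX n := differentiable_expr n dux.
  have pK k : partial k K x = N%:R * u x ^+ N.-1 * partial k u x.
    by rewrite -pX; apply/esym/eq_partial.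
  have J i j : jacmx S x i j = (lam j)%:R * u x ^+ (lam j).-1 * partial i u x * x 0 j +
      u x ^+ lam j * (i == j)%:R.
    rewrite mxE; under eq_fun do rewrite mxE.
    rewrite partialM//; last exact: differentiable_coord.
    by rewrite pX partial_coord.
  rewrite det2E !J sum2E !pK -Kx Ns !eqxx.
  have -> : (0 == 1 :> 'I_2) = false by [].
  have -> : (1 == 0 :> 'I_2) = false by [].
  have := scaling_det_identity (u x) (partial 0 u x) (partial 1 u x) (x 0 0) (x 0 1) (lam0 0) (lam0 1).
  exact.
have S0 : S 0 = 0 by apply/rowP => k; rewrite !mxE mulr0.
exists u; split=> //; apply: inverse_function => //.
rewrite unitmxE unitfE -/S; have -> := nbhs_singleton E.
by rewrite gt_eqF.
Unshelve. all: by end_near. Qed.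

Lemma half_pow_sqrt (t : R) m : 0 <= t -> half_pow t m = Num.sqrt t ^+ m.
Proof.
move=> t0; rewrite /half_pow; case: ifPn => // om.
rewrite -{1}(sqr_sqrtr t0) -exprM; congr (_ ^+ _).
by rewrite -[RHS]odd_double_half (negPf om) add0n -muln2 mulnC.
Qed.

(** A global form of quasi-homogeneity in the given coordinates. In [sym_qh_in] the neighbourhood
    may depend on t; here t may be replaced by a function of x, which the Jacobian correction
    requires. *)
Definition exact_qh n (A : 'rV[R]_2 -> 'M[R]_n) (lam : 'I_2 -> nat) (delta : 'I_n -> nat) :=
  forall t x i j, A (weighted_scale lam t x) i j = half_pow t (delta i + delta j) * A x i j.

Lemma exact_qh_sym_qh_in A lam delta : (0 < \sum_k lam k)%N -> exact_qh A lam delta ->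
  sym_qh_in id lam A.
Proof.
move=> lam0 H; split=> //; exists delta, (cst 1%:M); split.
  split; first exact: smooth_germ_cst.
  by near=> x; exact: unitmx1.
move=> B t i j; near=> x.
by rewrite /B /= trmx1 !mul1mx !mulmx1 H.
Unshelve. all: by end_near. Qed.

Lemma exact_qh_sym_quasi_homogeneous A lam delta : (0 < \sum_k lam k)%N ->
  exact_qh A lam delta -> sym_quasi_homogeneous A.
Proof.
by move=> lam0 H; exists id, lam; split; [exact: diffeo_germ_id|exact: exact_qh_sym_qh_in H].
Qed.

(** P is followed by a scaling S whose Jacobian equals that of the inverse of P, so S after P has
    Jacobian 1. Quasi-homogeneity says that A after S is diagonally congruent to A, and this
    congruence is absorbed into X. *)
Lemma vp_equiv_of_pos A B P lam delta : exact_qh A lam delta -> (forall k, (0 < lam k)%N) ->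
  diffeo_germ P -> 0 < \det (jacmx P 0) -> congruent_via P A B -> vp_equiv dx1dx2 A B.
Proof.
move=> qA lam0 dP detP [X [sX uX] BX].
have [sP P0 [Q [sQ Q0 QP PQ]]] := dP.
have JE := diffeo_jacmx sP P0 sQ QP.
have f0 : 0 < \det (jacmx Q 0).
  have := nbhs_singleton JE; rewrite P0 => /(congr1 determinant); rewrite det_mulmx det1 => E.
  by rewrite -(pmulr_rgt0 _ detP) E.
have [u [su u0 dS detS]] := scaling_with_jacobian lam0 (smooth_germ_det (smooth_germ_jacmx sQ)) f0.
set S := (fun x => weighted_scale lam (u x) x) in dS detS.
have [sS S0 _] := dS.
have cP := smooth_germ_cvg sP.
have nu : \forall x \near (0 : 'rV[R]_2), 0 < u x.
  exact: smooth_germ_gt0.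
(* Scaling by u multiplies the entry (i, j) by u^((delta i + delta j)/2) = w^(delta i) w^(delta j);
   a congruence by inverse powers of w removes the factor. *)
pose w z := (u z `^ (2^-1)).
have sw : smooth_germ w by exact: smooth_germ_powR.
have w0 : w 0 != 0 by rewrite gt_eqF// powR_gt0.
pose D z : 'M[R]_2 := diag_mx (\row_i ((w z)^-1 ^+ delta i)).
have sD : smooth_germ D.
  apply/smooth_germ_mxP => i j; rewrite /D; under eq_fun do rewrite !mxE.
  case: (i == j); last by rewrite (_ : (fun=> _) = cst 0)//; exact: smooth_germ_cst.
  by apply: smooth_germX; exact: smooth_germV.
exists (S \o P); split.
- exact: diffeo_germ_comp.
- apply/preserves_detP; first exact: smooth_germ_comp_rV.
  have nSP := near_comp0 cP P0 (smooth_germ_diff sS).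
  have ndP := smooth_germ_diff sP.
  have nd := near_comp0 cP P0 detS.
  near=> x; rewrite jacmx_comp; [|by near: x|by near: x].
  rewrite det_mulmx (_ : \det (jacmx S (P x)) = \det (jacmx Q (P x))); last by near: x.
  rewrite -det_mulmx (_ : jacmx P x *m jacmx Q (P x) = 1%:M) ?det1//.
  by near: x.
exists (fun x => D (P x) *m X x).
  split.
    by apply: smooth_germ_mulmx => //; exact: smooth_germ_comp_mx.
  have nuP := near_comp0 cP P0 nu.
  near=> x; rewrite unitmx_mul; apply/andP; split; last by near: x.
  have ux : 0 < u (P x) by near: x.
  rewrite unitmxE unitfE det_diag; apply/prodf_neq0 => i _.
  by rewrite mxE expf_neq0// invr_neq0// gt_eqF// powR_gt0.
have nuP := near_comp0 cP P0 nu.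
near=> x.
have ux : 0 < u (P x) by near: x.
have -> : B x = (X x)^T *m A (P x) *m X x by near: x.
rewrite trmx_mul !mulmxA; congr (_ *m _); rewrite -!mulmxA; congr (_ *m _).
apply/matrixP => i j.
rewrite /D tr_diag_mx mul_diag_mx mxE mul_mx_diag !mxE /= qA half_pow_sqrt ?ltW//.
rewrite -powR12_sqrt ?ltW// -/(w (P x)).
have wx : w (P x) != 0 by rewrite gt_eqF// powR_gt0.
rewrite exprD !exprVn; field.
by rewrite !expf_neq0.
Unshelve. all: by end_near. Qed.

(** M is an orientation-reversing change of coordinates that takes A1 to A2 up to a constant
    congruence. With A1 = A2 it is a symmetry and yields a single class; otherwise A2 is the mirror
    image of A1. *)
Definition reflects (M Y : 'M[R]_2) A1 A2 :=
  [/\ M *m M = 1%:M, \det M = -1, Y \in unitmx &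
    forall x, A2 (x *m M) = Y^T *m A1 x *m Y].

Lemma GL_germ_cstM (Y : 'M[R]_2) (X : 'rV[R]_2 -> 'M[R]_2) : Y \in unitmx -> GL_germ X ->
  GL_germ (fun x => Y *m X x).
Proof.
move=> uY [sX uX]; split; first by apply: smooth_germ_mulmx => //; exact: smooth_germ_cst.
by apply: filterS uX => x uX; rewrite unitmx_mul uY.
Qed.

(** The Jacobian of P at 0 is nonzero. If it is positive, P can be corrected directly; if it is
    negative, P followed by M has positive Jacobian and carries A2 to B, with X replaced by Y^-1
    X. *)
Lemma vp_of_G_equiv A1 A2 B lam1 lam2 delta1 delta2 M Y :
  exact_qh A1 lam1 delta1 -> (forall k, (0 < lam1 k)%N) ->
  exact_qh A2 lam2 delta2 -> (forall k, (0 < lam2 k)%N) ->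
  reflects M Y A1 A2 -> G_equiv A1 B -> vp_equiv dx1dx2 A1 B \/ vp_equiv dx1dx2 A2 B.
Proof.
move=> q1 l1 q2 l2 [MM detM uY HM] [P dP cP].
have [sP P0 [Q [sQ Q0 QP PQ]]] := dP.
have JE := nbhs_singleton (diffeo_jacmx sP P0 sQ QP).
have : \det (jacmx P 0) != 0.
  apply/eqP => E; move/(congr1 determinant): JE.
  by rewrite det_mulmx E mul0r det1 => /esym/eqP; rewrite oner_eq0.
rewrite neq_lt => /orP[neg|pos]; last first.
  by left; exact: vp_equiv_of_pos q1 l1 dP pos cP.
right.
have dPM : diffeo_germ (mulmxr M \o P).
  by apply: diffeo_germ_comp => //; exact: diffeo_germ_involution.
apply: (vp_equiv_of_pos q2 l2 dPM).
  have dP0 : differentiable P 0 by exact: (nbhs_singleton (smooth_germ_diff sP)).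
  rewrite jacmx_comp//; last first.
    by apply: linear_differentiable; exact: mulmxr_continuous.
  by rewrite jacmx_mulmxr det_mulmx detM mulrN1 oppr_gt0.
case: cP => X gX BX; exists (fun x => invmx Y *m X x).
  by apply: GL_germ_cstM => //; rewrite unitmx_inv.
apply: filterS BX => x ->; rewrite /= HM trmx_mul !mulmxA; congr (_ *m _).
rewrite mulmxK// -!mulmxA; congr (_ *m _); rewrite mulmxA -trmx_mul mulmxV//.
by rewrite trmx1 mul1mx.
Qed.

Lemma G_equiv_of_vp A1 A2 B M Y : reflects M Y A1 A2 -> vp_equiv dx1dx2 A2 B -> G_equiv A1 B.
Proof.
move=> [MM detM uY HM] [P [dP _ [X gX BX]]].
exists (mulmxr M \o P).
  by apply: diffeo_germ_comp => //; exact: diffeo_germ_involution.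
exists (fun x => Y *m X x); first exact: GL_germ_cstM.
apply: filterS BX => x ->; rewrite /= trmx_mul !mulmxA; congr (_ *m _).
by rewrite -!mulmxA; congr (_ *m _); rewrite mulmxA -HM -mulmxA MM mulmx1.
Qed.

Lemma one_vp_class_of_qh A lam delta M Y : exact_qh A lam delta -> (forall k, (0 < lam k)%N) ->
  reflects M Y A A -> one_vp_class dx1dx2 A.
Proof.
move=> qA l rA B _; split=> [/(vp_of_G_equiv qA l qA l rA)[]//|].
by move=> [P [dP _ cP]]; exists P.
Qed.

Lemma two_vp_classes_of_qh A1 A2 lam1 lam2 delta1 delta2 M Y :
  exact_qh A1 lam1 delta1 -> (forall k, (0 < lam1 k)%N) ->
  exact_qh A2 lam2 delta2 -> (forall k, (0 < lam2 k)%N) ->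
  reflects M Y A1 A2 -> ~ vp_equiv dx1dx2 A1 A2 -> two_vp_classes dx1dx2 A1 A1 A2.
Proof.
move=> q1 l1 q2 l2 rA nvp; split=> // B _; split.
  exact: vp_of_G_equiv q1 l1 q2 l2 rA.
by move=> [[P [dP _ cP]]|]; [exists P|exact: G_equiv_of_vp rA].
Qed.

End Plane.

(** * Germs along lines *)

Section Lines.
Context {R : realType}.

Definition c0 (h : R -> R) := {for 0, continuous h}.

Lemma c0D f g : c0 f -> c0 g -> c0 (fun t => f t + g t).
Proof. by move=> cf cg; exact: cvgD. Qed.

Lemma c0M f g : c0 f -> c0 g -> c0 (fun t => f t * g t).
Proof. by move=> cf cg; exact: cvgM. Qed.

Lemma c0N f : c0 f -> c0 (fun t => - f t).
Proof. by move=> cf; exact: cvgN. Qed.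

Lemma c0_cst c : c0 (fun=> c).
Proof. exact: cvg_cst. Qed.

Lemma c0_id : c0 (fun t => t).
Proof. exact: cvg_id. Qed.

Lemma c0X n f : c0 f -> c0 (fun t => f t ^+ n).
Proof.
move=> cf; elim: n => [|n IH]; first exact: c0_cst.
by under eq_fun do rewrite exprS; exact: c0M.
Qed.

Lemma c0_line r {v : 'rV[R]_r} (F : 'rV[R]_r -> R) : smooth_germ F -> c0 (fun t => F (t *: v)).
Proof.
move=> /smooth_germ_cvg cF; rewrite /c0; apply: continuous_comp.
  by apply: cvgZr_tmp; exact: cvg_id.
by rewrite scale0r.
Qed.

Lemma near_line r (v : 'rV[R]_r) (A : set 'rV[R]_r) :
  (\forall x \near (0 : 'rV[R]_r), A x) -> \forall t \near (0 : R), A (t *: v).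
Proof.
move=> nA.
have c : {for (0 : R), continuous (fun t : R => t *: v)} by apply: cvgZr_tmp; exact: cvg_id.
by apply: c; rewrite scale0r.
Qed.

(** The device that extracts lowest-order coefficients: h vanishes at all small t other than 0,
    hence at 0 by continuity. *)
Lemma c0_eq0 n h : c0 h -> (\forall t \near (0 : R), t ^+ n * h t = 0) -> h 0 = 0.
Proof.
move=> ch H; apply/eqP; case: eqP => // /eqP h0.
have N : \forall t \near (0 : R), h t != 0.
  have O : nbhs (h 0) [set y | y != 0] by apply: open_nbhs_nbhs; split=> //; exact: open_neq.
  exact: (ch _ O).
have [e /= e0 He] := (nbhs_ballP _ _).1 (filterI H N).
have : ball (0 : R) e (e / 2).
  by rewrite -ball_normE /= sub0r normrN gtr0_norm ?divr_gt0// ltr_pdivrMr// ltr_pMr// ltr1n.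
move=> /He[/eqP]; rewrite mulf_eq0 expf_eq0 => /orP[/andP[_]|].
  by rewrite gt_eqF// divr_gt0.
by move=> + /negP.
Qed.

End Lines.

Ltac c0_tac := lazymatch goal with
  | |- c0 (fun=> ?c) => exact: (@c0_cst _ c)
  | |- c0 (fun t => t) => exact: c0_id
  | |- c0 (fun t => @?f t + @?g t) => apply: (@c0D _ f g); c0_tac
  | |- c0 (fun t => - @?f t) => apply: (@c0N _ f); c0_tac
  | |- c0 (fun t => @?f t ^+ ?n) => apply: (@c0X _ n f); c0_tac
  | |- c0 (fun t => @?f t * @?g t) => apply: (@c0M _ f g); c0_tac
  | _ => first [match goal with H : c0 ?f |- c0 (fun t => ?f t) => exact H end
      | match goal with H : c0 ?f |- c0 ?f => exact H end]
  end.

(** * Two variables, symmetric two-by-two matrices, reflections *)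

Section PlaneLemmas.
Context {R : realType}.
Implicit Types (f g : 'rV[R]_2 -> R).

Definition row2 (a b : R) : 'rV[R]_2 := \row_k if k == 0 then a else b.

Lemma row2E a b : (row2 a b 0 0 = a) * (row2 a b 0 1 = b).
Proof. by rewrite !mxE. Qed.

Lemma scale_row2E t a b : ((t *: row2 a b) 0 0 = t * a) * ((t *: row2 a b) 0 1 = t * b).
Proof. by rewrite !mxE. Qed.

Lemma ord2P (P : 'I_2 -> Prop) : P 0 -> P 1 -> forall i, P i.
Proof.
move=> P0 P1 [[|[|//]] H]; first by rewrite (_ : Ordinal H = 0)//; exact: val_inj.
by rewrite (_ : Ordinal H = 1)//; exact: val_inj.
Qed.

Lemma mx2P (A B : 'M[R]_2) : A 0 0 = B 0 0 -> A 0 1 = B 0 1 -> A 1 0 = B 1 0 -> A 1 1 = B 1 1 -> A = B.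
Proof. by move=> ? ? ? ?; apply/matrixP; apply: ord2P; apply: ord2P. Qed.

Lemma row2P (x y : 'rV[R]_2) : x 0 0 = y 0 0 -> x 0 1 = y 0 1 -> x = y.
Proof. by move=> ? ?; apply/rowP; exact: ord2P. Qed.

Lemma sym2E (a b d : R) : (sym2 a b d 0 0 = a) * (sym2 a b d 0 1 = b) *
  (sym2 a b d 1 0 = b) * (sym2 a b d 1 1 = d).
Proof. by rewrite !mxE. Qed.

(** One coordinate is divided out after the other. The last clause identifies the quotients at 0
    with partial derivatives, which links expansions along lines to the Jacobian matrix. *)
Lemma hadamard2 f : smooth_germ f -> exists g1 g2 : 'rV[R]_2 -> R,
  [/\ smooth_germ g1, smooth_germ g2,
   \forall x \near (0 : 'rV[R]_2), f x = f 0 + x 0 0 * g1 x + x 0 1 * g2 x &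
   partial 0 f 0 = g1 0 /\ partial 1 f 0 = g2 0].
Proof.
move=> sf; have [g1 sg1 E1] := hadamard_coord 0 sf.
pose p (x : 'rV[R]_2) : 'rV[R]_2 := \row_k (if k == 0 then 0 else x 0 k).
have sp : smooth_germ p.
  apply/smooth_germ_mxP => i j; rewrite /p; under eq_fun do rewrite mxE.
  by case: (j == 0); [exact: smooth_germ_cst|exact: smooth_germ_coord].
have p0 : p 0 = 0 by apply/rowP => k; rewrite !mxE; case: ifP.
have sfp : smooth_germ (f \o p) by exact: smooth_germ_comp.
have [g2 sg2 E2] := hadamard_coord 1 sfp.
have E : \forall x \near (0 : 'rV[R]_2), f x = f 0 + x 0 0 * g1 x + x 0 1 * g2 x.
  near=> x.
  have -> : f x = f (p x) + x 0 0 * g1 x by near: x.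
  have : (f \o p) x = (f \o p) (\row_k (if k == 1 then 0 else x 0 k)) + x 0 1 * g2 x by near: x.
  rewrite /= => ->; rewrite (_ : p (\row__ _) = 0); first by rewrite addrAC.
  by apply: row2P; rewrite !mxE.
exists g1, g2; split=> //.
have c0x i : differentiable (fun x : 'rV[R]_2 => x 0 i) 0 by exact: differentiable_coord.
have d1 := nbhs_singleton (smooth_germ_diff sg1).
have d2 := nbhs_singleton (smooth_germ_diff sg2).
have dp1 : differentiable (fun x : 'rV[R]_2 => x 0 0 * g1 x) 0 by exact: differentiableM.
have dp2 : differentiable (fun x : 'rV[R]_2 => x 0 1 * g2 x) 0 by exact: differentiableM.
have dc : differentiable (fun x : 'rV[R]_2 => f 0) 0 by exact: differentiable_cst.
have dd : differentiable (fun x : 'rV[R]_2 => f 0 + x 0 0 * g1 x) 0 by exact: differentiableD.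
have P i : partial i f 0 = (i == 0)%:R * g1 0 + (i == 1)%:R * g2 0.
  rewrite (eq_partial i E) partialD// partialD// !partialM// !partial_coord.
  by rewrite [partial i (fun=> _) 0]/partial derive_cst !mxE !mul0r !addr0 add0r.
by rewrite !P/= !mul1r !mul0r addr0 add0r.
Unshelve. all: by end_near. Qed.

Lemma congr_sym2 (X : 'M[R]_2) (a b d : R) : X^T *m sym2 a b d *m X =
  sym2 (X 0 0 ^+ 2 * a + 2 * X 0 0 * X 1 0 * b + X 1 0 ^+ 2 * d)
    (X 0 0 * X 0 1 * a + (X 0 0 * X 1 1 + X 0 1 * X 1 0) * b + X 1 0 * X 1 1 * d)
    (X 0 1 ^+ 2 * a + 2 * X 0 1 * X 1 1 * b + X 1 1 ^+ 2 * d).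
Proof. by apply: mx2P; rewrite !(mxE, sum2E)/=; ring. Qed.

Lemma sym2_inj (a b d a' b' d' : R) : sym2 a b d = sym2 a' b' d' -> [/\ a = a', b = b' & d = d'].
Proof.
by move=> E; split; [have := congr1 (fun M : 'M[R]_2 => M 0 0) E|
  have := congr1 (fun M : 'M[R]_2 => M 0 1) E|have := congr1 (fun M : 'M[R]_2 => M 1 1) E];
  rewrite !sym2E.
Qed.

Lemma half_pow_double (t : R) m : half_pow t m.*2 = t ^+ m.
Proof. by rewrite /half_pow odd_double doubleK. Qed.

Lemma exact_qh_sym2 (fa fb fd : R -> R -> R) a b d1 d2 :
  (forall t x1 x2, fa (t ^+ a * x1) (t ^+ b * x2) = t ^+ d1 * fa x1 x2) ->
  (forall t x1 x2, fb (t ^+ a * x1) (t ^+ b * x2) = half_pow t (d1 + d2) * fb x1 x2) ->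
  (forall t x1 x2, fd (t ^+ a * x1) (t ^+ b * x2) = t ^+ d2 * fd x1 x2) ->
  exact_qh (plane_germ (fun x1 x2 => sym2 (fa x1 x2) (fb x1 x2) (fd x1 x2)))
    (pair_weights a b) (pair_weights d1 d2).
Proof.
move=> Ha Hb Hd t x i j; rewrite /plane_germ ![weighted_scale _ _ _ _ _]mxE /=.
move: i j; apply: ord2P; apply: ord2P; rewrite !sym2E/= /pair_weights/=.
- by rewrite addnn half_pow_double.
- by [].
- by rewrite addnC.
- by rewrite addnn half_pow_double.
Qed.

Lemma reflects_sym2 (F1 F2 : R -> R -> 'M[R]_2) (a b d : R) (Y : 'M[R]_2) :
  sym2 a b d *m sym2 a b d = 1%:M -> a * d - b * b = -1 -> Y \in unitmx ->
  (forall x1 x2, F2 (x1 * a + x2 * b) (x1 * b + x2 * d) = Y^T *m F1 x1 x2 *m Y) ->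
  reflects (sym2 a b d) Y (plane_germ F1) (plane_germ F2).
Proof.
move=> MM dM uY H; split=> //; first by rewrite det2E !sym2E.
by move=> x; rewrite /plane_germ -H !mxE !sum2E !mxE.
Qed.

Lemma diag2_unit (a d : R) : a * d != 0 -> sym2 a 0 d \in unitmx.
Proof. by move=> ad; rewrite unitmxE unitfE det2E !sym2E mulr0 subr0. Qed.

Lemma reflects_x2 (F1 F2 : R -> R -> 'M[R]_2) (Y : 'M[R]_2) : Y \in unitmx ->
  (forall x1 x2, F2 x1 (- x2) = Y^T *m F1 x1 x2 *m Y) ->
  reflects (sym2 1 0 (-1)) Y (plane_germ F1) (plane_germ F2).
Proof.
move=> uY H; apply: reflects_sym2 => //.
- by apply: mx2P; rewrite !(mxE, sum2E)/=; ring.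
- by ring.
by move=> x1 x2; rewrite -H; congr F2; ring.
Qed.

Lemma reflects_x1 (F1 F2 : R -> R -> 'M[R]_2) (Y : 'M[R]_2) : Y \in unitmx ->
  (forall x1 x2, F2 (- x1) x2 = Y^T *m F1 x1 x2 *m Y) ->
  reflects (sym2 (-1) 0 1) Y (plane_germ F1) (plane_germ F2).
Proof.
move=> uY H; apply: reflects_sym2 => //.
- by apply: mx2P; rewrite !(mxE, sum2E)/=; ring.
- by ring.
by move=> x1 x2; rewrite -H; congr F2; ring.
Qed.

End PlaneLemmas.

(** * Volume-preserving classes of the normal forms *)

Section NormalForms.
Context {R : realType}.
Implicit Types (s e : bool) (l : nat).

Lemma pair_weights_gt0 a b : (0 < a)%N -> (0 < b)%N -> forall k, (0 < pair_weights a b k)%N.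
Proof. by move=> a0 b0; apply: ord2P. Qed.

Lemma qh_nf1 : exact_qh (@nf1 R) (pair_weights 1 1) (pair_weights 1 1).
Proof. by apply: exact_qh_sym2 => t x1 x2; rewrite ?expr1// mulr0. Qed.

Lemma qh_nf2 : exact_qh (@nf2 R) (pair_weights 1 1) (pair_weights 1 1).
Proof. by apply: exact_qh_sym2 => t x1 x2; rewrite ?(half_pow_double t 1) ?expr1// mulrN. Qed.

(** With x1 of weight 2 the diagonal entries have quasi-degrees 2 and 2l, so the off-diagonal x2
    must have the mean weight l + 1. Giving x1 weight 2 keeps the quasi-degrees and the weight of x2
    integral. *)
Lemma qh_nf3 s l : exact_qh (@nf3 R s l) (pair_weights 2 (l + 1)) (pair_weights 2 (l.*2)).
Proof.
apply: exact_qh_sym2 => t x1 x2 //.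
  by rewrite (_ : (2 + l.*2)%N = (l + 1).*2) ?half_pow_double// addn1 doubleS.
by rewrite exprMn -exprM mul2n; ring.
Qed.

Lemma qh_nf4 l : exact_qh (@nf4 R l) (pair_weights l 1) (pair_weights l l).
Proof.
apply: exact_qh_sym2 => t x1 x2 //.
by rewrite addnn half_pow_double expr1 exprMn.
Qed.

Lemma qh_nf5 s1 s2 l1 l2 :
  exact_qh (@nf5 R s1 s2 l1 l2) (pair_weights (l1 + l2) 2) (pair_weights l1.*2 l2.*2).
Proof.
apply: exact_qh_sym2 => t x1 x2.
- by rewrite exprMn -exprM mul2n; ring.
- by rewrite -doubleD half_pow_double.
- by rewrite exprMn -exprM mul2n; ring.
Qed.

Lemma qh_nf6 s : exact_qh (@nf6 R s) (pair_weights 4 3) (pair_weights 4 8).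
Proof.
apply: exact_qh_sym2 => t x1 x2 //.
  by rewrite (half_pow_double t 6); ring.
by ring.
Qed.

Lemma qh_nf7 s1 s2 l : exact_qh (@nf7 R s1 s2 l) (pair_weights 2 l) (pair_weights 2 l.*2).
Proof.
apply: exact_qh_sym2 => t x1 x2 //; first by rewrite mulr0.
have e1 : (t ^+ l) ^+ 2 = t ^+ l.*2 by rewrite -exprM muln2.
have e2 : (t ^+ 2) ^+ l = t ^+ l.*2 by rewrite -exprM mul2n.
by rewrite [(t ^+ l * x2) ^+ 2]exprMn e1 [(t ^+ 2 * x1) ^+ l]exprMn e2; ring.
Qed.

Lemma qh_nf8 e s l : (0 < l)%N ->
  exact_qh (@nf8 R e s l) (pair_weights 1 (l - 1)) (pair_weights (l - 1) l).
Proof.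
move=> l0; apply: exact_qh_sym2 => t x1 x2 //; first by rewrite mulr0.
by case: l l0 => // l _; rewrite subn1 /= expr1 !exprMn exprS; ring.
Qed.

Lemma qh_nf9 e l : (0 < l)%N ->
  exact_qh (@nf9 R e l) (pair_weights (2 * l - 1) 2) (pair_weights (2 * l - 1) (2 * l + 1)).
Proof.
move=> l0; apply: exact_qh_sym2 => t x1 x2.
- by ring.
- have -> : (2 * l - 1 + (2 * l + 1))%N = (2 * l).*2 by lia.
  by rewrite half_pow_double exprMn -exprM.
- have -> : (2 * l + 1)%N = (2 * l - 1 + 2)%N by lia.
  by rewrite exprD; ring.
Qed.

Lemma qh_nf10 s e : exact_qh (@nf10 R s e) (pair_weights 3 2) (pair_weights 3 6).
Proof. by apply: exact_qh_sym2 => t x1 x2; rewrite ?mulr0//; ring. Qed.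

(** * Orientation-reversing symmetries and mirror images *)

Let one_unit : sym2 1 0 (1 : R) \in unitmx.
Proof. by apply: diag2_unit; rewrite mulr1 oner_eq0. Qed.

Let flip_unit : sym2 1 0 (-1 : R) \in unitmx.
Proof. by apply: diag2_unit; rewrite mul1r oppr_eq0 oner_eq0. Qed.

(** Exchanging x1 and x2 reverses orientation and is undone by exchanging the two basis vectors. *)
Lemma one_class_nf1 : one_vp_class dx1dx2 (@nf1 R).
Proof.
apply: (one_vp_class_of_qh qh_nf1 (M := sym2 0 1 0) (Y := sym2 0 1 0)); first exact: pair_weights_gt0.
have u : sym2 0 1 (0 : R) \in unitmx.
  by rewrite unitmxE unitfE det2E !sym2E mulr0 sub0r mulr1 oppr_eq0 oner_eq0.
apply: reflects_sym2 => //.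
- by apply: mx2P; rewrite !(mxE, sum2E)/=; ring.
- by ring.
by move=> x1 x2; rewrite congr_sym2 !sym2E; congr sym2; ring.
Qed.

Lemma one_class_nf2 : one_vp_class dx1dx2 (@nf2 R).
Proof.
apply: (one_vp_class_of_qh qh_nf2); first exact: pair_weights_gt0.
apply: (reflects_x2 flip_unit) => x1 x2.
by rewrite congr_sym2 !sym2E; congr sym2; ring.
Qed.

Lemma one_class_nf3 s l : one_vp_class dx1dx2 (@nf3 R s l).
Proof.
apply: (one_vp_class_of_qh (qh_nf3 s l)); first by apply: pair_weights_gt0 => //; rewrite addn1.
apply: (reflects_x2 flip_unit) => x1 x2.
by rewrite congr_sym2 !sym2E; congr sym2; ring.
Qed.

(** Changing the sign of x2 multiplies the off-diagonal entry by (-1)^l, which a congruence by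
    diag(1, (-1)^l) compensates. *)
Lemma one_class_nf4 l : (0 < l)%N -> one_vp_class dx1dx2 (@nf4 R l).
Proof.
move=> l0; apply: (one_vp_class_of_qh (qh_nf4 l)); first exact: pair_weights_gt0.
have u : sym2 1 0 ((-1) ^+ l : R) \in unitmx.
  by apply: diag2_unit; rewrite mul1r signr_eq0.
have ss : ((-1) ^+ l : R) ^+ 2 = 1 by rewrite sqrr_sign.
apply: (reflects_x2 u) => x1 x2.
by rewrite congr_sym2 !sym2E ss [(- x2) ^+ l]exprNn; congr sym2; ring.
Qed.

(** Here x1 occurs only off the diagonal, so its sign is absorbed by diag(1, -1). *)
Lemma one_class_nf5 s1 s2 l1 l2 : (0 < l1)%N -> one_vp_class dx1dx2 (@nf5 R s1 s2 l1 l2).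
Proof.
move=> l0; apply: (one_vp_class_of_qh (qh_nf5 s1 s2 l1 l2)).
  by apply: pair_weights_gt0 => //; rewrite ltn_addr.
apply: (reflects_x1 flip_unit) => x1 x2.
by rewrite congr_sym2 !sym2E; congr sym2; ring.
Qed.

(** Only the square of x2 occurs, so the reflection in x2 leaves the germ unchanged. *)
Lemma one_class_nf6 s : one_vp_class dx1dx2 (@nf6 R s).
Proof.
apply: (one_vp_class_of_qh (qh_nf6 s)); first exact: pair_weights_gt0.
apply: (reflects_x2 one_unit) => x1 x2.
by rewrite congr_sym2 !sym2E; congr sym2; ring.
Qed.

Lemma one_class_nf7 s1 s2 l : (0 < l)%N -> one_vp_class dx1dx2 (@nf7 R s1 s2 l).
Proof.
move=> l0; apply: (one_vp_class_of_qh (qh_nf7 s1 s2 l)); first exact: pair_weights_gt0.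
apply: (reflects_x2 one_unit) => x1 x2.
by rewrite congr_sym2 !sym2E; congr sym2; ring.
Qed.

(** The reflection in x1 changes the sign of x1 x2 and multiplies x1^l by (-1)^l. For odd l the sign
    of the pure power changes as well, hence [odd l (+) s]. *)
Lemma reflects_nf8 s l : exists M Y, reflects M Y (@nf8 R false s l) (@nf8 R true (odd l (+) s) l).
Proof.
exists (sym2 (-1) 0 1), (sym2 1 0 1); apply: (reflects_x1 one_unit) => x1 x2.
rewrite congr_sym2 !sym2E signr_addb signr_odd [(- x1) ^+ l]exprNn expr0 expr1.
have ss : ((-1) ^+ l : R) * (-1) ^+ l = 1 by rewrite -expr2 sqrr_sign.
rewrite [X in _ + X]mulrACA ss mul1r.
by congr sym2; ring.
Qed.

Lemma reflects_nf9 l : exists M Y, reflects M Y (@nf9 R false l) (@nf9 R true l).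
Proof.
exists (sym2 (-1) 0 1), (sym2 1 0 1); apply: (reflects_x1 one_unit) => x1 x2.
by rewrite congr_sym2 !sym2E expr0 expr1; congr sym2; ring.
Qed.

Lemma reflects_nf10 s : exists M Y, reflects M Y (@nf10 R s false) (@nf10 R s true).
Proof.
exists (sym2 1 0 (-1)), (sym2 1 0 1); apply: (reflects_x2 one_unit) => x1 x2.
by rewrite congr_sym2 !sym2E expr0 expr1; congr sym2; ring.
Qed.

(** * Obstructions to volume-preserving equivalence with the mirror image *)

Lemma smooth_germ_line (v0 v1 : R) (f : 'rV[R]_2 -> R) : smooth_germ f ->
  exists2 f' : R -> R, c0 f' &
    \forall t \near (0 : R), f (t *: row2 v0 v1) = f 0 + t * f' t.
Proof.
move=> /hadamard2[g1 [g2 [s1 s2 E _]]].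
exists (fun t => v0 * g1 (t *: row2 v0 v1) + v1 * g2 (t *: row2 v0 v1)).
  have c1 := c0_line (v := row2 v0 v1) s1; have c2 := c0_line (v := row2 v0 v1) s2.
  by c0_tac.
apply: filterS (near_line (row2 v0 v1) E) => t ->.
by rewrite !scale_row2E; ring.
Qed.

(* What a volume-preserving equivalence (Phi, X) looks like along the line
   t |-> t (v0, v1): Phi = t (G1, G2) there, and X = (A B; C D). *)
Lemma vp_equiv_sym2 (fa fb fd ga gb gd : R -> R -> R) :
  vp_equiv dx1dx2 (plane_germ (fun x1 x2 => sym2 (fa x1 x2) (fb x1 x2) (fd x1 x2)))
    (plane_germ (fun x1 x2 => sym2 (ga x1 x2) (gb x1 x2) (gd x1 x2))) ->
  exists p11 p12 p21 p22 a b d : R, p11 * p22 - p12 * p21 = 1 /\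
  forall v0 v1 : R, exists G1 G1' G2 A B B' C D : R -> R,
  [/\ [/\ c0 G1, c0 G1', c0 G2 & c0 B'], [/\ c0 A, c0 B, c0 C & c0 D],
    [/\ G1 0 = v0 * p11 + v1 * p12, G2 0 = v0 * p21 + v1 * p22, A 0 = a, B 0 = b & D 0 = d] &
    \forall t \near (0 : R), [/\ G1 t = G1 0 + t * G1' t, B t = b + t * B' t,
      ga (t * v0) (t * v1) = A t ^+ 2 * fa (t * G1 t) (t * G2 t) +
        2 * A t * C t * fb (t * G1 t) (t * G2 t) + C t ^+ 2 * fd (t * G1 t) (t * G2 t) &
      gd (t * v0) (t * v1) = B t ^+ 2 * fa (t * G1 t) (t * G2 t) +
        2 * B t * D t * fb (t * G1 t) (t * G2 t) + D t ^+ 2 * fd (t * G1 t) (t * G2 t)]].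
Proof.
move=> [P [[sP P0 _] /(preserves_detP sP) /nbhs_singleton dP [X [sX _] BX]]].
have sPj j : smooth_germ (fun x => P x 0 j) by move/smooth_germ_mxP : sP; apply.
have [g11 [g12 [s11 s12 E1 [p11 p12]]]] := hadamard2 (sPj 0).
have [g21 [g22 [s21 s22 E2 [p21 p22]]]] := hadamard2 (sPj 1).
have sXij i j : smooth_germ (fun x => X x i j) by move/smooth_germ_mxP : sX; apply.
exists (g11 0), (g12 0), (g21 0), (g22 0), (X 0 0 0), (X 0 0 1), (X 0 1 1).
split; first by move: dP; rewrite det2E !mxE p11 p12 p21 p22 [g21 0 * _]mulrC.
move=> v0 v1; pose v := row2 v0 v1.
have [g11' c11' E11] := smooth_germ_line v0 v1 s11.
have [g12' c12' E12] := smooth_germ_line v0 v1 s12.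
have [B' cB' EB] := smooth_germ_line v0 v1 (sXij 0 1).
have c11 := c0_line (v := v) s11; have c12 := c0_line (v := v) s12.
have c21 := c0_line (v := v) s21; have c22 := c0_line (v := v) s22.
exists (fun t => v0 * g11 (t *: v) + v1 * g12 (t *: v)), (fun t => v0 * g11' t + v1 * g12' t),
  (fun t => v0 * g21 (t *: v) + v1 * g22 (t *: v)), (fun t => X (t *: v) 0 0),
  (fun t => X (t *: v) 0 1), B', (fun t => X (t *: v) 1 0), (fun t => X (t *: v) 1 1).
split.
- by split; c0_tac.
- by split; [exact: (c0_line (v := v) (sXij 0 0))|exact: (c0_line (v := v) (sXij 0 1))|
    exact: (c0_line (v := v) (sXij 1 0))|exact: (c0_line (v := v) (sXij 1 1))].
- by rewrite scale0r.
rewrite P0 mxE in E1; rewrite P0 mxE in E2.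
have L1 := near_line v E1; have L2 := near_line v E2; have LB := near_line v BX.
near=> t.
have e1 : P (t *: v) 0 0 = t * (v0 * g11 (t *: v) + v1 * g12 (t *: v)).
  have -> : P (t *: v) 0 0 = 0 + (t *: v) 0 0 * g11 (t *: v) + (t *: v) 0 1 * g12 (t *: v) by near: t.
  by rewrite !scale_row2E; ring.
have e2 : P (t *: v) 0 1 = t * (v0 * g21 (t *: v) + v1 * g22 (t *: v)).
  have -> : P (t *: v) 0 1 = 0 + (t *: v) 0 0 * g21 (t *: v) + (t *: v) 0 1 * g22 (t *: v) by near: t.
  by rewrite !scale_row2E; ring.
have : plane_germ (fun x1 x2 => sym2 (ga x1 x2) (gb x1 x2) (gd x1 x2)) (t *: v) =
  (X (t *: v))^T *m plane_germ (fun x1 x2 => sym2 (fa x1 x2) (fb x1 x2) (fd x1 x2)) (P (t *: v)) *m X (t *: v).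
  by near: t.
rewrite /plane_germ congr_sym2 e1 e2 !scale_row2E => /sym2_inj[Ea _ Ed]; split=> //.
- have -> : g11 (t *: v) = g11 0 + t * g11' t by near: t.
  have -> : g12 (t *: v) = g12 0 + t * g12' t by near: t.
  by rewrite scale0r; ring.
- by near: t.
Unshelve. all: by end_near. Qed.

Lemma eq_subr0 (x y : R) : x = y -> y - x = 0.
Proof. by move=> ->; rewrite subrr. Qed.

(** First-order terms on the two axes give p21 = 0 and b = 0. Since l is at least 3, the
    second-order terms of the 22 entry see only x1 x2 and give d^2 p11 p22 = -1, while volume
    preservation gives p11 p22 = 1. So d^2 = -1, which is impossible. *)
Lemma not_vp_nf8 s s' l : (3 <= l)%N -> ~ vp_equiv dx1dx2 (@nf8 R false s l) (@nf8 R true s' l).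
Proof.
move=> l3 /(vp_equiv_sym2 (fa := fun _ x2 => x2) (fb := fun _ _ => 0)
  (fd := fun x1 x2 => (-1) ^+ false * (x1 * x2) + (-1) ^+ s * x1 ^+ l)
  (ga := fun _ x2 => x2) (gb := fun _ _ => 0)
  (gd := fun x1 x2 => (-1) ^+ true * (x1 * x2) + (-1) ^+ s' * x1 ^+ l)).
have -> : l = (l - 3).+3 by rewrite -addn3 subnK.
move: (l - 3)%N => {l3}l.
move: ((-1) ^+ s) ((-1) ^+ s') => S S'; rewrite expr0 expr1.
move=> [p11 [p12 [p21 [p22 [a [b [d [J H]]]]]]]].
have [/eqP a22 /eqP b22] : a ^+ 2 * p22 - 1 = 0 /\ b ^+ 2 * p22 = 0.
  have [G1 [G1' [G2 [A [B [B' [C [D [[? ? ? ?] [? ? ? ?] [E1 E2 E3 E4 E5] E]]]]]]]]] := H 0 1.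
  split.
    (* [h] is the difference of the two sides of the 11 equation along the line, divided by t; its
       value at 0 is the wanted relation. The same pattern recurs below with higher powers of t. *)
    pose h t := A t ^+ 2 * G2 t + C t ^+ 2 * (t * G1 t * G2 t + S * (t ^+ l.+2 * G1 t ^+ l.+3)) - 1.
    transitivity (h 0); first by rewrite /h E2 E3 !exprS; ring.
    apply: (@c0_eq0 _ 1); first by rewrite /h; c0_tac.
    apply: filterS E => t [_ _ E _]; apply: etrans (eq_subr0 E).
    by rewrite /h !(mul0r, mulr0, mulr1, mul1r, add0r, addr0) !exprMn !exprS; ring.
  pose h t := B t ^+ 2 * G2 t + D t ^+ 2 * (t * G1 t * G2 t + S * (t ^+ l.+2 * G1 t ^+ l.+3)).
  transitivity (h 0); first by rewrite /h E2 E4 !exprS; ring.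
  apply: (@c0_eq0 _ 1); first by rewrite /h; c0_tac.
  apply: filterS E => t [_ _ _ E]; apply: etrans (eq_subr0 E).
  by rewrite /h !(mul0r, mulr0, mulr1, mul1r, add0r, addr0) !exprMn !exprS; ring.
have p21_0 : a ^+ 2 * p21 = 0.
  have [G1 [G1' [G2 [A [B [B' [C [D [[? ? ? ?] [? ? ? ?] [E1 E2 E3 E4 E5] E]]]]]]]]] := H 1 0.
  pose h t := A t ^+ 2 * G2 t + C t ^+ 2 * (t * G1 t * G2 t + S * (t ^+ l.+2 * G1 t ^+ l.+3)).
  transitivity (h 0); first by rewrite /h E2 E3 !exprS; ring.
  apply: (@c0_eq0 _ 1); first by rewrite /h; c0_tac.
  apply: filterS E => t [_ _ E _]; apply: etrans (eq_subr0 E).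
  by rewrite /h !(mul0r, mulr0, mulr1, mul1r, add0r, addr0) !exprMn !exprS; ring.
have a0 : a != 0 by apply: contraTneq a22 => ->; rewrite expr0n mul0r sub0r oppr_eq0 oner_eq0.
have p210 : p21 = 0 by move/eqP: p21_0; rewrite mulf_eq0 expf_eq0 (negPf a0) => /eqP.
have p220 : p22 != 0 by apply: contraTneq a22 => ->; rewrite mulr0 sub0r oppr_eq0 oner_eq0.
have b0 : b = 0 by move: b22; rewrite mulf_eq0 expf_eq0 (negPf p220) orbF => /eqP.
have d1 : d ^+ 2 * p12 * p22 = 0.
  have [G1 [G1' [G2 [A [B [B' [C [D [[? ? ? ?] [? ? ? ?] [E1 E2 E3 E4 E5] E]]]]]]]]] := H 0 1.
  (* Because b = 0, B is t times [B'], so the 22 equation is divisible by t^2. *)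
  pose h t := t * B' t ^+ 2 * G2 t + D t ^+ 2 * (G1 t * G2 t + S * (t ^+ l.+1 * G1 t ^+ l.+3)).
  transitivity (h 0); first by rewrite /h E1 E2 E5 !exprS; ring.
  apply: (@c0_eq0 _ 2); first by rewrite /h; c0_tac.
  apply: filterS E => t [_ EB _ E]; apply: etrans (eq_subr0 E).
  by rewrite /h EB b0 !(mul0r, mulr0, mulr1, mul1r, add0r, addr0) !exprMn !exprS; ring.
have d2 : d ^+ 2 * (p11 + p12) * p22 + 1 = 0.
  have [G1 [G1' [G2 [A [B [B' [C [D [[? ? ? ?] [? ? ? ?] [E1 E2 E3 E4 E5] E]]]]]]]]] := H 1 1.
  pose h t := t * B' t ^+ 2 * G2 t + D t ^+ 2 * (G1 t * G2 t + S * (t ^+ l.+1 * G1 t ^+ l.+3)) + 1 - S' * t ^+ l.+1.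
  transitivity (h 0); first by rewrite /h E1 E2 E5 p210 !exprS; ring.
  apply: (@c0_eq0 _ 2); first by rewrite /h; c0_tac.
  apply: filterS E => t [_ EB _ E]; apply: etrans (eq_subr0 E).
  by rewrite /h EB b0 !(mul0r, mulr0, mulr1, mul1r, add0r, addr0) !exprMn !exprS; ring.
have : d ^+ 2 + 1 = 0.
  rewrite p210 mulr0 subr0 in J.
  transitivity (d ^+ 2 * (p11 * p22) + 1); first by rewrite J mulr1.
  by rewrite -[RHS]d2 mulrDr mulrDl d1 addr0 mulrA.
by apply/eqP; rewrite gt_eqF// ltr_wpDl// sqr_ge0.
Qed.

(** The 11 entry gives p12 = 0 and a^2 p11 = -1, the 22 entry at first order b = 0. At second order
    the 22 entry gives d^2 p11 p22 = -1, against p11 p22 = 1. The off-diagonal x2^l enters the 22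
    entry with the factor B = O(t), hence only at order l + 1. *)
Lemma not_vp_nf9 l : (2 <= l)%N -> ~ vp_equiv dx1dx2 (@nf9 R false l) (@nf9 R true l).
Proof.
move=> l2 /(vp_equiv_sym2 (fa := fun x1 _ => (-1) ^+ false * x1) (fb := fun _ x2 => x2 ^+ l)
  (fd := fun x1 x2 => (-1) ^+ false * (x1 * x2))
  (ga := fun x1 _ => (-1) ^+ true * x1) (gb := fun _ x2 => x2 ^+ l)
  (gd := fun x1 x2 => (-1) ^+ true * (x1 * x2))).
have -> : l = (l - 2).+2 by rewrite -addn2 subnK.
move: (l - 2)%N => {l2}l; rewrite expr0 expr1.
move=> [p11 [p12 [p21 [p22 [a [b [d [J H]]]]]]]].
have /eqP p12_0 : a ^+ 2 * p12 = 0.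
  have [G1 [G1' [G2 [A [B [B' [C [D [[? ? ? ?] [? ? ? ?] [E1 E2 E3 E4 E5] E]]]]]]]]] := H 0 1.
  pose h t := A t ^+ 2 * G1 t + 2 * A t * C t * (t ^+ l.+1 * G2 t ^+ l.+2) + C t ^+ 2 * (t * G1 t * G2 t).
  transitivity (h 0); first by rewrite /h E1 E3 !exprS; ring.
  apply: (@c0_eq0 _ 1); first by rewrite /h; c0_tac.
  apply: filterS E => t [_ _ E _]; apply: etrans (eq_subr0 E).
  by rewrite /h !(mul0r, mulr0, mulr1, mul1r, add0r, addr0) !exprMn !exprS; ring.
have [/eqP a11 /eqP b11] : a ^+ 2 * p11 + 1 = 0 /\ b ^+ 2 * p11 = 0.
  have [G1 [G1' [G2 [A [B [B' [C [D [[? ? ? ?] [? ? ? ?] [E1 E2 E3 E4 E5] E]]]]]]]]] := H 1 0.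
  split.
    pose h t := A t ^+ 2 * G1 t + 2 * A t * C t * (t ^+ l.+1 * G2 t ^+ l.+2) + C t ^+ 2 * (t * G1 t * G2 t) + 1.
    transitivity (h 0); first by rewrite /h E1 E3 !exprS; ring.
    apply: (@c0_eq0 _ 1); first by rewrite /h; c0_tac.
    apply: filterS E => t [_ _ E _]; apply: etrans (eq_subr0 E).
    by rewrite /h !(mul0r, mulr0, mulr1, mul1r, add0r, addr0) !exprMn !exprS; ring.
  pose h t := B t ^+ 2 * G1 t + 2 * B t * D t * (t ^+ l.+1 * G2 t ^+ l.+2) + D t ^+ 2 * (t * G1 t * G2 t).
  transitivity (h 0); first by rewrite /h E1 E4 !exprS; ring.
  apply: (@c0_eq0 _ 1); first by rewrite /h; c0_tac.
  apply: filterS E => t [_ _ _ E]; apply: etrans (eq_subr0 E).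
  by rewrite /h !(mul0r, mulr0, mulr1, mul1r, add0r, addr0) !exprMn !exprS; ring.
have a0 : a != 0 by apply: contraTneq a11 => ->; rewrite expr0n mul0r add0r oner_eq0.
have p120 : p12 = 0 by move: p12_0; rewrite mulf_eq0 expf_eq0 (negPf a0) => /eqP.
have p110 : p11 != 0 by apply: contraTneq a11 => ->; rewrite mulr0 add0r oner_eq0.
have b0 : b = 0 by move: b11; rewrite mulf_eq0 expf_eq0 (negPf p110) orbF => /eqP.
have d1 : d ^+ 2 * p11 * p21 = 0.
  have [G1 [G1' [G2 [A [B [B' [C [D [[? ? ? ?] [? ? ? ?] [E1 E2 E3 E4 E5] E]]]]]]]]] := H 1 0.
  pose h t := t * B' t ^+ 2 * G1 t + 2 * B' t * D t * (t ^+ l.+1 * G2 t ^+ l.+2) + D t ^+ 2 * (G1 t * G2 t).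
  transitivity (h 0); first by rewrite /h E1 E2 E5 p120 !exprS; ring.
  apply: (@c0_eq0 _ 2); first by rewrite /h; c0_tac.
  apply: filterS E => t [_ EB _ E]; apply: etrans (eq_subr0 E).
  by rewrite /h EB b0 !(mul0r, mulr0, mulr1, mul1r, add0r, addr0) !exprMn !exprS; ring.
have d2 : d ^+ 2 * p11 * (p21 + p22) + 1 = 0.
  have [G1 [G1' [G2 [A [B [B' [C [D [[? ? ? ?] [? ? ? ?] [E1 E2 E3 E4 E5] E]]]]]]]]] := H 1 1.
  pose h t := t * B' t ^+ 2 * G1 t + 2 * B' t * D t * (t ^+ l.+1 * G2 t ^+ l.+2) + D t ^+ 2 * (G1 t * G2 t) + 1.
  transitivity (h 0); first by rewrite /h E1 E2 E5 p120 !exprS; ring.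
  apply: (@c0_eq0 _ 2); first by rewrite /h; c0_tac.
  apply: filterS E => t [_ EB _ E]; apply: etrans (eq_subr0 E).
  by rewrite /h EB b0 !(mul0r, mulr0, mulr1, mul1r, add0r, addr0) !exprMn !exprS; ring.
have : d ^+ 2 + 1 = 0.
  rewrite p120 mul0r subr0 in J.
  transitivity (d ^+ 2 * (p11 * p22) + 1); first by rewrite J mulr1.
  by rewrite -[RHS]d2 mulrDr d1 add0r mulrA.
by apply/eqP; rewrite gt_eqF// ltr_wpDl// sqr_ge0.
Qed.

(** The 11 entry gives p12 = 0 and a^2 p11 = 1, so p11 > 0, and p22 > 0 by volume preservation. The
    cubic term of the 22 entry along the x2-axis gives d^2 p22^3 = -1, which contradicts the sign of
    p22. *)
Lemma not_vp_nf10 s : ~ vp_equiv dx1dx2 (@nf10 R s false) (@nf10 R s true).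
Proof.
move=> /(vp_equiv_sym2 (fa := fun x1 _ => x1) (fb := fun _ _ => 0)
  (fd := fun x1 x2 => (-1) ^+ s * x1 ^+ 2 + (-1) ^+ false * x2 ^+ 3)
  (ga := fun x1 _ => x1) (gb := fun _ _ => 0)
  (gd := fun x1 x2 => (-1) ^+ s * x1 ^+ 2 + (-1) ^+ true * x2 ^+ 3)).
move: ((-1) ^+ s) => S; rewrite expr0 expr1.
move=> [p11 [p12 [p21 [p22 [a [b [d [J H]]]]]]]].
have /eqP p12_0 : a ^+ 2 * p12 = 0.
  have [G1 [G1' [G2 [A [B [B' [C [D [[? ? ? ?] [? ? ? ?] [E1 E2 E3 E4 E5] E]]]]]]]]] := H 0 1.
  pose h t := A t ^+ 2 * G1 t + C t ^+ 2 * (S * (t * G1 t ^+ 2) + t ^+ 2 * G2 t ^+ 3).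
  transitivity (h 0); first by rewrite /h E1 E3; ring.
  apply: (@c0_eq0 _ 1); first by rewrite /h; c0_tac.
  apply: filterS E => t [_ _ E _]; apply: etrans (eq_subr0 E).
  by rewrite /h !(mul0r, mulr0, mulr1, mul1r, add0r, addr0); ring.
have [/eqP a11 /eqP b11] : a ^+ 2 * p11 - 1 = 0 /\ b ^+ 2 * p11 = 0.
  have [G1 [G1' [G2 [A [B [B' [C [D [[? ? ? ?] [? ? ? ?] [E1 E2 E3 E4 E5] E]]]]]]]]] := H 1 0.
  split.
    pose h t := A t ^+ 2 * G1 t + C t ^+ 2 * (S * (t * G1 t ^+ 2) + t ^+ 2 * G2 t ^+ 3) - 1.
    transitivity (h 0); first by rewrite /h E1 E3; ring.
    apply: (@c0_eq0 _ 1); first by rewrite /h; c0_tac.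
    apply: filterS E => t [_ _ E _]; apply: etrans (eq_subr0 E).
    by rewrite /h; ring.
  pose h t := B t ^+ 2 * G1 t + D t ^+ 2 * (S * (t * G1 t ^+ 2) + t ^+ 2 * G2 t ^+ 3) - S * t.
  transitivity (h 0); first by rewrite /h E1 E4; ring.
  apply: (@c0_eq0 _ 1); first by rewrite /h; c0_tac.
  apply: filterS E => t [_ _ _ E]; apply: etrans (eq_subr0 E).
  by rewrite /h; ring.
have a0 : a != 0 by apply: contraTneq a11 => ->; rewrite expr0n mul0r sub0r oppr_eq0 oner_eq0.
have p120 : p12 = 0 by move: p12_0; rewrite mulf_eq0 expf_eq0 (negPf a0) => /eqP.
have p11_0 : p11 != 0 by apply: contraTneq a11 => ->; rewrite mulr0 sub0r oppr_eq0 oner_eq0.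
have p11_gt0 : 0 < p11.
  have : 0 < a ^+ 2 * p11 by move: a11; rewrite subr_eq0 => /eqP ->.
  by rewrite pmulr_rgt0// exprn_even_gt0.
have b0 : b = 0 by move: b11; rewrite mulf_eq0 expf_eq0 (negPf p11_0) orbF => /eqP.
have d2 : d ^+ 2 * p22 ^+ 3 + 1 = 0.
  have [G1 [G1' [G2 [A [B [B' [C [D [[? ? ? ?] [? ? ? ?] [E1 E2 E3 E4 E5] E]]]]]]]]] := H 0 1.
  (* On this line both B and [G1] vanish at 0, because b = 0 and p12 = 0. The terms in x1 are
     therefore of order at least 4, and dividing by t^3 isolates the cubic term. *)
  pose h t := t * B' t ^+ 2 * G1' t + D t ^+ 2 * (S * (t * G1' t ^+ 2) + G2 t ^+ 3) + 1.
  transitivity (h 0); first by rewrite /h E2 E5; ring.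
  apply: (@c0_eq0 _ 3); first by rewrite /h; c0_tac.
  apply: filterS E => t [EG EB _ E]; apply: etrans (eq_subr0 E).
  by rewrite /h EB EG E1 p120 b0 !(mul0r, mulr0, mulr1, mul1r, add0r, addr0); ring.
rewrite p120 mul0r subr0 in J.
have p22_gt0 : 0 < p22 by rewrite -(pmulr_rgt0 _ p11_gt0) J.
move/eqP: d2; apply/negP; rewrite gt_eqF// ltr_wpDl// mulr_ge0 ?sqr_ge0//.
by rewrite exprn_ge0// ltW.
Qed.

End NormalForms.

(** * Division of germs and the codimension criterion *)

Ltac smooth_tac := first
  [ eassumption
  | exact: smooth_germ_cst
  | exact: smooth_germ_coord
  | lazymatch goal with
    | |- smooth_germ (fun x => @?f x + @?g x) => apply: (@smooth_germD _ _ f g); smooth_tac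
    | |- smooth_germ (fun x => - @?f x) => apply: (@smooth_germN _ _ f); smooth_tac
    | |- smooth_germ (fun x => @?f x ^+ ?n) => apply: (@smooth_germX _ _ n f); smooth_tac
    | |- smooth_germ (fun x => @?f x * @?g x) => apply: (@smooth_germM _ _ f g); smooth_tac
    end ].

Section Division.
Context {R : realType}.
Implicit Types (P Q S : {poly R}) (f : 'rV[R]_2 -> R).

(** A boolean index lets [~~ c] name the other coordinate, so one division lemma serves both
    axes. *)
Definition coord (c : bool) (x : 'rV[R]_2) : R := if c then x 0 1 else x 0 0.

Lemma hadamard_bool (c : bool) f : smooth_germ f -> exists g h : 'rV[R]_2 -> R,
  [/\ smooth_germ g, smooth_germ h &
   \forall x \near (0 : 'rV[R]_2), f x = f 0 + coord (~~ c) x * g x + coord c x * h x].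
Proof.
move=> /hadamard2[g1 [g2 [s1 s2 E _]]]; case: c.
  by exists g1, g2.
by exists g2, g1; split=> //; apply: filterS E => x ->; rewrite addrAC.
Qed.

Lemma smooth_germ_bool c : smooth_germ (coord c).
Proof. by case: c; exact: smooth_germ_coord. Qed.

(** Hadamard's lemma iterated N times on the coefficient of the chosen coordinate: f is reduced
    modulo the ideal generated by the other coordinate and the N-th power of this one, and the
    remainder is a Taylor polynomial. *)
Lemma smooth_division (c : bool) N f : smooth_germ f -> exists P (g h : 'rV[R]_2 -> R),
  [/\ (size P <= N)%N, smooth_germ g, smooth_germ h &
   \forall x \near (0 : 'rV[R]_2),
     f x = P.[coord c x] + coord (~~ c) x * g x + coord c x ^+ N * h x].
Proof.
have sc := smooth_germ_bool c.
elim: N f => [|N IH] f sf.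
  exists 0, (cst 0), f; split=> //; [by rewrite size_poly0|exact: smooth_germ_cst|].
  by near=> x; rewrite horner0 mulr0 !add0r mul1r.
have [g [h [sg sh E]]] := hadamard_bool c sf.
have [P [g' [h' [sP sg' sh' E']]]] := IH h sh.
exists (P * 'X + (f 0)%:P), (fun x => g x + coord c x * g' x), h'; split=> //.
- by rewrite size_MXaddC; case: ifP.
- by smooth_tac.
near=> x.
have -> : f x = f 0 + coord (~~ c) x * g x + coord c x * h x by near: x.
have -> : h x = P.[coord c x] + coord (~~ c) x * g' x + coord c x ^+ N * h' x by near: x.
by rewrite hornerMXaddC exprS; ring.
Unshelve. all: by end_near. Qed.

(** A polynomial of degree at most N that is o(t^N) vanishes. Each step of the induction removes a
    root at 0, and [k] records how many factors t have been divided out. *)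
Lemma poly_near_eq0_strong k N P h : (size P <= N.+1)%N -> c0 h -> h 0 = 0 ->
  (\forall t \near (0 : R), t ^+ k * (P.[t] - t ^+ N * h t) = 0) -> P = 0.
Proof.
elim: N k P => [|N IH] k P sP ch h0 H.
  have cP : c0 (fun t => P.[t] - t ^+ 0 * h t).
    have := @continuous_horner _ P 0 => cP; have cP' : c0 (horner P) by exact: cP.
    by c0_tac.
  have := c0_eq0 cP H; rewrite h0 mulr0 subr0 => P0.
  by rewrite (size1_polyC sP) -horner_coef0 P0.
have cP : c0 (fun t => P.[t] - t ^+ N.+1 * h t).
  have := @continuous_horner _ P 0 => cP; have cP' : c0 (horner P) by exact: cP.
  by c0_tac.
have := c0_eq0 cP H; rewrite h0 mulr0 subr0 => /eqP/factor_theorem[Q].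
rewrite polyC0 subr0 => EP.
suff Q0 : Q = 0 by rewrite EP Q0 mul0r.
apply: (IH k.+1) => //.
  have [->|Q0] := eqVneq Q 0; first by rewrite size_poly0.
  by move: sP; rewrite EP size_mulX.
apply: filterS H => t; rewrite EP hornerMX => H; rewrite -[RHS]H !exprS; ring.
Qed.

Lemma poly_near_eq0 k N P h : (size P <= N)%N -> c0 h ->
  (\forall t \near (0 : R), t ^+ k * (P.[t] - t ^+ N * h t) = 0) -> P = 0.
Proof.
case: N => [|N] sP ch H; first by apply/eqP; rewrite -size_poly_eq0 -leqn0.
apply: (@poly_near_eq0_strong k N P (fun t => t * h t)) => //.
- by c0_tac.
- by rewrite mul0r.
by apply: filterS H => t H; rewrite -[RHS]H exprS; ring.
Qed.

(** The linear coefficient of S is h(0) seen from one line and -h'(0) seen from the opposite one. As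
    h(0) = h'(0), it is 0. This separates x1 x2 from the tangent space where a single line
    cannot. *)
Lemma affine_near_eq0 S h h' : (size S <= 2)%N -> c0 h -> c0 h' -> h 0 = h' 0 ->
  (\forall t \near (0 : R), t * (S.[t] - t * h t) = 0) ->
  (\forall t \near (0 : R), t * (S.[- t] - t * h' t) = 0) -> S = 0.
Proof.
move=> sS ch ch' hh H H'.
have ES t : S.[t] = S`_0 + S`_1 * t.
  by rewrite (horner_coef_wide _ sS) !big_ord_recl big_ord0 addr0 expr0 mulr1 expr1.
have S0 : S`_0 = 0.
  pose k t := S`_0 + S`_1 * t - t * h t.
  have -> : S`_0 = k 0 by rewrite /k; ring.
  apply: (@c0_eq0 _ 1); first by rewrite /k; c0_tac.
  by apply: filterS H => t; rewrite ES /k expr1.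
have S1 : S`_1 = h 0.
  pose k t := S`_1 - h t.
  suff : k 0 = 0 by rewrite /k => /eqP; rewrite subr_eq0 => /eqP.
  apply: (@c0_eq0 _ 2); first by rewrite /k; c0_tac.
  by apply: filterS H => t; rewrite ES S0 /k => E; rewrite -[RHS]E; ring.
have S1' : - S`_1 = h' 0.
  pose k t := - S`_1 - h' t.
  suff : k 0 = 0 by rewrite /k => /eqP; rewrite subr_eq0 => /eqP.
  apply: (@c0_eq0 _ 2); first by rewrite /k; c0_tac.
  by apply: filterS H' => t; rewrite ES S0 /k => E; rewrite -[RHS]E; ring.
have S10 : S`_1 = 0 by move: S1'; rewrite -hh -S1; lra.
apply/polyP => -[|[|i]]; rewrite coef0 ?S0 ?S10//.
by rewrite nth_default// (leq_trans sS).
Qed.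

End Division.

(** * Explicit partial derivatives *)

Section PolynomialPartials.
Context {R : realType}.
Implicit Types (f g : R -> R -> R).

(** Both partial derivatives are parameters, so that [pder_tac] can synthesise them from the shape
    of f and [pder_eq] can simplify them afterwards. *)
Definition pder f f0 f1 := forall x : 'rV[R]_2,
  [/\ differentiable (fun x : 'rV[R]_2 => f (x 0 0) (x 0 1)) x,
    partial 0 (fun x => f (x 0 0) (x 0 1)) x = f0 (x 0 0) (x 0 1) &
    partial 1 (fun x => f (x 0 0) (x 0 1)) x = f1 (x 0 0) (x 0 1)].

Lemma pder_eq f f0 f1 g0 g1 : pder f f0 f1 -> (forall x y, f0 x y = g0 x y) ->
  (forall x y, f1 x y = g1 x y) -> pder f g0 g1.
Proof. by move=> H H0 H1 x; have [] := H x; split; rewrite -?H0 -?H1. Qed.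

Lemma pder_cst c : pder (fun _ _ => c) (fun _ _ => 0) (fun _ _ => 0).
Proof. by move=> x; split; [exact: differentiable_cst|exact: derive_cst|exact: derive_cst]. Qed.

Lemma pder_x : pder (fun x _ => x) (fun _ _ => 1) (fun _ _ => 0).
Proof. by move=> x; split; [exact: differentiable_coord|rewrite partial_coord|rewrite partial_coord]. Qed.

Lemma pder_y : pder (fun _ y => y) (fun _ _ => 0) (fun _ _ => 1).
Proof. by move=> x; split; [exact: differentiable_coord|rewrite partial_coord|rewrite partial_coord]. Qed.

Lemma pderD f f0 f1 g g0 g1 : pder f f0 f1 -> pder g g0 g1 ->
  pder (fun x y => f x y + g x y) (fun x y => f0 x y + g0 x y) (fun x y => f1 x y + g1 x y).
Proof.
move=> Hf Hg x; have [df f0E f1E] := Hf x; have [dg g0E g1E] := Hg x.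
split; first exact: differentiableD.
- by rewrite (partialD 0 df dg) f0E g0E.
- by rewrite (partialD 1 df dg) f1E g1E.
Qed.

Lemma pderM f f0 f1 g g0 g1 : pder f f0 f1 -> pder g g0 g1 ->
  pder (fun x y => f x y * g x y) (fun x y => f0 x y * g x y + f x y * g0 x y)
    (fun x y => f1 x y * g x y + f x y * g1 x y).
Proof.
move=> Hf Hg x; have [df f0E f1E] := Hf x; have [dg g0E g1E] := Hg x.
split; first exact: differentiableM.
- by rewrite (partialM 0 df dg) f0E g0E.
- by rewrite (partialM 1 df dg) f1E g1E.
Qed.

Lemma pderX n f f0 f1 : pder f f0 f1 ->
  pder (fun x y => f x y ^+ n) (fun x y => n%:R * f x y ^+ n.-1 * f0 x y)
    (fun x y => n%:R * f x y ^+ n.-1 * f1 x y).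
Proof.
move=> Hf x; have [df f0E f1E] := Hf x.
split; first exact: differentiable_expr.
- by rewrite (partialX 0 n df) f0E.
- by rewrite (partialX 1 n df) f1E.
Qed.

Lemma pderN f f0 f1 : pder f f0 f1 ->
  pder (fun x y => - f x y) (fun x y => - f0 x y) (fun x y => - f1 x y).
Proof.
move=> Hf x; have [df f0E f1E] := Hf x; split.
- exact: differentiableN.
- by rewrite /partial -[LHS]/('D_(delta_mx 0 0) (- (fun x : 'rV[R]_2 => f (x 0 0) (x 0 1))) x) deriveN -?f0E//; exact: diff_derivable.
- by rewrite /partial -[LHS]/('D_(delta_mx 0 1) (- (fun x : 'rV[R]_2 => f (x 0 0) (x 0 1))) x) deriveN -?f1E//; exact: diff_derivable.
Qed.

End PolynomialPartials.

Ltac pder_tac := lazymatch goal with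
  | |- pder (fun _ _ => ?c) _ _ => exact: (@pder_cst _ c)
  | |- pder (fun x _ => x) _ _ => exact: pder_x
  | |- pder (fun _ y => y) _ _ => exact: pder_y
  | |- pder (fun x y => @?f x y + @?g x y) _ _ => apply: (@pderD _ f _ _ g); pder_tac
  | |- pder (fun x y => - @?f x y) _ _ => apply: (@pderN _ f); pder_tac
  | |- pder (fun x y => @?f x y ^+ ?n) _ _ => apply: (@pderX _ n f); pder_tac
  | |- pder (fun x y => @?f x y * @?g x y) _ _ => apply: (@pderM _ f _ _ g); pder_tac
  end.

Lemma smooth_germ_sym2 {R : realType} (a b d : 'rV[R]_2 -> R) :
  smooth_germ a -> smooth_germ b -> smooth_germ d -> smooth_germ (fun x => sym2 (a x) (b x) (d x)).
Proof.
move=> sa sb sd; apply/smooth_germ_mxP; apply: ord2P; apply: ord2P.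
- by rewrite (_ : (fun x => _) = a)//; apply/funext => x; rewrite sym2E.
- by rewrite (_ : (fun x => _) = b)//; apply/funext => x; rewrite sym2E.
- by rewrite (_ : (fun x => _) = b)//; apply/funext => x; rewrite sym2E.
- by rewrite (_ : (fun x => _) = d)//; apply/funext => x; rewrite sym2E.
Qed.

Lemma diff_mx_entry {R : realType} {r : nat} m n (A : 'rV[R]_r -> 'M[R]_(m, n)) (x v : 'rV[R]_r) i j :
  differentiable A x -> 'd A x v i j = \sum_k v 0 k * partial k (fun x => A x i j) x.
Proof.
move=> dA; rewrite diff_partialE// summxE; apply: eq_bigr => k _.
by rewrite mxE partial_mx.
Qed.

(** * The extended tangent space in entries and the codimension criterion *)

Section Codimension.
Context {R : realType}.
Variables (fa fb fd fa0 fa1 fb0 fb1 fd0 fd1 : R -> R -> R).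
Implicit Types (P Q S : {poly R}).

Let A := plane_germ (fun x1 x2 => sym2 (fa x1 x2) (fb x1 x2) (fd x1 x2)).

(* (p, q, s) are the entries of dA(V) + U^T A + A U at the point (x, y). *)
Definition tang_at (V0 V1 u00 u01 u10 u11 x y p q s : R) : Prop :=
  [/\ p = V0 * fa0 x y + V1 * fa1 x y + 2 * (fa x y * u00 + fb x y * u10),
    q = V0 * fb0 x y + V1 * fb1 x y + fa x y * u01 + fb x y * u11 + fb x y * u00 + fd x y * u10 &
    s = V0 * fd0 x y + V1 * fd1 x y + 2 * (fb x y * u01 + fd x y * u11)].

Hypotheses (Ha : pder fa fa0 fa1) (Hb : pder fb fb0 fb1) (Hd : pder fd fd0 fd1).

Lemma diff_sym2 (x v : 'rV[R]_2) : 'd A x v = sym2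
  (v 0 0 * fa0 (x 0 0) (x 0 1) + v 0 1 * fa1 (x 0 0) (x 0 1))
  (v 0 0 * fb0 (x 0 0) (x 0 1) + v 0 1 * fb1 (x 0 0) (x 0 1))
  (v 0 0 * fd0 (x 0 0) (x 0 1) + v 0 1 * fd1 (x 0 0) (x 0 1)).
Proof.
have E00 : (fun x => A x 0 0) = (fun x : 'rV[R]_2 => fa (x 0 0) (x 0 1)).
  by apply/funext => y; rewrite /A /plane_germ sym2E.
have E01 : (fun x => A x 0 1) = (fun x : 'rV[R]_2 => fb (x 0 0) (x 0 1)).
  by apply/funext => y; rewrite /A /plane_germ sym2E.
have E10 : (fun x => A x 1 0) = (fun x : 'rV[R]_2 => fb (x 0 0) (x 0 1)).
  by apply/funext => y; rewrite /A /plane_germ sym2E.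
have E11 : (fun x => A x 1 1) = (fun x : 'rV[R]_2 => fd (x 0 0) (x 0 1)).
  by apply/funext => y; rewrite /A /plane_germ sym2E.
have [da a0 a1] := Ha x; have [db b0 b1] := Hb x; have [dd d0 d1] := Hd x.
have cA : ck 0 setT A.
  apply/ck_mxP; first exact: openT.
  apply: ord2P; apply: ord2P; rewrite ?E00 ?E01 ?E10 ?E11; split=> // y _;
    by [have [] := Ha y|have [] := Hb y|have [] := Hd y].
have dA : differentiable A x by exact: ck_diff cA _.
have D i j := diff_mx_entry v i j dA.
by apply: mx2P; rewrite sym2E D sum2E ?E00 ?E01 ?E10 ?E11 ?a0 ?a1 ?b0 ?b1 ?d0 ?d1.
Qed.

Lemma tang_atE (x v : 'rV[R]_2) (U : 'M[R]_2) p q s :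
  tang_at (v 0 0) (v 0 1) (U 0 0) (U 0 1) (U 1 0) (U 1 1) (x 0 0) (x 0 1) p q s <->
  sym2 p q s = 'd A x v + U^T *m A x + A x *m U.
Proof.
have -> : 'd A x v + U^T *m A x + A x *m U = sym2
  (v 0 0 * fa0 (x 0 0) (x 0 1) + v 0 1 * fa1 (x 0 0) (x 0 1) +
    2 * (fa (x 0 0) (x 0 1) * U 0 0 + fb (x 0 0) (x 0 1) * U 1 0))
  (v 0 0 * fb0 (x 0 0) (x 0 1) + v 0 1 * fb1 (x 0 0) (x 0 1) +
    fa (x 0 0) (x 0 1) * U 0 1 + fb (x 0 0) (x 0 1) * U 1 1 +
    fb (x 0 0) (x 0 1) * U 0 0 + fd (x 0 0) (x 0 1) * U 1 0)
  (v 0 0 * fd0 (x 0 0) (x 0 1) + v 0 1 * fd1 (x 0 0) (x 0 1) +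
    2 * (fb (x 0 0) (x 0 1) * U 0 1 + fd (x 0 0) (x 0 1) * U 1 1)).
  by rewrite diff_sym2 /A /plane_germ; apply: mx2P; rewrite !(mxE, sum2E)/=; ring.
by split=> [[-> -> ->]//|/sym2_inj].
Qed.

Lemma Ge_tangent_sym2P (p q s : 'rV[R]_2 -> R) :
  Ge_tangent A (fun x => sym2 (p x) (q x) (s x)) <->
  exists V0 V1 u00 u01 u10 u11 : 'rV[R]_2 -> R,
    [/\ [/\ smooth_germ V0, smooth_germ V1 & smooth_germ u00],
      [/\ smooth_germ u01, smooth_germ u10 & smooth_germ u11] &
     \forall x \near (0 : 'rV[R]_2),
      tang_at (V0 x) (V1 x) (u00 x) (u01 x) (u10 x) (u11 x) (x 0 0) (x 0 1) (p x) (q x) (s x)].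
Proof.
split.
  move=> [V [U [/smooth_germ_mxP sV /smooth_germ_mxP sU E]]].
  exists (fun x => V x 0 0), (fun x => V x 0 1), (fun x => U x 0 0), (fun x => U x 0 1),
    (fun x => U x 1 0), (fun x => U x 1 1); split=> //.
  by apply: filterS E => x /tang_atE.
move=> [V0 [V1 [u00 [u01 [u10 [u11 [[s0 s1 s00] [s01 s10 s11] E]]]]]]].
pose V x := row2 (V0 x) (V1 x).
pose U x : 'M[R]_2 := \matrix_(i, j) if i == 0 then (if j == 0 then u00 x else u01 x)
  else (if j == 0 then u10 x else u11 x).
exists V, U; split.
- apply/smooth_germ_mxP => i; rewrite ord1; apply: ord2P; rewrite /V.
    by under eq_fun do rewrite row2E.
  by under eq_fun do rewrite row2E.
- by apply/smooth_germ_mxP; apply: ord2P; apply: ord2P; rewrite /U; under eq_fun do rewrite mxE /=.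
by apply: filterS E => x E; apply/tang_atE; rewrite /V /U !row2E !mxE.
Qed.

Variables (e1 c1 c2 : bool) (p q r : nat).

Definition slot1 (e : bool) (y : R) := if e then y else 0.

Definition block_sum P Q S (x : 'rV[R]_2) : 'M[R]_2 :=
  sym2 (slot1 e1 P.[coord c1 x]) (slot1 (~~ e1) P.[coord c1 x]) (Q.[coord c2 x] + x 0 0 * S.[x 0 1]).

Definition block_basis (k : 'I_(p + q + r)) (x : 'rV[R]_2) : 'M[R]_2 :=
  match fintype.split k with
  | inl k' => match fintype.split k' with
    | inl i => sym2 (slot1 e1 (coord c1 x ^+ i)) (slot1 (~~ e1) (coord c1 x ^+ i)) 0
    | inr j => sym2 0 0 (coord c2 x ^+ j)
    end
  | inr j => sym2 0 0 (x 0 0 * x 0 1 ^+ j)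
  end.

Lemma block_basis_sum (c : 'I_(p + q + r) -> R) P Q S x :
  (size P <= p)%N -> (size Q <= q)%N -> (size S <= r)%N ->
  (forall i : 'I_p, c (lshift r (lshift q i)) = P`_i) ->
  (forall i : 'I_q, c (lshift r (rshift p i)) = Q`_i) ->
  (forall i : 'I_r, c (rshift (p + q) i) = S`_i) ->
  \sum_k c k *: block_basis k x = block_sum P Q S x.
Proof.
move=> sP sQ sS HP HQ HS; rewrite !big_split_ord /=.
have sl (i : 'I_(p + q)) : fintype.split (lshift r i) = inl i := unsplitK (inl i).
have sr (i : 'I_r) : fintype.split (rshift (p + q) i) = inr i := unsplitK (inr i).
have sl' (i : 'I_p) : fintype.split (lshift q i) = inl i := unsplitK (inl i).
have sr' (i : 'I_q) : fintype.split (rshift p i) = inr i := unsplitK (inr i).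
under eq_bigr do rewrite HP /block_basis sl sl'.
under [X in _ + X + _]eq_bigr do rewrite HQ /block_basis sl sr'.
under [X in _ + X]eq_bigr do rewrite HS /block_basis sr.
rewrite /block_sum (horner_coef_wide _ sP) (horner_coef_wide _ sQ) (horner_coef_wide _ sS).
apply: mx2P; rewrite !sym2E !mxE !summxE; under eq_bigr do rewrite !mxE /=;
  under [X in _ + X + _]eq_bigr do rewrite !mxE /=;
  under [X in _ + X]eq_bigr do rewrite !mxE /=.
- rewrite [X in _ + X + _]big1 => [|i _]; last by rewrite mulr0.
  rewrite [X in _ + X]big1 => [|i _]; last by rewrite mulr0.
  by rewrite !addr0; case: e1; rewrite //= big1// => i _; rewrite mulr0.
- rewrite [X in _ + X + _]big1 => [|i _]; last by rewrite mulr0.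
  rewrite [X in _ + X]big1 => [|i _]; last by rewrite mulr0.
  by rewrite !addr0; case: e1; rewrite //= big1// => i _; rewrite mulr0.
- rewrite [X in _ + X + _]big1 => [|i _]; last by rewrite mulr0.
  rewrite [X in _ + X]big1 => [|i _]; last by rewrite mulr0.
  by rewrite !addr0; case: e1; rewrite //= big1// => i _; rewrite mulr0.
rewrite big1 => [|i _]; last by rewrite mulr0.
rewrite add0r mulr_sumr; congr (_ + _); apply: eq_bigr => i _; ring.
Qed.

(* The codimension count: the monomials x_(c1)^i (i < p) in the first slot
   (the 11 entry if e1, else the 12 entry), x_(c2)^j (j < q) and x0 x1^k (k < r)
   in the 22 entry form a basis of the quotient.  Independence is only tested
   along lines through the origin. *)
Lemma codim_sym2 :
  (forall C11 C12 C22 : 'rV[R]_2 -> R, smooth_germ C11 -> smooth_germ C12 -> smooth_germ C22 ->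
    exists P Q S, [/\ (size P <= p)%N, (size Q <= q)%N & (size S <= r)%N] /\
    exists V0 V1 u00 u01 u10 u11 : 'rV[R]_2 -> R,
    [/\ [/\ smooth_germ V0, smooth_germ V1 & smooth_germ u00],
      [/\ smooth_germ u01, smooth_germ u10 & smooth_germ u11] &
     \forall x \near (0 : 'rV[R]_2),
      tang_at (V0 x) (V1 x) (u00 x) (u01 x) (u10 x) (u11 x) (x 0 0) (x 0 1)
        (C11 x - slot1 e1 P.[coord c1 x]) (C12 x - slot1 (~~ e1) P.[coord c1 x])
        (C22 x - (Q.[coord c2 x] + x 0 0 * S.[x 0 1]))]) ->
  (forall P Q S (k0 k1 k00 k01 k10 k11 : R), (size P <= p)%N -> (size Q <= q)%N -> (size S <= r)%N ->
    (forall v0 v1 : R, exists V0 V1 u00 u01 u10 u11 : R -> R,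
    [/\ [/\ c0 V0, c0 V1 & c0 u00], [/\ c0 u01, c0 u10 & c0 u11],
      [/\ V0 0 = k0, V1 0 = k1 & u00 0 = k00] /\ [/\ u01 0 = k01, u10 0 = k10 & u11 0 = k11] &
     \forall t \near (0 : R),
      tang_at (V0 t) (V1 t) (u00 t) (u01 t) (u10 t) (u11 t) (t * v0) (t * v1)
        (slot1 e1 P.[t * (if c1 then v1 else v0)]) (slot1 (~~ e1) P.[t * (if c1 then v1 else v0)])
        (Q.[t * (if c2 then v1 else v0)] + t * v0 * S.[t * v1])]) ->
    [/\ P = 0, Q = 0 & S = 0]) ->
  Ge_codim A (p + q + r).
Proof.
move=> span indep; exists block_basis; split.
- move=> k; have sc1 := @smooth_germ_bool R c1; have sc2 := @smooth_germ_bool R c2; split.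
    have ssl e (f : 'rV[R]_2 -> R) : smooth_germ f -> smooth_germ (fun x => slot1 e (f x)).
      by case: e => // _; exact: smooth_germ_cst.
    have s0 : smooth_germ (fun _ : 'rV[R]_2 => 0 : R) by exact: smooth_germ_cst.
    have sX0 := @smooth_germ_bool R false; have sX1 := @smooth_germ_bool R true.
    rewrite /block_basis; case: (fintype.split k) => [k'|j].
      case: (fintype.split k') => [i|j].
        by apply: smooth_germ_sym2 => //; apply: ssl; exact: smooth_germX.
      by apply: smooth_germ_sym2 => //; exact: smooth_germX.
    by apply: smooth_germ_sym2 => //; apply: smooth_germM => //; exact: smooth_germX.
  near=> x; rewrite /block_basis; case: (fintype.split k) => [k'|j]; try case: (fintype.split k') => [i|j];
    by apply: mx2P; rewrite !mxE.
- move=> C [/smooth_germ_mxP sC symC].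
  have [P [Q [S [[sP sQ sS] [V0 [V1 [u00 [u01 [u10 [u11 [H1 H2 E]]]]]]]]]]] :=
    span _ _ _ (sC 0 0) (sC 0 1) (sC 1 1).
  pose c (k : 'I_(p + q + r)) := match fintype.split k with
    | inl k' => match fintype.split k' with inl i => P`_i | inr j => Q`_j end
    | inr j => S`_j end.
  exists c.
  have cE x : \sum_k c k *: block_basis k x = block_sum P Q S x.
    apply: block_basis_sum => // i; rewrite /c.
    - have -> : fintype.split (lshift r (lshift q i)) = inl (lshift q i) := unsplitK (inl _).
      by have -> : fintype.split (lshift q i) = inl i := unsplitK (inl _).
    - have -> : fintype.split (lshift r (rshift p i)) = inl (rshift p i) := unsplitK (inl _).
      by have -> : fintype.split (rshift p i) = inr i := unsplitK (inr _).
    - by have -> : fintype.split (rshift (p + q) i) = inr i := unsplitK (inr _).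
  have [V [U [sV sU T]]] : Ge_tangent A (fun x => sym2 (C x 0 0 - slot1 e1 P.[coord c1 x])
      (C x 0 1 - slot1 (~~ e1) P.[coord c1 x])
      (C x 1 1 - (Q.[coord c2 x] + x 0 0 * S.[x 0 1]))).
    by apply/Ge_tangent_sym2P; exists V0, V1, u00, u01, u10, u11.
  exists V, U; split=> //; near=> x; rewrite cE.
  have symCx : (C x)^T = C x by near: x.
  rewrite -[RHS](_ : sym2 (C x 0 0 - slot1 e1 P.[coord c1 x])
      (C x 0 1 - slot1 (~~ e1) P.[coord c1 x])
      (C x 1 1 - (Q.[coord c2 x] + x 0 0 * S.[x 0 1])) = _); last by near: x.
  rewrite /block_sum; apply: mx2P; rewrite mxE [X in _ + X]mxE !sym2E//.
  by rewrite -[C x 1 0]/((C x) 1 0) -{1}symCx mxE.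
move=> c T.
(* The coefficients of a vanishing combination are collected into polynomials; [insub] turns a
   natural index back into a bounded one. *)
pose P := \poly_(i < p) (if insub i is Some i' then c (lshift r (lshift q i')) else 0).
pose Q := \poly_(i < q) (if insub i is Some i' then c (lshift r (rshift p i')) else 0).
pose S := \poly_(i < r) (if insub i is Some i' then c (rshift (p + q) i') else 0).
have EP (i : 'I_p) : c (lshift r (lshift q i)) = P`_i by rewrite coef_poly ltn_ord valK.
have EQ (i : 'I_q) : c (lshift r (rshift p i)) = Q`_i by rewrite coef_poly ltn_ord valK.
have ES (i : 'I_r) : c (rshift (p + q) i) = S`_i by rewrite coef_poly ltn_ord valK.
have sP : (size P <= p)%N by exact: size_poly.
have sQ : (size Q <= q)%N by exact: size_poly.
have sS : (size S <= r)%N by exact: size_poly.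
have cE : (fun x => \sum_k c k *: block_basis k x) = block_sum P Q S.
  by apply/funext => x; exact: block_basis_sum.
move: T; rewrite cE => /Ge_tangent_sym2P[V0 [V1 [u00 [u01 [u10 [u11 [[s0 s1 s00] [s01 s10 s11] E]]]]]]].
have [P0 Q0 S0] : [/\ P = 0, Q = 0 & S = 0].
  (* The constants handed over are the values at 0 of the six germs. They do not depend on the line,
     which lets the independence arguments combine several lines. *)
  apply: (indep P Q S (V0 0) (V1 0) (u00 0) (u01 0) (u10 0) (u11 0)) => // v0 v1.
  pose v := row2 v0 v1.
  exists (fun t => V0 (t *: v)), (fun t => V1 (t *: v)), (fun t => u00 (t *: v)),
    (fun t => u01 (t *: v)), (fun t => u10 (t *: v)), (fun t => u11 (t *: v)).
  split; [by split; exact: c0_line|by split; exact: c0_line|by rewrite scale0r|].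
  have := near_line v E; apply: filterS => t; rewrite /coord !scale_row2E.
  by case: c1; case: c2.
move=> k; rewrite -(splitK k); case: (fintype.split k) => [k'|j] /=; last by rewrite ES S0 coef0.
rewrite -(splitK k'); case: (fintype.split k') => [i|j] /=; first by rewrite EP P0 coef0.
by rewrite EQ Q0 coef0.
Unshelve. all: by end_near. Qed.

End Codimension.

(** * Codimensions of the normal forms *)

Ltac line_simp E := rewrite /slot1 /= ?(mulr0, mul0r, mulr1, mul1r, addr0, add0r, expr0n, mulr0n) /=
  ?(mulr0, mul0r, mulr1, mul1r, addr0, add0r) in E.

Section CodimensionNormalForms.
Context {R : realType}.

Lemma sign_cases (s : bool) : (-1) ^+ s = 1 :> R \/ (-1) ^+ s = -1 :> R.
Proof. by case: s; [right; rewrite expr1|left; rewrite expr0]. Qed.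

Lemma size_subZXn (P : {poly R}) c n : (size P <= n.+1)%N -> (size (P - c *: 'X^n)%R <= n.+1)%N.
Proof.
move=> sP; rewrite (leq_trans (size_polyD _ _))// geq_max sP size_polyN.
by rewrite (leq_trans (size_scale_leq _ _))// size_polyXn.
Qed.

(** V alone produces every diagonal, while the off-diagonal entry of the tangent space runs through
    the ideal (x1, x2); only its constant term survives. *)
Lemma codim_nf1 : Ge_codim (@nf1 R) 1.
Proof.
have Ha := @pder_x R; have Hb := @pder_cst R 0; have Hd := @pder_y R.
apply: (codim_sym2 Ha Hb Hd (e1 := false) (c1 := false) (c2 := false) (p := 1) (q := 0) (r := 0)).
  move=> C11 C12 C22 s11 s12 s22.
  have [P [g [h [sP sg sh E]]]] := smooth_division false 1 s12.
  exists P, 0, 0; split; first by rewrite size_poly0.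
  exists C11, C22, (cst 0), h, g, (cst 0); split; [by split; smooth_tac|by split; smooth_tac|].
  apply: filterS E => x; rewrite /coord /= => E.
  by split; rewrite /= ?E ?horner0; ring.
move=> P Q T k0 k1 k00 k01 k10 k11 sP /size_poly_leq0P Q0 /size_poly_leq0P T0 H; split=> //.
have [V0 [V1 [u00 [u01 [u10 [u11 [[? ? ?] [? ? ?] [[K0 K1 K00] [K01 K10 K11]] E]]]]]]] := H 1 0.
apply: (@poly_near_eq0 _ 0 1 P u01) => //.
apply: filterS E => t [_ E _]; line_simp E.
by rewrite E; ring.
Qed.

(** V produces the 11 and 12 entries and does not affect the trace, to which U contributes exactly
    the ideal (x1, x2). The constant term of the trace survives. *)
Lemma codim_nf2 : Ge_codim (@nf2 R) 1.
Proof.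
have Ha := @pder_x R; have Hb := @pder_y R.
have Hd : pder (fun x _ : R => - x) (fun _ _ => - 1) (fun _ _ => - 0) by pder_tac.
apply: (codim_sym2 Ha Hb Hd (e1 := false) (c1 := false) (c2 := false) (p := 0) (q := 1) (r := 0)).
  move=> C11 C12 C22 s11 s12 s22.
  have sW : smooth_germ (fun x => C11 x + C22 x) by smooth_tac.
  have [Q [g [h [sQ sg sh E]]]] := smooth_division false 1 sW.
  exists 0, Q, 0; split; first by rewrite size_poly0.
  exists (fun x => C11 x - x 0 0 * h x - x 0 1 * g x),
    (fun x => C12 x - x 0 1 * (h x * 2^-1) + x 0 0 * (g x * 2^-1)),
    (fun x => h x * 2^-1), (cst 0), (fun x => g x * 2^-1), (cst 0); split; [by split; smooth_tac|by split; smooth_tac|].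
  apply: filterS E => x; rewrite /coord /= => E.
  have {}E : C22 x = Q.[x 0 0] + x 0 1 * g x + x 0 0 ^+ 1 * h x - C11 x by rewrite -E; ring.
  by split; rewrite /= ?E ?horner0; field.
move=> P Q T k0 k1 k00 k01 k10 k11 /size_poly_leq0P P0 sQ /size_poly_leq0P T0 H; split=> //.
have [V0 [V1 [u00 [u01 [u10 [u11 [[? ? ?] [? ? ?] [[K0 K1 K00] [K01 K10 K11]] E]]]]]]] := H 1 0.
apply: (@poly_near_eq0 _ 0 1 Q (fun t => 2 * u00 t - 2 * u11 t)) => //; first by c0_tac.
apply: filterS E => t [E1 _ E]; line_simp E1; line_simp E.
by rewrite ?P0 ?horner0 in E1; rewrite ?T0 ?horner0 in E; lra.
Qed.

(** V absorbs the 11 and 12 entries. The 22 entry, corrected by l x1^(l-1) times the 11 entry up to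
    sign, is then free modulo (x2, x1^l), which leaves l monomials. *)
Lemma codim_nf3 s l : (2 <= l)%N -> Ge_codim (@nf3 R s l) l.
Proof.
move=> l2; have -> : l = (l - 2).+2 by rewrite -addn2 subnK.
move: (l - 2)%N => {l2}l; rewrite /nf3; have := sign_cases s; move: ((-1) ^+ s : R) => S HS.
have Ha := @pder_x R; have Hb := @pder_y R.
have Hd : pder (fun x _ : R => S * x ^+ l.+2) (fun x _ => S * (l.+2%:R * x ^+ l.+1)) (fun _ _ => 0).
  by apply: pder_eq; [pder_tac| |] => x y /=; ring.
rewrite -[X in Ge_codim _ X](addn0 l.+2).
apply: (codim_sym2 Ha Hb Hd (e1 := false) (c1 := false) (c2 := false) (p := 0) (q := l.+2) (r := 0)).
  move=> C11 C12 C22 s11 s12 s22.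
  have sW : smooth_germ (fun x => C22 x - S * (l.+2%:R * x 0 0 ^+ l.+1) * C11 x) by smooth_tac.
  have [Q [g [h [sQ sg sh E]]]] := smooth_division false l.+2 sW.
  exists 0, Q, 0; split; first by rewrite size_poly0.
  exists C11, (fun x => C12 x - x 0 0 * (g x * 2^-1) - x 0 1 * (S * h x * 2^-1)),
    (cst 0), (fun x => g x * 2^-1), (cst 0), (fun x => S * h x * 2^-1); split; [by split; smooth_tac|by split; smooth_tac|].
  apply: filterS E => x; rewrite /coord /= => E.
  have {}E : C22 x = Q.[x 0 0] + x 0 1 * g x + x 0 0 ^+ l.+2 * h x + S * (l.+2%:R * x 0 0 ^+ l.+1) * C11 x by rewrite -E; ring.
  by split; rewrite /= ?E ?horner0 ?exprS; case: HS => ->; field.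
move=> P Q T k0 k1 k00 k01 k10 k11 /size_poly_leq0P P0 sQ /size_poly_leq0P T0 H; split=> //.
have [V0 [V1 [u00 [u01 [u10 [u11 [[? ? ?] [? ? ?] [[K0 K1 K00] [K01 K10 K11]] E]]]]]]] := H 1 0.
apply: (@poly_near_eq0 _ 0 l.+2 Q (fun t => - 2 * S * l.+2%:R * u00 t + 2 * S * u11 t)) => //; first by c0_tac.
apply: filterS E => t [E1 _ E]; line_simp E1; line_simp E.
rewrite ?P0 ?horner0 in E1; rewrite ?T0 ?horner0 in E.
have V : V0 t = - 2 * t * u00 t by lra.
line_simp E.
by rewrite E V !exprS; ring.
Qed.

(** V0 absorbs the 11 entry. The difference of the diagonal entries survives modulo (x1, x2^l) and
    the 12 entry modulo (x1, x2^(l-1)), the latter because V1 contributes l x2^(l-1). *)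
Lemma codim_nf4 l : (2 <= l)%N -> Ge_codim (@nf4 R l) (2 * l - 1).
Proof.
move=> l2; have -> : (2 * l - 1 = (l - 2).+1 + (l - 2).+2 + 0)%N by lia.
have -> : l = (l - 2).+2 by rewrite -addn2 subnK.
rewrite !subSS !subn0; move: (l - 2)%N => {l2}l; rewrite /nf4.
have Ha := @pder_x R.
have Hb : pder (fun _ y : R => y ^+ l.+2) (fun _ _ => 0) (fun _ y => l.+2%:R * y ^+ l.+1).
  by apply: pder_eq; [pder_tac| |] => x y /=; ring.
have L0 : l.+2%:R != 0 :> R by rewrite pnatr_eq0.
apply: (codim_sym2 Ha Hb Ha (e1 := false) (c1 := true) (c2 := true)).
  move=> C11 C12 C22 s11 s12 s22.
  have sW : smooth_germ (fun x => C22 x - C11 x) by smooth_tac.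
  have [Q [g [h [sQ sg sh E]]]] := smooth_division true l.+2 sW.
  have [P [g' [h' [sP sg' sh' E']]]] := smooth_division true l.+1 s12.
  exists P, Q, 0; split; first by rewrite size_poly0.
  (* Solves the pair u01 + u10 = g' (the x1 part of the 12 entry) and 2 (u01 - u10) = h (the x2^l
     part of the diagonal difference). *)
  pose u10 x := (g' x - h x * 2^-1) * 2^-1.
  have s10 : smooth_germ u10 by rewrite /u10; smooth_tac.
  exists (fun x => C11 x - 2 * (x 0 1 ^+ l.+2 * u10 x)),
    (fun x => (h' x - x 0 1 * (g x * 2^-1)) * (l.+2%:R)^-1),
    (cst 0), (fun x => h x * 2^-1 + u10 x), u10, (fun x => g x * 2^-1); split; [by split; smooth_tac|by split; smooth_tac|].
  near=> x.
  have E1 : C22 x - C11 x = Q.[x 0 1] + x 0 0 * g x + x 0 1 ^+ l.+2 * h x by near: x.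
  have E2 : C12 x = P.[x 0 1] + x 0 0 * g' x + x 0 1 ^+ l.+1 * h' x by near: x.
  have {}E1 : C22 x = Q.[x 0 1] + x 0 0 * g x + x 0 1 ^+ l.+2 * h x + C11 x by rewrite -E1; ring.
  rewrite /tang_at /u10 /slot1 /coord E1 E2 horner0 !exprS /=.
  by move: (l.+2%:R) L0 => L L0; split; field.
move=> P Q T k0 k1 k00 k01 k10 k11 sP sQ /size_poly_leq0P T0 H; split=> //.
  have [V0 [V1 [u00 [u01 [u10 [u11 [[? ? ?] [? ? ?] [[K0 K1 K00] [K01 K10 K11]] E]]]]]]] := H 0 1.
  apply: (@poly_near_eq0 _ 0 l.+1 P (fun t => l.+2%:R * V1 t + t * u11 t + t * u00 t)) => //; first by c0_tac.
  apply: filterS E => t [_ E _]; line_simp E.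
  by rewrite E !exprS; ring.
have [V0 [V1 [u00 [u01 [u10 [u11 [[? ? ?] [? ? ?] [[K0 K1 K00] [K01 K10 K11]] E]]]]]]] := H 0 1.
apply: (@poly_near_eq0 _ 0 l.+2 Q (fun t => - 2 * u10 t + 2 * u01 t)) => //; first by c0_tac.
apply: filterS E => t [E1 _ E]; line_simp E1; line_simp E.
rewrite ?T0 ?horner0 in E; line_simp E.
have V : V0 t = - 2 * (t ^+ l.+2 * u10 t) by lra.
by rewrite E V; ring.
Unshelve. all: by end_near. Qed.

(** V0 absorbs the 12 entry. V1 acts on both diagonal entries but can be used once: it reduces the
    22 entry to l2 - 1 monomials and leaves l1 in the 11 entry. *)
Lemma codim_nf5 s1 s2 l1 l2 : (2 <= l1)%N -> (2 <= l2)%N -> Ge_codim (@nf5 R s1 s2 l1 l2) (l1 + l2 - 1).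
Proof.
move=> l12 l22; have -> : (l1 + l2 - 1 = (l1 - 2).+2 + (l2 - 2).+1 + 0)%N by lia.
have -> : l1 = (l1 - 2).+2 by rewrite -addn2 subnK.
have -> : l2 = (l2 - 2).+2 by rewrite -addn2 subnK.
rewrite !subSS !subn0; move: (l1 - 2)%N (l2 - 2)%N => {l12 l22}k l; rewrite /nf5.
have := sign_cases s1; move: ((-1) ^+ s1 : R) => S1 HS1.
have := sign_cases s2; move: ((-1) ^+ s2 : R) => S2 HS2.
have Ha : pder (fun _ y : R => S1 * y ^+ k.+2) (fun _ _ => 0) (fun _ y => S1 * (k.+2%:R * y ^+ k.+1)).
  by apply: pder_eq; [pder_tac| |] => x y /=; ring.
have Hb := @pder_x R.
have Hd : pder (fun _ y : R => S2 * y ^+ l.+2) (fun _ _ => 0) (fun _ y => S2 * (l.+2%:R * y ^+ l.+1)).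
  by apply: pder_eq; [pder_tac| |] => x y /=; ring.
have L0 : l.+2%:R != 0 :> R by rewrite pnatr_eq0.
apply: (codim_sym2 Ha Hb Hd (e1 := true) (c1 := true) (c2 := true)).
  move=> C11 C12 C22 s11 s12 s22.
  have [Q [g [h [sQ sg sh E]]]] := smooth_division true l.+1 s22.
  (* V1 is spent on the x2^(l2-1) part of the 22 entry; its effect on the 11 entry is subtracted
     before that entry is divided. *)
  pose V1 x := S2 * h x * (l.+2%:R)^-1.
  have sV1 : smooth_germ V1 by rewrite /V1; smooth_tac.
  have sW : smooth_germ (fun x => C11 x - V1 x * (S1 * (k.+2%:R * x 0 1 ^+ k.+1))) by smooth_tac.
  have [P [g' [h' [sP sg' sh' E']]]] := smooth_division true k.+2 sW.
  exists P, Q, 0; split; first by rewrite size_poly0.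
  exists (fun x => C12 x - (S1 * x 0 1 ^+ k.+2 * (g x * 2^-1) + x 0 0 * (S1 * h' x * 2^-1) +
      S2 * x 0 1 ^+ l.+2 * (g' x * 2^-1))),
    V1, (fun x => S1 * h' x * 2^-1), (fun x => g x * 2^-1), (fun x => g' x * 2^-1), (cst 0); split; [by split; smooth_tac|by split; smooth_tac|].
  near=> x.
  have E1 : C22 x = Q.[x 0 1] + x 0 0 * g x + x 0 1 ^+ l.+1 * h x by near: x.
  have E2 : C11 x - V1 x * (S1 * (k.+2%:R * x 0 1 ^+ k.+1)) = P.[x 0 1] + x 0 0 * g' x + x 0 1 ^+ k.+2 * h' x by near: x.
  have {}E2 : C11 x = P.[x 0 1] + x 0 0 * g' x + x 0 1 ^+ k.+2 * h' x + V1 x * (S1 * (k.+2%:R * x 0 1 ^+ k.+1)) by rewrite -E2; ring.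
  rewrite /tang_at /slot1 /coord E1 E2 horner0 /V1 /= ![x 0 1 ^+ l.+2]exprS.
  by move: (l.+2%:R) L0 => L L0; split; case: HS1 => ->; case: HS2 => ->; field.
move=> P Q T k0 k1 k00 k01 k10 k11 sP sQ /size_poly_leq0P T0 H.
have S10 : S1 != 0 by case: HS1 => ->; rewrite ?oppr_eq0 oner_eq0.
have S20 : S2 != 0 by case: HS2 => ->; rewrite ?oppr_eq0 oner_eq0.
have [V0 [V1 [u00 [u01 [u10 [u11 [[? ? ?] [? ? ?] [[K0 K1 K00] [K01 K10 K11]] E]]]]]]] := H 0 1.
have Q0 : Q = 0.
  apply: (@poly_near_eq0 _ 0 l.+1 Q (fun t => S2 * l.+2%:R * V1 t + 2 * S2 * (t * u11 t))) => //; first by c0_tac.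
  apply: filterS E => t [_ _ E]; line_simp E.
  by rewrite ?T0 ?horner0 in E; line_simp E; rewrite E !exprS; ring.
(* Once Q = 0, the 22 equation forces V1(0) = 0. V1 then contributes nothing to the coefficient of
   x2^(l1-1) in the 11 entry, so that monomial is independent too. *)
have K : k1 = 0.
  pose h t := S2 * l.+2%:R * V1 t + 2 * S2 * (t * u11 t).
  have : h 0 = 0.
    apply: (@c0_eq0 _ l.+1); first by rewrite /h; c0_tac.
    apply: filterS E => t [_ _ E]; line_simp E.
    rewrite ?T0 ?Q0 ?horner0 in E; line_simp E.
    by rewrite /h [RHS]E !exprS; ring.
  rewrite /h K1 !mul0r !mulr0 addr0 => /eqP.
  by rewrite !mulf_eq0 (negPf L0) (negPf S20) => /eqP.
split=> //.
apply: (@poly_near_eq0_strong _ 0 k.+1 P (fun t => S1 * k.+2%:R * V1 t + 2 * S1 * (t * u00 t))) => //; first by c0_tac.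
  by rewrite K1 K; ring.
apply: filterS E => t [E _ _]; line_simp E.
by rewrite E !exprS; ring.
Unshelve. all: by end_near. Qed.

(** The surviving monomials are 1 in the 12 entry and 1, x2, x2^2, x1, x1 x2 in the 22 entry. The
    monomial x2^2 stays because its generator u01 also puts x1 into the 12 entry. *)
Lemma codim_nf6 s : Ge_codim (@nf6 R s) 6.
Proof.
rewrite /nf6; have := sign_cases s; move: ((-1) ^+ s : R) => S HS.
have Ha := @pder_x R.
have Hb : pder (fun _ y : R => y ^+ 2) (fun _ _ => 0) (fun _ y => 2 * y).
  by apply: pder_eq; [pder_tac| |] => x y /=; ring.
have Hd : pder (fun x _ : R => S * x ^+ 2) (fun x _ => S * (2 * x)) (fun _ _ => 0).
  by apply: pder_eq; [pder_tac| |] => x y /=; ring.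
apply: (codim_sym2 Ha Hb Hd (e1 := false) (c1 := true) (c2 := true) (p := 1) (q := 3) (r := 2)).
  move=> C11 C12 C22 s11 s12 s22.
  have [P [p [q [sP sp sq EP]]]] := smooth_division true 1 s12.
  have [pa [pb [spa spb Ep _]]] := hadamard2 sp.
  have sW : smooth_germ (fun x => C22 x - 2 * S * (x 0 0 * C11 x)) by smooth_tac.
  have [Q [g [g3 [sQ sg sg3 EQ]]]] := smooth_division true 3 sW.
  have [T [g1 [g2 [sT sg1 sg2 ET]]]] := smooth_division true 2 sg.
  (* Cancelling x1 p in the 12 entry by u01 adds 2 x2^2 p(0) to the 22 entry, which is moved into
     the remainder Q. *)
  exists P, (Q - (2 * p 0) *: 'X^2), T; split; first by split=> //; exact: size_subZXn.
  (* In the 22 entry S x1 x2^2 u10 occurs with coefficient -4 through V0 and -2 through u01, hence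
     the 6; the 4 in [u00] comes from V0 alone. *)
  pose u10 x := - S * (g2 x - 2 * pa x) * 6^-1.
  pose rr x := g3 x * 2^-1 - pb x.
  pose u00 x := - S * g1 x * 4^-1.
  have s10 : smooth_germ u10 by rewrite /u10; smooth_tac.
  have srr : smooth_germ rr by rewrite /rr; smooth_tac.
  have s00 : smooth_germ u00 by rewrite /u00; smooth_tac.
  exists (fun x => C11 x - 2 * (x 0 0 * u00 x) - 2 * (x 0 1 ^+ 2 * u10 x)),
    (fun x => (q x - x 0 1 * u00 x - x 0 0 * rr x) * 2^-1), u00,
    (fun x => p x - S * (x 0 0 * u10 x) + x 0 1 * rr x), u10, (cst 0); split; [by split; smooth_tac|by split; smooth_tac|].
  near=> x.
  have E1 : C12 x = P.[x 0 1] + x 0 0 * p x + x 0 1 ^+ 1 * q x by near: x.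
  have E2 : p x = p 0 + x 0 0 * pa x + x 0 1 * pb x by near: x.
  have E3 : C22 x - 2 * S * (x 0 0 * C11 x) = Q.[x 0 1] + x 0 0 * g x + x 0 1 ^+ 3 * g3 x by near: x.
  have E4 : g x = T.[x 0 1] + x 0 0 * g1 x + x 0 1 ^+ 2 * g2 x by near: x.
  have {}E3 : C22 x = Q.[x 0 1] + x 0 0 * g x + x 0 1 ^+ 3 * g3 x + 2 * S * (x 0 0 * C11 x) by rewrite -E3; ring.
  rewrite /tang_at /slot1 /coord E1 E3 E4 E2 /u10 /u00 /rr hornerD hornerN hornerZ hornerXn /=.
  by split; case: HS => ->; field.
move=> P Q T k0 k1 k00 k01 k10 k11 sP sQ sT H.
have P0 : P = 0.
  have [V0 [V1 [u00 [u01 [u10 [u11 [[? ? ?] [? ? ?] [[K0 K1 K00] [K01 K10 K11]] E]]]]]]] := H 0 1.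
  apply: (@poly_near_eq0 _ 0 1 P (fun t => 2 * V1 t + t * u11 t + t * u00 t)) => //; first by c0_tac.
  apply: filterS E => t [_ E _]; line_simp E.
  by rewrite E; ring.
(* The 12 equation on the x1-axis gives u01(0) = 0, so on the x2-axis the term 2 x2^2 u01 is o(t^2)
   and the coefficient of x2^2 in Q must vanish. *)
have K : k01 = 0.
  have [V0 [V1 [u00 [u01 [u10 [u11 [[? ? ?] [? ? ?] [[K0 K1 K00] [K01 K10 K11]] E]]]]]]] := H 1 0.
  pose h t := u01 t + S * (t * u10 t).
  transitivity (h 0); first by rewrite /h K01 mul0r mulr0 addr0.
  apply: (@c0_eq0 _ 1); first by rewrite /h; c0_tac.
  apply: filterS E => t [_ E _]; line_simp E.
  by rewrite ?P0 ?horner0 in E; rewrite /h [RHS]E; ring.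
have Q0 : Q = 0.
  have [V0 [V1 [u00 [u01 [u10 [u11 [[? ? ?] [? ? ?] [[K0 K1 K00] [K01 K10 K11]] E]]]]]]] := H 0 1.
  apply: (@poly_near_eq0_strong _ 0 2 Q (fun t => 2 * u01 t)) => //; first by c0_tac.
    by rewrite K01 K mulr0.
  apply: filterS E => t [_ _ E]; line_simp E.
  by rewrite E; ring.
split=> //.
(* On each of the lines (1, 1) and (1, -1) the 22 equation is of second order in t apart from T, and
   the second-order coefficient is the same combination of values at 0. *)
have [h [ch Eh EE]] : exists h : R -> R, [/\ c0 h, h 0 = - 4 * S * k00 + 2 * k01 + 2 * S * k11 &
    \forall t \near (0 : R), t * (T.[t] - t * h t) = 0].
  have [V0 [V1 [u00 [u01 [u10 [u11 [[? ? ?] [? ? ?] [[K0 K1 K00] [K01 K10 K11]] E]]]]]]] := H 1 1.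
  exists (fun t => - 4 * S * (u00 t + t * u10 t) + 2 * u01 t + 2 * S * u11 t); split.
  - by c0_tac.
  - by rewrite K00 K01 K11; ring.
  apply: filterS E => t [E1 _ E]; line_simp E1; line_simp E.
  rewrite ?Q0 ?horner0 in E; line_simp E.
  have V : V0 t = - 2 * (t * u00 t + t ^+ 2 * u10 t) by move: E1; lra.
  by rewrite mulrBr E V; ring.
have [V0 [V1 [u00 [u01 [u10 [u11 [[? ? ?] [? ? ?] [[K0 K1 K00] [K01 K10 K11]] E]]]]]]] := H 1 (-1).
pose h' t := - 4 * S * (u00 t + t * u10 t) + 2 * u01 t + 2 * S * u11 t.
apply: (@affine_near_eq0 _ T h h') => //; first by rewrite /h'; c0_tac.
  by rewrite Eh /h' K00 K01 K11; ring.
apply: filterS E => t [E1 _ E]; line_simp E1; line_simp E.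
rewrite ?Q0 ?horner0 in E; rewrite !mulrN1 in E E1; line_simp E.
have V : V0 t = - 2 * (t * u00 t + t ^+ 2 * u10 t) by move: E1; lra.
by rewrite mulrBr E V /h'; ring.
Unshelve. all: by end_near. Qed.

(** The 12 entry is free modulo (x1, x2^2) and leaves two monomials. After V0 has absorbed the 11
    entry, the 22 entry is free modulo (x2, x1^l) and leaves l. *)
Lemma codim_nf7 s1 s2 l : (2 <= l)%N -> Ge_codim (@nf7 R s1 s2 l) (l + 2).
Proof.
move=> l2; have -> : (l + 2 = 2 + (l - 2).+2 + 0)%N by lia.
have -> : l = (l - 2).+2 by rewrite -addn2 subnK.
rewrite !subSS !subn0; move: (l - 2)%N => {l2}l; rewrite /nf7.
have := sign_cases s1; move: ((-1) ^+ s1 : R) => S1 HS1.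
have := sign_cases s2; move: ((-1) ^+ s2 : R) => S2 HS2.
have Ha := @pder_x R; have Hb := @pder_cst R 0.
have Hd : pder (fun x y : R => S1 * y ^+ 2 + S2 * x ^+ l.+2)
    (fun x _ => S2 * (l.+2%:R * x ^+ l.+1)) (fun _ y => S1 * (2 * y)).
  by apply: pder_eq; [pder_tac| |] => x y /=; ring.
apply: (codim_sym2 Ha Hb Hd (e1 := false) (c1 := true) (c2 := false)).
  move=> C11 C12 C22 s11 s12 s22.
  have [P [g [h [sP sg sh EP]]]] := smooth_division true 2 s12.
  have sW : smooth_germ (fun x => C22 x - C11 x * (S2 * (l.+2%:R * x 0 0 ^+ l.+1))) by smooth_tac.
  have [Q [g' [h' [sQ sg' sh' EQ]]]] := smooth_division false l.+2 sW.
  exists P, Q, 0; split; first by rewrite size_poly0.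
  exists C11, (fun x => S1 * (g' x - S1 * S2 * (x 0 1 * h' x)) * 2^-1), (cst 0),
    (fun x => g x - S1 * S2 * (x 0 0 ^+ l.+1 * h x)), (fun x => S1 * h x), (fun x => S2 * h' x * 2^-1); split; [by split; smooth_tac|by split; smooth_tac|].
  near=> x.
  have E1 : C12 x = P.[x 0 1] + x 0 0 * g x + x 0 1 ^+ 2 * h x by near: x.
  have E2 : C22 x - C11 x * (S2 * (l.+2%:R * x 0 0 ^+ l.+1)) = Q.[x 0 0] + x 0 1 * g' x + x 0 0 ^+ l.+2 * h' x by near: x.
  have {}E2 : C22 x = Q.[x 0 0] + x 0 1 * g' x + x 0 0 ^+ l.+2 * h' x + C11 x * (S2 * (l.+2%:R * x 0 0 ^+ l.+1)) by rewrite -E2; ring.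
  rewrite /tang_at /slot1 /coord E1 E2 horner0 /= ![x 0 0 ^+ l.+2]exprS.
  by split; case: HS1 => ->; case: HS2 => ->; field.
move=> P Q T k0 k1 k00 k01 k10 k11 sP sQ /size_poly_leq0P T0 H; split=> //.
  have [V0 [V1 [u00 [u01 [u10 [u11 [[? ? ?] [? ? ?] [[K0 K1 K00] [K01 K10 K11]] E]]]]]]] := H 0 1.
  apply: (@poly_near_eq0 _ 0 2 P (fun t => S1 * u10 t)) => //; first by c0_tac.
  apply: filterS E => t [_ E _]; line_simp E.
  by rewrite E; ring.
have [V0 [V1 [u00 [u01 [u10 [u11 [[? ? ?] [? ? ?] [[K0 K1 K00] [K01 K10 K11]] E]]]]]]] := H 1 0.
apply: (@poly_near_eq0 _ 0 l.+2 Q (fun t => - 2 * S2 * l.+2%:R * u00 t + 2 * S2 * u11 t)) => //; first by c0_tac.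
apply: filterS E => t [E1 _ E]; line_simp E1; line_simp E.
rewrite ?T0 ?horner0 in E; line_simp E.
have V : V0 t = - 2 * t * u00 t by move: E1; lra.
by rewrite E V !exprS; ring.
Unshelve. all: by end_near. Qed.

(** The 12 entry leaves l monomials modulo (x2, x1^l). In the 22 entry V0 multiplies a combination
    of x2 and x1^(l-1) with nonzero coefficients: x2 becomes a multiple of x1^(l-1), which stays,
    and this gives l more. *)
Lemma codim_nf8 e s l : (3 <= l)%N -> Ge_codim (@nf8 R e s l) (2 * l).
Proof.
move=> l3; have -> : (2 * l = (l - 3).+3 + (l - 3).+3 + 0)%N by lia.
have -> : l = (l - 3).+3 by rewrite -addn3 subnK.
rewrite !subSS !subn0; move: (l - 3)%N => {l3}l; rewrite /nf8.
have := sign_cases e; move: ((-1) ^+ e : R) => S1 HS1.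
have := sign_cases s; move: ((-1) ^+ s : R) => S2 HS2.
have Ha := @pder_y R; have Hb := @pder_cst R 0.
have Hd : pder (fun x y : R => S1 * (x * y) + S2 * x ^+ l.+3)
    (fun x y => S1 * y + S2 * (l.+3%:R * x ^+ l.+2)) (fun x _ => S1 * x).
  by apply: pder_eq; [pder_tac| |] => x y /=; ring.
apply: (codim_sym2 Ha Hb Hd (e1 := false) (c1 := false) (c2 := false)).
  move=> C11 C12 C22 s11 s12 s22.
  have [P [g [h [sP sg sh EP]]]] := smooth_division false l.+3 s12.
  have sW : smooth_germ (fun x => C22 x - S1 * (x 0 0 * C11 x)) by smooth_tac.
  have [Q [g' [h' [sQ sg' sh' EQ]]]] := smooth_division false l.+3 sW.
  have [ga [gb [sga sgb Eg _]]] := hadamard2 sg'.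
  (* Removing x2 g' by V0 costs l g'(0) x1^(l-1) up to sign. After the shift of l, the exponent l -
     1 reads [l.+2]. *)
  exists P, (Q - (S1 * S2 * l.+3%:R * g' 0) *: 'X^(l.+2)), 0; split.
    by rewrite size_poly0; split=> //; exact: size_subZXn.
  pose H x := h' x - S1 * S2 * l.+3%:R * ga x.
  pose u00 x := (S2 * H x + S2 * l.+3%:R * (x 0 0 ^+ l.+1 * gb x)) * 2^-1.
  have sH : smooth_germ H by rewrite /H; smooth_tac.
  have s00 : smooth_germ u00 by rewrite /u00; smooth_tac.
  exists (fun x => S1 * g' x), (fun x => C11 x - 2 * (x 0 1 * u00 x)), u00,
    (fun x => g x - S1 * S2 * (x 0 0 * h x)), (fun x => S2 * h x), (fun x => S2 * H x * 2^-1); split; [by split; smooth_tac|by split; smooth_tac|].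
  near=> x.
  have E1 : C12 x = P.[x 0 0] + x 0 1 * g x + x 0 0 ^+ l.+3 * h x by near: x.
  have E2 : C22 x - S1 * (x 0 0 * C11 x) = Q.[x 0 0] + x 0 1 * g' x + x 0 0 ^+ l.+3 * h' x by near: x.
  have E3 : g' x = g' 0 + x 0 0 * ga x + x 0 1 * gb x by near: x.
  have {}E2 : C22 x = Q.[x 0 0] + x 0 1 * g' x + x 0 0 ^+ l.+3 * h' x + S1 * (x 0 0 * C11 x) by rewrite -E2; ring.
  rewrite /tang_at /slot1 /coord E1 E2 E3 /u00 /H horner0 hornerD hornerN hornerZ hornerXn /= !exprS.
  by move: (l.+3%:R) => L; split; case: HS1 => ->; case: HS2 => ->; field.
move=> P Q T k0 k1 k00 k01 k10 k11 sP sQ /size_poly_leq0P T0 H; split=> //.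
  have [V0 [V1 [u00 [u01 [u10 [u11 [[? ? ?] [? ? ?] [[K0 K1 K00] [K01 K10 K11]] E]]]]]]] := H 1 0.
  apply: (@poly_near_eq0 _ 0 l.+3 P (fun t => S2 * u10 t)) => //; first by c0_tac.
  apply: filterS E => t [_ E _]; line_simp E.
  by rewrite E; ring.
(* On the x2-axis the 22 equation reduces to t V0 = 0 up to sign, so V0(0) = 0; on the x1-axis the
   term in x1^(l-1) is then o(t^(l-1)). *)
have K : k0 = 0.
  have [V0 [V1 [u00 [u01 [u10 [u11 [[? ? ?] [? ? ?] [[K0 K1 K00] [K01 K10 K11]] E]]]]]]] := H 0 1.
  have Q00 : Q.[0] = 0.
    have [_ _] := nbhs_singleton E; rewrite T0 horner0 !mul0r !mulr0 !addr0 => ->.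
    by rewrite !exprS; ring.
  pose h t := S1 * V0 t.
  have : h 0 = 0.
    apply: (@c0_eq0 _ 1); first by rewrite /h; c0_tac.
    apply: filterS E => t [_ _ E]; rewrite mulr0 Q00 T0 horner0 ?mulr0 ?mul0r ?addr0 !exprS in E.
    by rewrite /h [RHS]E; ring.
  by rewrite /h K0; case: HS1 => -> ?; lra.
have [V0 [V1 [u00 [u01 [u10 [u11 [[? ? ?] [? ? ?] [[K0 K1 K00] [K01 K10 K11]] E]]]]]]] := H 1 0.
apply: (@poly_near_eq0_strong _ 0 l.+2 Q (fun t => S2 * l.+3%:R * V0 t + 2 * S2 * (t * u11 t))) => //; first by c0_tac.
  by rewrite K0 K; ring.
apply: filterS E => t [E1 _ E]; line_simp E1; line_simp E.
rewrite ?T0 ?horner0 in E; line_simp E.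
have V : V1 t = 0 by move: E1; lra.
by rewrite E V !exprS; ring.
Unshelve. all: by end_near. Qed.

(** The two entries are coupled: removing x1 from the 22 entry by V1 leaves x2^(l-1) in the 12
    entry, and removing x1 from the 12 entry by u01 leaves x2^l in the 22 entry. Hence l monomials
    survive in the 12 entry and l + 1 in the 22 entry. *)
Lemma codim_nf9 e l : (2 <= l)%N -> Ge_codim (@nf9 R e l) (2 * l + 1).
Proof.
move=> l2; have -> : (2 * l + 1 = (l - 2).+2 + (l - 2).+3 + 0)%N by lia.
have -> : l = (l - 2).+2 by rewrite -addn2 subnK.
rewrite !subSS !subn0; move: (l - 2)%N => {l2}l; rewrite /nf9.
have := sign_cases e; move: ((-1) ^+ e : R) => S HS.
have Ha : pder (fun x _ : R => S * x) (fun _ _ => S) (fun _ _ => 0).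
  by apply: pder_eq; [pder_tac| |] => x y /=; ring.
have Hb : pder (fun _ y : R => y ^+ l.+2) (fun _ _ => 0) (fun _ y => l.+2%:R * y ^+ l.+1).
  by apply: pder_eq; [pder_tac| |] => x y /=; ring.
have Hd : pder (fun x y : R => S * (x * y)) (fun _ y => S * y) (fun x _ => S * x).
  by apply: pder_eq; [pder_tac| |] => x y /=; ring.
have L0 : 2 * l.+2%:R + 1 != 0 :> R by rewrite gt_eqF// ltr_wpDl// mulr_ge0.
apply: (codim_sym2 Ha Hb Hd (e1 := false) (c1 := true) (c2 := true)).
  move=> C11 C12 C22 s11 s12 s22.
  have [P [p [q [sP sp sq EP]]]] := smooth_division true l.+2 s12.
  have [p1 [p2 [sp1 sp2 Ep _]]] := hadamard2 sp.
  have sW : smooth_germ (fun x => C22 x - x 0 1 * C11 x) by smooth_tac.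
  have [Q [g [h [sQ sg sh EQ]]]] := smooth_division true l.+3 sW.
  have [g1 [g2 [sg1 sg2 Eg _]]] := hadamard2 sg.
  (* The two subtracted monomials are the constant-term costs of V1 and u01 in the opposite
     entries. *)
  exists (P - (l.+2%:R * S * g 0) *: 'X^(l.+1)), (Q - (2 * S * p 0) *: 'X^(l.+2)), 0; split.
    by rewrite size_poly0; split=> //; exact: size_subZXn.
  pose M x := S * (p2 x - l.+2%:R * S * (x 0 1 ^+ l * g1 x)).
  pose K x := S * (g2 x - 2 * S * (x 0 1 ^+ l.+1 * p1 x)).
  pose w x := (M x + h x * 2^-1) * 2^-1.
  pose u10 x := (M x - h x * 2^-1) * 2^-1.
  (* With l the original exponent, [v] and [u00] solve l v + u00 = q and v - 2 u00 = K; eliminating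
     u00 gives (2 l + 1) v = 2 q + K. The formulas for [w] and [u10] solve w + u10 = M and w - u10 =
     h/2. *)
  pose v x := (2 * q x + K x) * (2 * l.+2%:R + 1)^-1.
  pose u00 x := (v x - K x) * 2^-1.
  have sM : smooth_germ M by rewrite /M; smooth_tac.
  have sK : smooth_germ K by rewrite /K; smooth_tac.
  have sw : smooth_germ w by rewrite /w; smooth_tac.
  have s10 : smooth_germ u10 by rewrite /u10; smooth_tac.
  have sv : smooth_germ v by rewrite /v; smooth_tac.
  have s00 : smooth_germ u00 by rewrite /u00; smooth_tac.
  exists (fun x => S * (C11 x - 2 * S * (x 0 0 * u00 x) - 2 * (x 0 1 ^+ l.+2 * u10 x))),
    (fun x : 'rV[R]_2 => S * (g 0 + x 0 0 * g1 x) + x 0 1 * v x), u00,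
    (fun x : 'rV[R]_2 => S * (p 0 + x 0 0 * p1 x) + x 0 1 * w x), u10, (cst 0); split; [by split; smooth_tac|by split; smooth_tac|].
  near=> x.
  have E1 : C12 x = P.[x 0 1] + x 0 0 * p x + x 0 1 ^+ l.+2 * q x by near: x.
  have E2 : C22 x - x 0 1 * C11 x = Q.[x 0 1] + x 0 0 * g x + x 0 1 ^+ l.+3 * h x by near: x.
  have E3 : p x = p 0 + x 0 0 * p1 x + x 0 1 * p2 x by near: x.
  have E4 : g x = g 0 + x 0 0 * g1 x + x 0 1 * g2 x by near: x.
  have {}E2 : C22 x = Q.[x 0 1] + x 0 0 * g x + x 0 1 ^+ l.+3 * h x + x 0 1 * C11 x by rewrite -E2; ring.
  rewrite /tang_at /slot1 /coord E1 E2 E3 E4 /u00 /u10 /v /w /M /K horner0 !hornerD !hornerN !hornerZ !hornerXn /= !exprS.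
  by move: (l.+2%:R) L0 => L L0; split; case: HS => ->; field.
move=> P Q T k0 k1 k00 k01 k10 k11 sP sQ /size_poly_leq0P T0 H.
have S0 : S != 0 by case: HS => ->; rewrite ?oppr_eq0 oner_eq0.
(* On the x1-axis the 22 and 12 equations are t V1 = 0 and t u01 = 0 up to sign, so both generators
   vanish at 0 and cannot reach x2^(l-1) or x2^l on the x2-axis. *)
have [K1E K01E] : k1 = 0 /\ k01 = 0.
  have [V0 [V1 [u00 [u01 [u10 [u11 [[? ? ?] [? ? ?] [[K0 K1 K00] [K01 K10 K11]] E]]]]]]] := H 1 0.
  have [_ EP EQ] := nbhs_singleton E.
  have P00 : P.[0] = 0 by move: EP; rewrite /= mul0r !exprS => ->; ring.
  have Q00 : Q.[0] = 0 by move: EQ; rewrite /= T0 horner0 !mul0r !exprS => EQ; move: EQ; rewrite addr0 => ->; ring.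
  split.
    pose h t := S * V1 t.
    have : h 0 = 0.
      apply: (@c0_eq0 _ 1); first by rewrite /h; c0_tac.
      apply: filterS E => t [_ _ E]; rewrite mulr0 Q00 T0 horner0 ?mulr0 ?mul0r ?addr0 !exprS in E.
      by rewrite /h [RHS]E; ring.
    by rewrite /h K1; case: HS => -> ?; lra.
  pose h t := S * u01 t.
  have : h 0 = 0.
    apply: (@c0_eq0 _ 1); first by rewrite /h; c0_tac.
    apply: filterS E => t [_ E _]; rewrite /= mulr0 P00 !exprS in E.
    by rewrite /h [RHS]E; ring.
  by rewrite /h K01; case: HS => -> ?; lra.
have [V0 [V1 [u00 [u01 [u10 [u11 [[? ? ?] [? ? ?] [[K0 K1 K00] [K01 K10 K11]] E]]]]]]] := H 0 1.
split=> //.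
  apply: (@poly_near_eq0_strong _ 0 l.+1 P (fun t => l.+2%:R * V1 t + t * u11 t + t * u00 t)) => //; first by c0_tac.
    by rewrite K1 K1E; ring.
  apply: filterS E => t [_ E _]; line_simp E.
  by rewrite E !exprS; ring.
apply: (@poly_near_eq0_strong _ 0 l.+2 Q (fun t => 2 * u01 t - 2 * (t * u10 t))) => //; first by c0_tac.
  by rewrite K01 K01E; ring.
apply: filterS E => t [E1 _ E]; line_simp E1; line_simp E.
rewrite ?T0 ?horner0 in E; line_simp E.
have V : V0 t * S = - 2 * (t ^+ l.+2 * u10 t) by move: E1; lra.
have -> : Q.[t] = t * (V0 t * S) + 2 * (t ^+ l.+2 * u01 t) by rewrite E; ring.
by rewrite V; ring.
Unshelve. all: by end_near. Qed.

(** The 12 entry leaves 1, x2, x2^2 modulo (x1, x2^3). In the 22 entry V1 yields multiples of x2^2,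
    and u00, once V0 restores the 11 entry, multiples of x1^2; this leaves 1, x2, x1, x1 x2. *)
Lemma codim_nf10 s e : Ge_codim (@nf10 R s e) 7.
Proof.
rewrite /nf10; have := sign_cases s; move: ((-1) ^+ s : R) => S1 HS1.
have := sign_cases e; move: ((-1) ^+ e : R) => S2 HS2.
have Ha := @pder_x R; have Hb := @pder_cst R 0.
have Hd : pder (fun x y : R => S1 * x ^+ 2 + S2 * y ^+ 3)
    (fun x _ => S1 * (2 * x)) (fun _ y => S2 * (3 * y ^+ 2)).
  by apply: pder_eq; [pder_tac| |] => x y /=; ring.
apply: (codim_sym2 Ha Hb Hd (e1 := false) (c1 := true) (c2 := true) (p := 3) (q := 2) (r := 2)).
  move=> C11 C12 C22 s11 s12 s22.
  have [P [g [h [sP sg sh EP]]]] := smooth_division true 3 s12.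
  have sW : smooth_germ (fun x => C22 x - 2 * S1 * (x 0 0 * C11 x)) by smooth_tac.
  have [Q [g' [h' [sQ sg' sh' EQ]]]] := smooth_division true 2 sW.
  have [T [g1 [g2 [sT sg1 sg2 ET]]]] := smooth_division true 2 sg'.
  exists P, Q, T; split=> //.
  exists (fun x => C11 x - 2 * (x 0 0 * (- S1 * g1 x * 4^-1))), (fun x => S2 * (h' x + x 0 0 * g2 x) * 3^-1),
    (fun x => - S1 * g1 x * 4^-1),
    (fun x => g x - S1 * S2 * (x 0 0 * h x)), (fun x => S2 * h x), (cst 0); split; [by split; smooth_tac|by split; smooth_tac|].
  near=> x.
  have E1 : C12 x = P.[x 0 1] + x 0 0 * g x + x 0 1 ^+ 3 * h x by near: x.
  have E2 : C22 x - 2 * S1 * (x 0 0 * C11 x) = Q.[x 0 1] + x 0 0 * g' x + x 0 1 ^+ 2 * h' x by near: x.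
  have E3 : g' x = T.[x 0 1] + x 0 0 * g1 x + x 0 1 ^+ 2 * g2 x by near: x.
  have {}E2 : C22 x = Q.[x 0 1] + x 0 0 * g' x + x 0 1 ^+ 2 * h' x + 2 * S1 * (x 0 0 * C11 x) by rewrite -E2; ring.
  rewrite /tang_at /slot1 /coord E1 E2 E3 /=.
  by split; case: HS1 => ->; case: HS2 => ->; field.
move=> P Q T k0 k1 k00 k01 k10 k11 sP sQ sT H.
have P0 : P = 0.
  have [V0 [V1 [u00 [u01 [u10 [u11 [[? ? ?] [? ? ?] [[K0 K1 K00] [K01 K10 K11]] E]]]]]]] := H 0 1.
  apply: (@poly_near_eq0 _ 0 3 P (fun t => S2 * u10 t)) => //; first by c0_tac.
  apply: filterS E => t [_ E _]; line_simp E.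
  by rewrite E; ring.
have Q0 : Q = 0.
  have [V0 [V1 [u00 [u01 [u10 [u11 [[? ? ?] [? ? ?] [[K0 K1 K00] [K01 K10 K11]] E]]]]]]] := H 0 1.
  apply: (@poly_near_eq0 _ 0 2 Q (fun t => 3 * S2 * V1 t + 2 * S2 * (t * u11 t))) => //; first by c0_tac.
  apply: filterS E => t [_ _ E]; line_simp E.
  by rewrite E; ring.
split=> //.
(* As P and Q vanish, T is tested on the lines (1, 1) and (1, -1); the cubic term x2^3 changes sign
   between them but does not affect the value of h at 0. *)
have [h [ch Eh EE]] : exists h : R -> R, [/\ c0 h, h 0 = - 4 * S1 * k00 + 3 * S2 * k1 + 2 * S1 * k11 &
    \forall t \near (0 : R), t * (T.[t] - t * h t) = 0].
  have [V0 [V1 [u00 [u01 [u10 [u11 [[? ? ?] [? ? ?] [[K0 K1 K00] [K01 K10 K11]] E]]]]]]] := H 1 1.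
  exists (fun t => - 4 * S1 * u00 t + 3 * S2 * V1 t + 2 * (S1 + S2 * t) * u11 t); split.
  - by c0_tac.
  - by rewrite K00 K1 K11; ring.
  apply: filterS E => t [E1 _ E]; line_simp E1; line_simp E.
  rewrite ?Q0 ?horner0 in E; line_simp E.
  have V : V0 t = - 2 * (t * u00 t) by move: E1; lra.
  by rewrite mulrBr E V; ring.
have [V0 [V1 [u00 [u01 [u10 [u11 [[? ? ?] [? ? ?] [[K0 K1 K00] [K01 K10 K11]] E]]]]]]] := H 1 (-1).
pose h' t := - 4 * S1 * u00 t + 3 * S2 * V1 t + 2 * (S1 - S2 * t) * u11 t.
apply: (@affine_near_eq0 _ T h h') => //; first by rewrite /h'; c0_tac.
  by rewrite Eh /h' K00 K1 K11; ring.
apply: filterS E => t [E1 _ E]; line_simp E1; line_simp E.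
rewrite ?Q0 ?horner0 in E; rewrite !mulrN1 in E; line_simp E.
have V : V0 t = - 2 * (t * u00 t) by move: E1; lra.
by rewrite mulrBr E V /h'; ring.
Unshelve. all: by end_near. Qed.

End CodimensionNormalForms.

(** * Quasi-homogeneity data and the split classes *)

Section QuasiHomogeneityData.
Context {R : realType}.

Lemma qh_data_of_exact (A : 'rV[R]_2 -> 'M[R]_2) c a b delta : (0 < a)%N ->
  exact_qh A (pair_weights a b) delta -> Ge_codim A c -> qh_data A c a b.
Proof.
move=> a0 qA cA; have w0 : (0 < \sum_k pair_weights a b k)%N.
  by rewrite big_ord_recl ltn_addr.
split=> //; first exact: exact_qh_sym_quasi_homogeneous w0 qA.
exact: exact_qh_sym_qh_in w0 qA.
Qed.

Lemma two_classes_nf8 s l : (3 <= l)%N ->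
  two_vp_classes dx1dx2 (@nf8 R false s l) (@nf8 R false s l) (@nf8 R true (odd l (+) s) l).
Proof.
move=> l3; have [M [Y MY]] := @reflects_nf8 R s l.
have l0 : (0 < l)%N by exact: leq_trans l3.
have w k : (0 < pair_weights 1 (l - 1) k)%N.
  by apply: pair_weights_gt0; rewrite // subn_gt0; exact: leq_trans l3.
exact: (two_vp_classes_of_qh (qh_nf8 _ _ l0) w (qh_nf8 _ _ l0) w MY (not_vp_nf8 l3)).
Qed.

Lemma two_classes_nf9 l : (2 <= l)%N ->
  two_vp_classes dx1dx2 (@nf9 R false l) (@nf9 R false l) (@nf9 R true l).
Proof.
move=> l2; have [M [Y MY]] := @reflects_nf9 R l.
have l0 : (0 < l)%N by exact: leq_trans l2.
have w k : (0 < pair_weights (2 * l - 1) 2 k)%N by apply: pair_weights_gt0 => //; lia.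
exact: (two_vp_classes_of_qh (qh_nf9 _ l0) w (qh_nf9 _ l0) w MY (not_vp_nf9 l2)).
Qed.

Lemma two_classes_nf10 s :
  two_vp_classes dx1dx2 (@nf10 R s false) (@nf10 R s false) (@nf10 R s true).
Proof.
have [M [Y MY]] := @reflects_nf10 R s.
have w k : (0 < pair_weights 3 2 k)%N by exact: pair_weights_gt0.
exact: (two_vp_classes_of_qh (qh_nf10 _ _) w (qh_nf10 _ _) w MY (@not_vp_nf10 R s)).
Qed.

End QuasiHomogeneityData.

Theorem mainTheorem10 (R : realType) :
  (qh_data (@nf1 R) 1 1 1 /\ one_vp_class dx1dx2 (@nf1 R)) /\
  (qh_data (@nf2 R) 1 1 1 /\ one_vp_class dx1dx2 (@nf2 R)) /\
  (forall (s : bool) (l : nat), (2 <= l)%N ->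
     qh_data (@nf3 R s l) l 2 (l + 1) /\ one_vp_class dx1dx2 (@nf3 R s l)) /\
  (forall l : nat, (2 <= l)%N ->
     qh_data (@nf4 R l) (2 * l - 1) l 1 /\ one_vp_class dx1dx2 (@nf4 R l)) /\
  (forall (s1 s2 : bool) (l1 l2 : nat), (l2 <= l1)%N -> (2 <= l2)%N ->
     qh_data (@nf5 R s1 s2 l1 l2) (l1 + l2 - 1) (l1 + l2) 2 /\
     one_vp_class dx1dx2 (@nf5 R s1 s2 l1 l2)) /\
  (forall s : bool,
     qh_data (@nf6 R s) 6 4 3 /\ one_vp_class dx1dx2 (@nf6 R s)) /\
  (forall (s1 s2 : bool) (l : nat), (2 <= l)%N ->
     qh_data (@nf7 R s1 s2 l) (l + 2) 2 l /\
     one_vp_class dx1dx2 (@nf7 R s1 s2 l)) /\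
  (forall l : nat, (3 <= l)%N ->
     (forall e s : bool, qh_data (@nf8 R e s l) (2 * l) 1 (l - 1)) /\
     (forall s : bool,
        two_vp_classes dx1dx2 (@nf8 R false s l)
          (@nf8 R false s l) (@nf8 R true (odd l (+) s) l))) /\
  (forall l : nat, (2 <= l)%N ->
     (forall e : bool, qh_data (@nf9 R e l) (2 * l + 1) (2 * l - 1) 2) /\
     two_vp_classes dx1dx2 (@nf9 R false l)
       (@nf9 R false l) (@nf9 R true l)) /\
  (forall s : bool,
     (forall e : bool, qh_data (@nf10 R s e) 7 3 2) /\
     two_vp_classes dx1dx2 (@nf10 R s false)
       (@nf10 R s false) (@nf10 R s true)).
Proof.
have ge2_gt0 (l : nat) : (2 <= l)%N -> (0 < l)%N by exact: leq_trans.
split; [|split; [|split; [|split; [|split; [|split; [|split; [|split; [|split]]]]]]]].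
- by split; [exact: qh_data_of_exact qh_nf1 codim_nf1 | exact: one_class_nf1].
- by split; [exact: qh_data_of_exact qh_nf2 codim_nf2 | exact: one_class_nf2].
- move=> s l l2; split; last exact: one_class_nf3.
  exact: qh_data_of_exact (qh_nf3 _ _) (codim_nf3 _ l2).
- move=> l l2; have l0 := ge2_gt0 _ l2; split; last exact: one_class_nf4.
  exact: qh_data_of_exact (qh_nf4 _) (codim_nf4 l2).
- move=> s1 s2 l1 l2 l12 l22; have l11 := leq_trans l22 l12; have l0 := ge2_gt0 _ l11.
  split; last exact: one_class_nf5.
  by apply: qh_data_of_exact (qh_nf5 _ _ _ _) (codim_nf5 _ _ l11 l22); rewrite ltn_addr.
- by move=> s; split; [exact: qh_data_of_exact (qh_nf6 _) (codim_nf6 _) | exact: one_class_nf6].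
- move=> s1 s2 l l2; have l0 := ge2_gt0 _ l2; split; last exact: one_class_nf7.
  exact: qh_data_of_exact (qh_nf7 _ _ _) (codim_nf7 _ _ l2).
- move=> l l3; have l0 : (0 < l)%N by exact: leq_trans l3.
  split=> [e s|s]; last exact: two_classes_nf8.
  exact: qh_data_of_exact (qh_nf8 _ _ l0) (codim_nf8 _ _ l3).
- move=> l l2; have l0 := ge2_gt0 _ l2; split=> [e|]; last exact: two_classes_nf9.
  by apply: qh_data_of_exact (qh_nf9 _ l0) (codim_nf9 _ l2); lia.
- move=> s; split=> [e|]; last exact: two_classes_nf10.
  exact: qh_data_of_exact (qh_nf10 _ _) (codim_nf10 _ _).
Qed.
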